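(* Let $n\ge 3$, let $X_1,\dots,X_{n+1}$ be well-pointed spaces, $\vec m=(m_n,\dots,m_1)$ a sequence of non-negative integers, and let $\vec f=(f_n,\dots,f_1)$, $\vec f'=(f_n',\dots,f_1')$ be two sequences of pointed maps $f_i,f'_i:\Sigma^{m_i}X_i\to X_{i+1}$ with $f_i\simeq f_i'$ for all $1\le i\le n$. Then $\{\vec f\}^{(\star)}_{\vec m}=\{\vec f'\}^{(\star)}_{\vec m}$ for each of the twelve symbols $\star\in\{q,aq,q_2,qs_2,q\dot s_2,q\ddot s_2,aqs_2,aq\dot s_2,aq\ddot s_2,s_t,\dot s_t,\ddot s_t\}$.
   Context: Conventions. All spaces are well-pointed (the inclusion of the base point is a free cofibration, i.e. has the unpointed homotopy extension property); maps and homotopies are pointed; $[X,Y]$ is the set of homotopy classes. $I=[0,1]$ has base point $1$; $S^1=I/\{0,1\}$ with $\bar t$ the class of $t$; $S^k=S^1\wedge\dots\wedge S^1$ ($k$ factors), so $S^a\wedge S^b=S^{a+b}$. $\Sigma^kX=X\wedge S^k$, $CX=X\wedge I$; $Y\cup_fCX$ is the mapping cone of $f:X\to Y$ ($x\wedge 0$ is identified with $f(x)$), $i_f:Y\to Y\cup_fCX$ is the inclusion, and $q'_f:(Y\cup_fCX)\cup_{i_f}CY\to\Sigma X$ collapses $CY$ and sends $x\wedge t$ to $x\wedge\bar t$. For $j:A\to B$ and $h:B\to Y$, $h\cup C1_A:B\cup_jCA\to Y\cup_{h\circ j}CA$ is the induced map. $\tau(A,B):A\wedge B\to B\wedge A$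 is the switch. $\psi^\ell_f:\Sigma^\ell Y\cup_{\Sigma^\ell f}C\Sigma^\ell X\to\Sigma^\ell(Y\cup_fCX)$ is the canonical homeomorphism $x\wedge s\wedge t\mapsto x\wedge t\wedge s$. $\Sigma^{m_{[k,\ell]}}=\Sigma^{m_k}\cdots\Sigma^{m_\ell}$, i.e. $\Sigma^{m_{[k,\ell]}}X=X\wedge S^{m_\ell}\wedge\dots\wedge S^{m_k}$ for $k\ge\ell$; $|\vec m|=m_1+\dots+m_n$; $\Sigma^{|\vec m|}X_1=\Sigma^{m_{[n,1]}}X_1$. $\omega^{-1}$ denotes a homotopy inverse of $\omega$. Iterated mapping cones. A system $\mathscr S=(Y_1,\Sigma Y_2,\dots,\Sigma^{k-1}Y_k;C_1,\dots,C_{k+1};g_1,\dots,g_k;j_1,\dots,j_k)$ with $g_i:\Sigma^{i-1}Y_i\to C_i$, $j_i:C_i\to C_{i+1}$ is a quasi iterated mapping cone of depth $k$ if each $j_i$ is a free cofibration, for every well-pointed $Z$ the sequence $[C_{i+1},Z]\xrightarrow{j_i^*}[C_i,Z]\xrightarrow{g_i^*}[\Sigma^{i-1}Y_i,Z]$ is exact, and there are homotopy equivalences $\omega_i:C_{i+1}\cup_{j_i}CC_i\to\Sigma^iY_i$; such a set $\Omega=\{\omega_i\}$ is a quasi-structure. It is an iterated mapping cone if moreover each $j_i$ is a homotopy cofibre of $g_i$, i.e. there is a homotopy equivalence $a_i:C_{i+1}\to C_i\cup_{g_i}C\Sigma^{i-1}Y_i$ with $a_i\circ j_i=i_{g_i}$;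 such a set $\mathscr A=\{a_i\}$ is a structure, and it yields the quasi-structure $\Omega(\mathscr A)=\{q'_{g_i}\circ(a_i\cup C1_{C_i})\}$. $\mathscr S$ is reduced if $C_2=C_1\cup_{g_1}CY_1$ and $j_1=i_{g_1}$; then $\Omega$ is reduced if $\omega_1=q'_{g_1}$, and $\mathscr A$ is reduced if $a_1=1_{C_2}$. Presentations. Let $\vec f=(f_n,\dots,f_1)$, $f_i:\Sigma^{m_i}X_i\to X_{i+1}$. We consider: a quasi iterated mapping cone $\mathscr S_2=(\Sigma^{m_1}X_1;X_2,C_{2,2};f_1;j_{2,1})$ of depth $1$ and iterated mapping cones $\mathscr S_r=(\Sigma^{m_{r-1}}X_{r-1},\Sigma\Sigma^{m_{[r-1,r-2]}}X_{r-2},\dots,\Sigma^{r-2}\Sigma^{m_{[r-1,1]}}X_1;C_{r,1},\dots,C_{r,r};g_{r,1},\dots,g_{r,r-1};j_{r,1},\dots,j_{r,r-1})$ of depth $r-1$ for $3\le r\le n$, where $C_{r,1}=X_r$, $g_{r,1}=f_{r-1}$; quasi-structures $\Omega_r=\{\omega_{r,s}\mid1\le s<r\}$ and structures $\mathscr A_r$ on $\mathscr S_r$ ($\mathscr A_2$ only if $\mathscr S_2$ is an iterated mapping cone); extensions $\overline{f_r}:\Sigma^{m_r}C_{r,r}\to X_{r+1}$ of $f_r$ for $2\le r<n$ and an extension $\overline{f_n}:\Sigma^{m_n}C_{n,n-1}\to X_{n+1}$ of $f_n$ (extensions along the suspended composites of the $j_{r,s}$). Write $\overline{f_r}^{\,s}$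 for the restriction of $\overline{f_r}$ to $\Sigma^{m_r}C_{r,s}$ along the $j$'s. Put $\widetilde\Sigma^{m_r}\omega_{r,s}=(1_{\Sigma^{m_{[r-1,r-s]}}X_{r-s}}\wedge\tau(S^s,S^{m_r}))\circ\Sigma^{m_r}\omega_{r,s}\circ\psi^{m_r}_{j_{r,s}}:\Sigma^{m_r}C_{r,s+1}\cup C\Sigma^{m_r}C_{r,s}\to\Sigma^s\Sigma^{m_{[r,r-s]}}X_{r-s}$. Let $T(\mathscr S_r,\overline{f_r},\Omega_r)$ be the system of depth $r$ with spaces $C_{r+1,1}=X_{r+1}$, $C_{r+1,s+1}=X_{r+1}\cup_{\overline{f_r}^{\,s}}C\Sigma^{m_r}C_{r,s}$ $(1\le s\le r)$, with $j_{r+1,1}=i_{f_r}$, $j_{r+1,s+1}=1_{X_{r+1}}\cup C\Sigma^{m_r}j_{r,s}$, $g_{r+1,1}=f_r$, $g_{r+1,s+1}=(\overline{f_r}^{\,s+1}\cup C1_{\Sigma^{m_r}C_{r,s}})\circ(\widetilde\Sigma^{m_r}\omega_{r,s})^{-1}$. It carries the reduced quasi-structure $\widetilde{\Omega_r}$ whose first member is $q'_{f_r}$ and whose $(s+1)$-st member is $\Sigma\widetilde\Sigma^{m_r}\omega_{r,s}\circ q\circ\xi$, where $\xi:(X_{r+1}\cup C\Sigma^{m_r}C_{r,s+1})\cup C(X_{r+1}\cup C\Sigma^{m_r}C_{r,s})\approx(X_{r+1}\cup CX_{r+1})\cup C(\Sigma^{m_r}C_{r,s+1}\cup C\Sigma^{m_r}C_{r,s})$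 is the canonical homeomorphism (interchanging the two cone coordinates on $CC\Sigma^{m_r}C_{r,s}$) and $q$ is the quotient map onto $\Sigma(\Sigma^{m_r}C_{r,s+1}\cup C\Sigma^{m_r}C_{r,s})$. A collection $\{\mathscr S_r,\overline{f_r},\Omega_r\mid2\le r\le n\}$ is: a $q$-presentation if $\mathscr S_{r+1}=T(\mathscr S_r,\overline{f_r},\Omega_r)$ for $2\le r<n$; an $aq$-presentation if moreover $\Omega_{r+1}=\widetilde{\Omega_r}$ for $2\le r<n$; a $qs_2$- (resp. $aqs_2$-) presentation if it is a $q$- (resp. $aq$-) presentation and $\mathscr S_2$ is an iterated mapping cone; a $q\dot s_2$- (resp. $aq\dot s_2$-) presentation if moreover $\mathscr S_2$ is reduced; a $q\ddot s_2$- (resp. $aq\ddot s_2$-) presentation if moreover $\Omega_2$ is reduced. A collection $\{\mathscr S_2,\overline{f_2},\Omega_2\}\cup\{\mathscr S_r,\overline{f_r},\mathscr A_r\mid3\le r\le n\}$ is a $q_2$-presentation if $\mathscr S_3=T(\mathscr S_2,\overline{f_2},\Omega_2)$, $\mathscr S_{r+1}=T(\mathscr S_r,\overline{f_r},\Omega(\mathscr A_r))$ for $3\le r<n$, and $\mathscr A_r$ is reduced for $3\le r\le n$. A collection $\{\mathscr S_r,\overline{f_r},\mathscr A_r\mid2\le r\le n\}$ is an $s_t$-presentation if $\mathscr S_{r+1}=T(\mathscr S_r,\overline{f_r},\Omega(\mathscr A_r))$ for $2\le r<n$ and $\mathscr A_r$ is reduced for $3\le r\le n$; a $\dot s_t$-presentation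 if moreover $\mathscr S_2$ is reduced; a $\ddot s_t$-presentation if moreover $\mathscr A_2$ is reduced. Bracket. $\{\vec f\}^{(\star)}_{\vec m}\subset[\Sigma^{n-2}\Sigma^{|\vec m|}X_1,X_{n+1}]$ is the (possibly empty) set of homotopy classes of $\overline{f_n}\circ\Sigma^{m_n}g_{n,n-1}\circ(1_{\Sigma^{m_{[n-1,1]}}X_1}\wedge\tau(S^{m_n},S^{n-2}))$ for all $\star$-presentations of $\vec f$. *)

(* Defs.v *)
From HB Require Import structures.
From Stdlib Require Import Relation_Definitions Relation_Operators.
From mathcomp Require Import all_boot all_order all_algebra generic_quotient.
From mathcomp Require Import all_classical reals topology.

Set Implicit Arguments.
Unset Strict Implicit.
Unset Printing Implicit Defensive.

Import Order.TTheory Num.Theory.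
Import numFieldTopology.Exports.
Local Open Scope classical_set_scope.
Local Open Scope quotient_scope.

(* MathComp-Analysis.  Maps are plain functions; continuity and preservation of
   base points are asserted by [pointed_map] for every map that is quantified
   over.  The canonical maps between quotient spaces are defined by recursion on
   representatives, and each comes with lemmas computing it on points. *)

Section Glue.
Variables (T : topologicalType) (r : T -> T -> Prop).

Definition glue_eq (a b : T) : bool := `[< clos_refl_sym_trans T r a b >].

Lemma glue_eq_refl : reflexive glue_eq.
Proof. by move=> a; apply/asboolP; exact: rst_refl. Qed.

Lemma glue_eq_sym : symmetric glue_eq.
Proof.
by move=> a b; apply/idP/idP => /asboolP h; apply/asboolP; exact: rst_sym.
Qed.

Lemma glue_eq_trans : transitive glue_eq.
Proof.
by move=> b a c /asboolP h /asboolP k; apply/asboolP; exact: rst_trans h k.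
Qed.

Definition glue_equiv := EquivRel glue_eq glue_eq_refl glue_eq_sym glue_eq_trans.

Definition glue : topologicalType := quotient_topology {eq_quot glue_equiv}.

Definition glue_pi (a : T) : glue := \pi_{eq_quot glue_equiv} a.

(* The function on the quotient induced by [F].  It is defined through
   representatives, hence total; [glue_recE] is its defining equation when [F]
   is compatible with [r]. *)
Definition glue_rec (Z : Type) (F : T -> Z) (q : glue) : Z :=
  F (repr (q : {eq_quot glue_equiv})).

Lemma glue_piP (a b : T) : glue_pi a = glue_pi b <-> clos_refl_sym_trans T r a b.
Proof.
by split=> [/eqmodP/asboolP|h]; [|apply/eqmodP/asboolP].
Qed.

Lemma glue_pi_eq (a b : T) : r a b -> glue_pi a = glue_pi b.
Proof. by move=> h; apply/glue_piP; exact: rst_step. Qed.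

Lemma glue_pi_surj (q : glue) : exists a, q = glue_pi a.
Proof. by exists (repr (q : {eq_quot glue_equiv})); rewrite /glue_pi reprK. Qed.

Lemma glue_recE (Z : Type) (F : T -> Z) (a : T) :
  (forall x y, r x y -> F x = F y) -> glue_rec F (glue_pi a) = F a.
Proof.
move=> h; rewrite /glue_rec.
have hF x y : clos_refl_sym_trans T r x y -> F x = F y.
  by elim=> [{}x {}y /h|//|{}x {}y _ ->|{}x {}y z _ -> _ ->].
by apply/hF/glue_piP; rewrite /glue_pi reprK.
Qed.

Lemma glue_rec_continuous (Z : topologicalType) (F : T -> Z) :
  (forall x y, r x y -> F x = F y) -> continuous F -> continuous (glue_rec F).
Proof.
move=> h cF.
apply/(@quotient_continuous T {eq_quot glue_equiv} Z (glue_rec F)).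
rewrite (_ : _ \o _ = F) //; apply/funext => a /=.
exact: glue_recE.
Qed.

End Glue.

Section Interval.
Variable R : realType.
Local Open Scope ring_scope.

Definition I01 : Type := set_type (`[0, 1]%classic : set R).
HB.instance Definition _ := Topological.on I01.

Lemma I01_0 : (0 : R) \in (`[0, 1]%classic : set R).
Proof. by rewrite inE /= in_itv /= lexx ler01. Qed.

Lemma I01_1 : (1 : R) \in (`[0, 1]%classic : set R).
Proof. by rewrite inE /= in_itv /= lexx ler01. Qed.

Definition i0 : I01 := exist _ 0 I01_0.
Definition i1 : I01 := exist _ 1 I01_1.

HB.instance Definition _ := isPointed.Build I01 i1.

Definition Circle : Type := glue (fun s t : I01 => s = i0 /\ t = i1).
HB.instance Definition _ := Topological.on Circle.

Definition circle_pt (t : I01) : Circle := glue_pi _ t.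

HB.instance Definition _ := isPointed.Build Circle (circle_pt i1).
End Interval.

Section Smash.
Variables X Y : ptopologicalType.

Definition wedge_axes (p : X * Y) : Prop := p.1 = point \/ p.2 = point.

Definition smash : Type :=
  glue (fun p q : X * Y => wedge_axes p /\ wedge_axes q).
HB.instance Definition _ := Topological.on smash.

Definition smk (x : X) (y : Y) : smash := glue_pi _ (x, y).

HB.instance Definition _ := isPointed.Build smash (smk point point).

Definition smash_rec (Z : Type) (F : X -> Y -> Z) : smash -> Z :=
  glue_rec (fun p => F p.1 p.2).

Lemma smkP (w : smash) : exists x y, w = smk x y.
Proof. by have [[x y] ->] := glue_pi_surj w; exists x, y. Qed.

Lemma smk_ptl (y : Y) : smk point y = point.
Proof. by apply: glue_pi_eq; split; left. Qed.

Lemma smk_ptr (x : X) : smk x point = point.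
Proof. by apply: glue_pi_eq; split; [right|left]. Qed.

Lemma smash_recE (Z : Type) (F : X -> Y -> Z) (z : Z) x y :
  (forall y, F point y = z) -> (forall x, F x point = z) ->
  smash_rec F (smk x y) = F x y.
Proof.
move=> hl hr; apply: glue_recE => -[a b] [c d] /= [].
by do 2 case=> /= ->; rewrite ?hl ?hr.
Qed.

End Smash.

Arguments smk {X Y} x y.
Arguments smk_ptl {X Y} y.
Arguments smk_ptr {X Y} x.

Definition smash_map (X X' Y Y' : ptopologicalType) (f : X -> X') (g : Y -> Y') :
    smash X Y -> smash X' Y' :=
  smash_rec (fun x y => smk (f x) (g y)).

Lemma smash_mapE (X X' Y Y' : ptopologicalType) (f : X -> X') (g : Y -> Y') x y :
  f point = point -> g point = point ->
  smash_map f g (smk x y) = smk (f x) (g y).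
Proof.
by move=> hf hg; apply: (smash_recE (z := point)) => [b|a];
  rewrite ?hf ?hg ?smk_ptl ?smk_ptr.
Qed.

Section Topology.
Variable R : realType.

Local Notation I := (I01 R).
Local Notation S1 := (Circle R).

(* With the convention that iterated smash products associate to the left,
   [X /\ S^k = (..(X /\ S^1) /\ ..) /\ S^1]; the identifications
   [Sigma^0 X = X] and [Sigma (Sigma^k X) = Sigma^(k+1) X] are definitional. *)
Fixpoint Susp (k : nat) (X : ptopologicalType) : ptopologicalType :=
  if k is k'.+1 then smash (Susp k' X) S1 else X.

Fixpoint susp_map (k : nat) (X Y : ptopologicalType) (f : X -> Y) :
    Susp k X -> Susp k Y :=
  if k is k'.+1 then smash_map (@susp_map k' X Y f) idfun else f.
Arguments susp_map k {X Y} f _.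

(* The point [x /\ s_0 /\ .. /\ s_(k-1)] of [Sigma^k X]. *)
Fixpoint swedge (k : nat) (X : ptopologicalType) (x : X) (s : nat -> S1) :
    Susp k X :=
  if k is k'.+1 then smk (swedge k' x s) (s k') else x.
Arguments swedge k {X} x s.

(* [1_A /\ tau(S^s, S^m) : Sigma^m (Sigma^s A) -> Sigma^s (Sigma^m A)],
   characterized by [susp_swapE]. *)
Fixpoint susp_swap (s m : nat) (A : ptopologicalType) :
    Susp m (Susp s A) -> Susp s (Susp m A) :=
  match m return Susp m (Susp s A) -> Susp s (Susp m A) with
  | 0 => idfun
  | m'.+1 => smash_rec (fun w (t : S1) =>
      susp_map s (fun y : Susp m' A => smk y t : Susp m'.+1 A)
        (@susp_swap s m' A w))
  end.
Arguments susp_swap s m A : clear implicits.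

Lemma swedge_surj k (X : ptopologicalType) (w : Susp k X) :
  exists x s, w = swedge k x s.
Proof.
elim: k w => [w|k IH w]; first by exists w, (fun=> point).
have [y [t ->]] := smkP w; have [x [s ->]] := IH y.
exists x, (fun i => if i == k then t else s i) => /=; rewrite eqxx.
congr smk; elim: k {IH y w} (leqnn k) => //.
have H l j : (j <= l)%N -> swedge j x s =
    swedge j x (fun i => if i == l then t else s i).
  elim: j => //= j IH jl; rewrite IH 1?ltnW//; congr smk.
  by rewrite ltn_eqF.
by move=> k _ _; exact: H.
Qed.

Lemma susp_ptE k (X : ptopologicalType) :
  (point : Susp k.+1 X) = smk (point : Susp k X) (point : S1).
Proof. by []. Qed.

Lemma susp_map_pt k (X Y : ptopologicalType) (f : X -> Y) :
  f point = point -> susp_map k f point = point.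
Proof.
move=> hf; elim: k => //= k IH.
by rewrite susp_ptE smash_mapE // IH.
Qed.

Lemma susp_mapE k (X Y : ptopologicalType) (f : X -> Y) x s :
  f point = point -> susp_map k f (swedge k x s) = swedge k (f x) s.
Proof.
by move=> hf; elim: k => //= k IH; rewrite smash_mapE ?susp_map_pt // IH.
Qed.

Lemma susp_map_cst k (X Y : ptopologicalType) (w : Susp k X) :
  susp_map k (fun _ : X => point : Y) w = point.
Proof.
have [x [s ->]] := swedge_surj w; rewrite susp_mapE //.
by elim: k {w} => //= k ->; rewrite smk_ptl.
Qed.

Lemma susp_swap_pt s m (A : ptopologicalType) : susp_swap s m A point = point.
Proof.
elim: m => //= m IH.
rewrite susp_ptE /= (smash_recE (z := point)) => [|t|w].
- by rewrite IH susp_map_pt // smk_ptl.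
- by rewrite IH susp_map_pt // smk_ptl.
- rewrite (_ : (fun y => _) = fun=> point) ?susp_map_cst //.
  by apply/funext => y; rewrite smk_ptr.
Qed.

Lemma susp_swapE s m (A : ptopologicalType) (x : A) u t :
  susp_swap s m A (swedge m (swedge s x u) t) = swedge s (swedge m x t) u.
Proof.
elim: m => //= m IH; rewrite (smash_recE (z := point)) => [|v|w].
- by rewrite IH susp_mapE // smk_ptl.
- by rewrite susp_swap_pt susp_map_pt // smk_ptl.
- rewrite (_ : (fun y => _) = fun=> point) ?susp_map_cst //.
  by apply/funext => y; rewrite smk_ptr.
Qed.

Definition Cone (X : ptopologicalType) : ptopologicalType := smash X I.

Definition cmk (X : ptopologicalType) (x : X) (t : I) : Cone X := smk x t.

Section MappingCone.
Variables (X Y : ptopologicalType) (f : X -> Y).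

Definition cone_sum : Type :=
  {b : bool & (if b then Y else Cone X) : topologicalType}.
HB.instance Definition _ := Topological.on cone_sum.

Definition csl (y : Y) : cone_sum :=
  existT (fun b : bool => (if b then Y else Cone X) : topologicalType) true y.
Definition csr (c : Cone X) : cone_sum :=
  existT (fun b : bool => (if b then Y else Cone X) : topologicalType) false c.

(* [mcone f] is [Y u_f CX]: the point [x /\ 0] is identified with [f x]. *)
Definition mcone : Type :=
  glue (fun a b : cone_sum => exists x, a = csr (cmk x (i0 R)) /\ b = csl (f x)).
HB.instance Definition _ := Topological.on mcone.

Definition mcl (y : Y) : mcone := glue_pi _ (csl y).
Definition mcr (c : Cone X) : mcone := glue_pi _ (csr c).

HB.instance Definition _ := isPointed.Build mcone (mcl point).

Definition mcone_rec (Z : Type) (u : Y -> Z) (v : X -> I -> Z) : mcone -> Z :=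
  glue_rec (fun w : cone_sum => let: existT b a := w in
    (if b return ((if b then Y else Cone X) : topologicalType) -> Z
     then u else smash_rec v) a).

Lemma mcone_glue x : mcr (cmk x (i0 R)) = mcl (f x).
Proof. by apply: glue_pi_eq; exists x. Qed.

Lemma mcr_pt : f point = point -> mcr point = point.
Proof. by move=> hf; rewrite -(smk_ptl (i0 R)) mcone_glue hf. Qed.

Lemma mconeP (w : mcone) :
  (exists y, w = mcl y) \/ (exists x t, w = mcr (cmk x t)).
Proof.
have [[[] a] ->] := glue_pi_surj w; first by left; exists a.
by right; have [x [t ->]] := smkP a; exists x, t.
Qed.

Section Rec.
Variables (Z : Type) (u : Y -> Z) (v : X -> I -> Z).
Hypothesis hl : forall t, v point t = u point.
Hypothesis hr : forall x, v x point = u point.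
Hypothesis hg : forall x, v x (i0 R) = u (f x).

Let compat (a b : cone_sum) :
  (exists x, a = csr (cmk x (i0 R)) /\ b = csl (f x)) ->
  (let: existT b a := a in
    (if b return ((if b then Y else Cone X) : topologicalType) -> Z
     then u else smash_rec v) a) =
  (let: existT b a := b in
    (if b return ((if b then Y else Cone X) : topologicalType) -> Z
     then u else smash_rec v) a).
Proof. by case=> x [-> ->] /=; rewrite (smash_recE (z := u point)). Qed.

Lemma mcone_recl y : mcone_rec u v (mcl y) = u y.
Proof. by rewrite /mcone_rec glue_recE //; exact: compat. Qed.

Lemma mcone_recr x t : mcone_rec u v (mcr (cmk x t)) = v x t.
Proof.
rewrite /mcone_rec glue_recE; last exact: compat.
exact: smash_recE.
Qed.
End Rec.

End MappingCone.

Arguments mcl {X Y} f y.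
Arguments mcr {X Y} f c.

(* [mcone_map u v : B u_j CA -> B' u_j' CA'] is [u] on [B] and [C v] on [CA].
   It is meaningful when [u \o j = j' \o v]. *)
Definition mcone_map (A B A' B' : ptopologicalType) (j : A -> B) (j' : A' -> B')
    (u : B -> B') (v : A -> A') : mcone j -> mcone j' :=
  mcone_rec (fun b => mcl j' (u b)) (fun a t => mcr j' (cmk (v a) t)).
Arguments mcone_map {A B A' B'} j j' u v.

(* The quotient map [Y u_f CX -> Sigma X] collapsing [Y]. *)
Definition pinch (X Y : ptopologicalType) (f : X -> Y) : mcone f -> Susp 1 X :=
  mcone_rec (fun=> point) (fun x t => smk x (circle_pt t) : Susp 1 X).

(* [q'_f : (Y u_f CX) u_(i_f) CY -> Sigma X]. *)
Definition qprime (X Y : ptopologicalType) (f : X -> Y) :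
    mcone (mcl f) -> Susp 1 X :=
  mcone_rec (@pinch X Y f) (fun _ _ => point).
Arguments qprime {X Y} f.

(* [psi^l_f]; see [psil] and [psir]. *)
Definition psi (l : nat) (X Y : ptopologicalType) (f : X -> Y) :
    mcone (susp_map l f) -> Susp l (mcone f) :=
  mcone_rec (susp_map l (mcl f : Y -> mcone f))
    (fun z t => susp_map l (fun x => mcr f (cmk x t) : mcone f) z).
Arguments psi l {X Y} f.

Section Computation.
Variables X Y : ptopologicalType.

Lemma circle_pt0 : circle_pt (i0 R) = point.
Proof. exact: glue_pi_eq. Qed.

Lemma mcone_mapl (A B A' B' : ptopologicalType) (j : A -> B) (j' : A' -> B')
    (u : B -> B') (v : A -> A') b :
  j' point = point -> u point = point -> v point = point ->
  (forall a, u (j a) = j' (v a)) ->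
  mcone_map j j' u v (mcl j b) = mcl j' (u b).
Proof.
move=> hj' hu hv h; apply: mcone_recl => [t|a|a].
- by rewrite hv /cmk smk_ptl mcr_pt // hu.
- by rewrite /cmk smk_ptr mcr_pt // hu.
- by rewrite mcone_glue h.
Qed.

Lemma mcone_mapr (A B A' B' : ptopologicalType) (j : A -> B) (j' : A' -> B')
    (u : B -> B') (v : A -> A') a t :
  j' point = point -> u point = point -> v point = point ->
  (forall a, u (j a) = j' (v a)) ->
  mcone_map j j' u v (mcr j (cmk a t)) = mcr j' (cmk (v a) t).
Proof.
move=> hj' hu hv h.
apply: (mcone_recr (u := fun b => mcl j' (u b)) (v := fun a t => mcr j' (cmk (v a) t))) => [{}t|{}a|{}a].
- by rewrite hv /cmk smk_ptl mcr_pt // hu.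
- by rewrite /cmk smk_ptr mcr_pt // hu.
- by rewrite mcone_glue h.
Qed.

Variable f : X -> Y.
Hypothesis f_pt : f point = point.

Let pinch_hyp : [/\ forall t : I, smk point (circle_pt t) = point :> Susp 1 X,
  forall x : X, smk x (circle_pt (point : I)) = point :> Susp 1 X &
  forall x : X, smk x (circle_pt (i0 R)) = point :> Susp 1 X].
Proof. by split=> *; rewrite ?circle_pt0 ?smk_ptl // smk_ptr. Qed.

Lemma pinchl y : pinch (mcl f y) = point.
Proof. by case: pinch_hyp => ? ? ?; exact: mcone_recl. Qed.

Lemma pinchr x t : pinch (mcr f (cmk x t)) = smk x (circle_pt t).
Proof.
by case: pinch_hyp => ? ? ?;
  apply: (mcone_recr (v := fun x t => smk x (circle_pt t) : Susp 1 X)).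
Qed.

Lemma qprimel w : qprime f (mcl (mcl f) w) = pinch w.
Proof. by apply: mcone_recl => *; rewrite pinchl. Qed.

Lemma qprimer y t : qprime f (mcr (mcl f) (cmk y t)) = point.
Proof. by apply: (mcone_recr (u := @pinch X Y f)) => *; rewrite pinchl. Qed.

Let psi_hyp l :
  [/\ forall t, susp_map l (fun x => mcr f (cmk x t) : mcone f) point =
        susp_map l (mcl f : Y -> mcone f) point,
   forall z, susp_map l (fun x => mcr f (cmk x (point : I)) : mcone f) z =
        susp_map l (mcl f : Y -> mcone f) point &
   forall z, susp_map l (fun x => mcr f (cmk x (i0 R)) : mcone f) z =
        susp_map l (mcl f : Y -> mcone f) (susp_map l f z)].
Proof.
split=> [t|z|z].
- by rewrite !susp_map_pt // /cmk smk_ptl mcr_pt.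
- rewrite (_ : (fun x => _) = fun=> point) ?susp_map_cst ?susp_map_pt //.
  by apply/funext => x; rewrite /cmk smk_ptr mcr_pt.
- have [x [s ->]] := swedge_surj z.
  by rewrite !susp_mapE ?f_pt ?mcone_glue ?f_pt.
Qed.

Lemma psil l y s :
  psi l f (mcl (susp_map l f) (swedge l y s)) = swedge l (mcl f y : mcone f) s.
Proof.
by case: (psi_hyp l) => ? ? ?; rewrite /psi mcone_recl // susp_mapE.
Qed.

Lemma psir l x s t :
  psi l f (mcr (susp_map l f) (cmk (swedge l x s) t)) =
  swedge l (mcr f (cmk x t) : mcone f) s.
Proof.
case: (psi_hyp l) => ? ? ?; rewrite /psi mcone_recr // susp_mapE //.
by rewrite /cmk smk_ptl mcr_pt.
Qed.

End Computation.
Definition pointed_map (X Y : ptopologicalType) (f : X -> Y) : Prop :=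
  continuous f /\ f point = point.

Definition homotopic (X Y : ptopologicalType) (f g : X -> Y) : Prop :=
  exists H : X * I -> Y,
    [/\ continuous H, forall x, H (x, i0 R) = f x, forall x, H (x, i1 R) = g x
      & forall t, H (point, t) = point].

(* The homotopy class of [f], as an equivalence class of maps. *)
Definition hclass (X Y : ptopologicalType) (f : X -> Y) : set (X -> Y) :=
  [set g | homotopic f g].

Definition homotopy_inverse (X Y : ptopologicalType) (f : X -> Y) (g : Y -> X) :
    Prop :=
  [/\ pointed_map g, homotopic (g \o f) idfun & homotopic (f \o g) idfun].

Definition homotopy_equivalence (X Y : ptopologicalType) (f : X -> Y) : Prop :=
  pointed_map f /\ exists g, homotopy_inverse f g.

(* [W], [h], [G] and [H] are unpointed. *)
Definition free_cofibration (A B : topologicalType) (j : A -> B) : Prop :=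
  continuous j /\
  forall (W : topologicalType) (h : B -> W) (G : A * I -> W),
    continuous h -> continuous G -> (forall a, G (a, i0 R) = h (j a)) ->
    exists H : B * I -> W,
      [/\ continuous H, forall b, H (b, i0 R) = h b
        & forall a t, H (j a, t) = G (a, t)].

Definition well_pointed (X : ptopologicalType) : Prop :=
  free_cofibration (@set_val X [set point]).

(* Exactness of [[C', Z] -> [C, Z] -> [Y, Z]] for all well-pointed [Z]. *)
Definition coexact (Y C C' : ptopologicalType) (g : Y -> C) (j : C -> C') : Prop :=
  forall Z : ptopologicalType, well_pointed Z ->
  forall u : C -> Z, pointed_map u ->
    (homotopic (u \o g) (fun=> point) <->
     exists v : C' -> Z, pointed_map v /\ homotopic (v \o j) u).

Definition chain (B : ptopologicalType) (U : nat -> ptopologicalType) (s : nat) :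
    ptopologicalType :=
  if s is s'.+1 then U s' else B.

(* A system with first space [B].  Indices start at 0: [spc S s], [att S s],
   [inc S s] and [Y s] are the C_(s+1), g_(s+1), j_(s+1) and Y_(s+1) of the
   usual notation.  For a system of depth [k] only [spc S s] with [s <= k] and
   [att S s], [inc S s] with [s < k] are relevant. *)
Record system (B : ptopologicalType) (Y : nat -> ptopologicalType) := System {
  upper : nat -> ptopologicalType;
  att : forall s, Susp s (Y s) -> chain B upper s;
  inc : forall s, chain B upper s -> chain B upper s.+1
}.
Arguments att {B Y} _ s _.
Arguments inc {B Y} _ s _.

(* The composite [C s -> C s.+1 -> .. -> C p] of the [j]'s, for [s <= p]. *)
Fixpoint inc_to (C : nat -> ptopologicalType) (j : forall s, C s -> C s.+1)
    (s p : nat) : C s -> C p :=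
  match s, p return C s -> C p with
  | 0, 0 => idfun
  | 0, p'.+1 => j p' \o @inc_to C j 0 p'
  | s'.+1, p'.+1 => @inc_to (fun i => C i.+1) (fun i => j i.+1) s' p'
  | _.+1, 0 => fun=> point
  end.
Arguments inc_to {C} j s p _.

Lemma inc_to_id (C : nat -> ptopologicalType) (j : forall s, C s -> C s.+1) s :
  inc_to j s s = idfun.
Proof. by elim: s C j => //= s IH C j; exact: IH. Qed.

Lemma inc_toS (C : nat -> ptopologicalType) (j : forall s, C s -> C s.+1) s p :
  (s <= p)%N -> inc_to j s p.+1 = j p \o inc_to j s p.
Proof.
elim: s p C j => [|s IH] [|p] C j //= sp.
exact: (IH p (fun i => C i.+1) (fun i => j i.+1)).
Qed.

Section System.
Variables (B : ptopologicalType) (Y : nat -> ptopologicalType).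
Implicit Type S : system B Y.

Definition spc S : nat -> ptopologicalType := chain B (upper S).

Definition quasi_data S : Type :=
  forall s, mcone (inc S s) -> Susp s.+1 (Y s).

Definition str_data S : Type :=
  forall s, spc S s.+1 -> mcone (att S s).

Definition quasi_imc (k : nat) S : Prop :=
  (forall s, (s <= k)%N -> well_pointed (spc S s)) /\
  forall s, (s < k)%N ->
    [/\ pointed_map (att S s), pointed_map (inc S s),
        free_cofibration (inc S s),
        coexact (att S s) (inc S s)
      & exists w : mcone (inc S s) -> Susp s.+1 (Y s),
          homotopy_equivalence w].

Definition homotopy_cofibre_equiv S (s : nat)
    (a : spc S s.+1 -> mcone (att S s)) : Prop :=
  homotopy_equivalence a /\ a \o inc S s = mcl (att S s).

Definition imc (k : nat) S : Prop :=
  quasi_imc k S /\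
  forall s, (s < k)%N -> exists a, homotopy_cofibre_equiv (S := S) (s := s) a.

Definition quasi_structure (k : nat) S (w : quasi_data S) : Prop :=
  forall s, (s < k)%N -> homotopy_equivalence (w s).

Definition structure (k : nat) S (a : str_data S) : Prop :=
  forall s, (s < k)%N -> homotopy_cofibre_equiv (a s).

Definition quasi_of_str S (a : str_data S) : quasi_data S := fun s =>
  qprime (att S s) \o
  mcone_map (inc S s) (mcl (att S s)) (a s) idfun.

(* The three notions of being reduced involve the equality of spaces
   [C_2 = C_1 u_(g_1) CY_1]; they are therefore equalities of dependent tuples
   (C_2, j_1), (C_2, j_1, omega_1) and (C_2, j_1, a_1). *)
Definition reduced S : Prop :=
  existT (fun Z : ptopologicalType => B -> Z) (spc S 1) (inc S 0) =
  existT (fun Z : ptopologicalType => B -> Z)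
    (mcone (att S 0)) (mcl (att S 0)).

Definition reduced_quasi S (w : quasi_data S) : Prop :=
  let P (Z : ptopologicalType) := {j : B -> Z & mcone j -> Susp 1 (Y 0)} in
  existT P (spc S 1) (existT _ (inc S 0) (w 0)) =
  existT P (mcone (att S 0))
    (existT _ (mcl (att S 0)) (qprime (att S 0))).

Definition reduced_str S (a : str_data S) : Prop :=
  let P (Z : ptopologicalType) := ((B -> Z) * (Z -> mcone (att S 0)))%type in
  existT P (spc S 1) (inc S 0, a 0) =
  existT P (mcone (att S 0)) (mcl (att S 0), idfun).

End System.
Arguments quasi_imc {B Y} k S.
Arguments imc {B Y} k S.
Arguments quasi_structure {B Y} k {S} w.
Arguments structure {B Y} k {S} a.
Arguments quasi_of_str {B Y S} a s.

Section Xi.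
Variables (X P Q : ptopologicalType) (h : Q -> P) (u : P -> X) (u' : Q -> X).

(* (X u_u CP) u C(X u_u' CQ) -> (X u CX) u C(P u_h CQ), where [u' = u \o h]. *)
Definition xi : mcone (mcone_map u' u idfun h) ->
    mcone (mcone_map h (idfun : X -> X) u u') :=
  let k := mcone_map h (idfun : X -> X) u u' in
  mcone_rec
    (mcone_rec (fun x => mcl k (mcl idfun x))
               (fun p t => mcr k (cmk (mcl h p : mcone h) t)))
    (fun w t' =>
       mcone_rec (fun x => mcl k (mcr idfun (cmk x t')))
                 (fun q t => mcr k (cmk (mcr h (cmk q t') : mcone h) t)) w).

Hypotheses (h_pt : h point = point) (u_pt : u point = point).
Hypothesis u'E : forall q, u' q = u (h q).

Let u'_pt : u' point = point. Proof. by rewrite u'E h_pt. Qed.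

Let k := mcone_map h (idfun : X -> X) u u'.

Let k_l p : k (mcl h p) = mcl idfun (u p).
Proof. by apply: mcone_mapl => // ?; rewrite u'E. Qed.

Let k_r q t : k (mcr h (cmk q t)) = mcr idfun (cmk (u' q) t).
Proof. by apply: mcone_mapr => // ?; rewrite u'E. Qed.

Let k_pt : k point = point.
Proof. by rewrite [LHS](k_l point) u_pt. Qed.

Let inner_l x : mcone_rec (fun x => mcl k (mcl idfun x))
  (fun p t => mcr k (cmk (mcl h p : mcone h) t)) (mcl u x) = mcl k (mcl idfun x).
Proof.
apply: mcone_recl => [t|p|p].
- by rewrite /cmk smk_ptl mcr_pt.
- by rewrite /cmk smk_ptr mcr_pt.
- by rewrite mcone_glue k_l.
Qed.

Let inner_r p t : mcone_rec (fun x => mcl k (mcl idfun x))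
  (fun p t => mcr k (cmk (mcl h p : mcone h) t)) (mcr u (cmk p t)) =
  mcr k (cmk (mcl h p : mcone h) t).
Proof.
apply: (mcone_recr (u := fun x => mcl k (mcl idfun x))
  (v := fun p t => mcr k (cmk (mcl h p : mcone h) t))) => [{}t|{}p|{}p].
- by rewrite /cmk smk_ptl mcr_pt.
- by rewrite /cmk smk_ptr mcr_pt.
- by rewrite mcone_glue k_l.
Qed.

Let outer t' :
  [/\ forall t, mcr k (cmk (mcr h (cmk point t') : mcone h) t) =
                mcl k (mcr idfun (cmk point t')),
      forall q, mcr k (cmk (mcr h (cmk q t') : mcone h) (point : I)) =
                mcl k (mcr idfun (cmk point t')) &
      forall q, mcr k (cmk (mcr h (cmk q t') : mcone h) (i0 R)) =
                mcl k (mcr idfun (cmk (u' q) t'))].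
Proof.
split=> [t|q|q].
- by rewrite /cmk !smk_ptl !mcr_pt // smk_ptl mcr_pt.
- by rewrite /cmk smk_ptr smk_ptl !mcr_pt.
- by rewrite mcone_glue k_r.
Qed.

Let outer_l t' x : mcone_rec (fun x => mcl k (mcr idfun (cmk x t')))
   (fun q t => mcr k (cmk (mcr h (cmk q t') : mcone h) t)) (mcl u' x) =
   mcl k (mcr idfun (cmk x t')).
Proof. by case: (outer t') => ? ? ?; apply: mcone_recl. Qed.

Let outer_r t' q t : mcone_rec (fun x => mcl k (mcr idfun (cmk x t')))
   (fun q t => mcr k (cmk (mcr h (cmk q t') : mcone h) t)) (mcr u' (cmk q t)) =
   mcr k (cmk (mcr h (cmk q t') : mcone h) t).
Proof.
case: (outer t') => ? ? ?.
exact: (mcone_recr (u := fun x => mcl k (mcr idfun (cmk x t')))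
  (v := fun q t => mcr k (cmk (mcr h (cmk q t') : mcone h) t))).
Qed.

Let xi_hyp :
  let U := mcone_rec (f := u) (fun x => mcl k (mcl idfun x))
             (fun p t => mcr k (cmk (mcl h p : mcone h) t)) in
  let V := fun w t' =>
       mcone_rec (f := u') (fun x => mcl k (mcr idfun (cmk x t')))
                 (fun q t => mcr k (cmk (mcr h (cmk q t') : mcone h) t)) w in
  [/\ forall t, V point t = U point, forall w, V w point = U point &
      forall w, V w (i0 R) = U (mcone_map u' u idfun h w)].
Proof.
have E : mcone_rec (f := u) (fun x => mcl k (mcl idfun x))
   (fun p t => mcr k (cmk (mcl h p : mcone h) t)) point = mcl k point.
  exact: (inner_l point).
split=> [t|w|w] /=.
- by rewrite E [LHS](outer_l t point) /cmk smk_ptl mcr_pt.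
- rewrite E; have [[x ->]|[q [t ->]]] := mconeP w.
    by rewrite outer_l /cmk smk_ptr mcr_pt.
  by rewrite outer_r /cmk smk_ptr (mcr_pt h_pt) smk_ptl mcr_pt.
- have [[x ->]|[q [t ->]]] := mconeP w.
    by rewrite outer_l mcone_glue mcone_mapl // inner_l.
  by rewrite outer_r mcone_mapr // inner_r mcone_glue.
Qed.

Lemma xi_base x : xi (mcl _ (mcl u x)) = mcl k (mcl idfun x).
Proof. by case: xi_hyp => ? ? ?; rewrite /xi mcone_recl. Qed.

Lemma xi_inner p t :
  xi (mcl _ (mcr u (cmk p t))) = mcr k (cmk (mcl h p : mcone h) t).
Proof. by case: xi_hyp => ? ? ?; rewrite /xi mcone_recl. Qed.

Lemma xi_outer x t' : xi (mcr _ (cmk (mcl u' x : mcone u') t')) =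
  mcl k (mcr idfun (cmk x t')).
Proof. by case: xi_hyp => ? ? ?; rewrite /xi mcone_recr. Qed.

Lemma xi_swap q t t' : xi (mcr _ (cmk (mcr u' (cmk q t) : mcone u') t')) =
  mcr k (cmk (mcr h (cmk q t') : mcone h) t).
Proof. by case: xi_hyp => ? ? ?; rewrite /xi mcone_recr. Qed.

End Xi.
Arguments xi {X P Q} h u u'.

Section Brackets.
Variables (X : nat -> ptopologicalType) (m : nat -> nat).

(* [msusp r s] is Sigma^(m_(r-1)) .. Sigma^(m_(r-s)) X_(r-s), for [s <= r]. *)
Fixpoint msusp (r s : nat) {struct s} : ptopologicalType :=
  match s, r with
  | 0, _ => X r
  | s'.+1, r'.+1 => Susp (m r') (msusp r' s')
  | _.+1, 0 => X 0
  end.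

(* The type of the [r]-th system: its first space is X_r, and the source of its
   [s]-th attaching map (counting from 0) is Sigma^s (msusp r s.+1). *)
Definition sys (r : nat) : Type := system (X r) (fun s => msusp r s.+1).

Definition ext_data (r : nat) (S : sys r) : Type :=
  Susp (m r) (spc S r.-1) -> X r.+1.

Section T.
Variables (r : nat) (S : sys r) (fb : ext_data S).

Definition restr (s : nat) : Susp (m r) (spc S s) -> X r.+1 :=
  fb \o susp_map (m r) (inc_to (inc S) s r.-1).
Arguments restr s _ : clear implicits.

Definition wt_quasi (w : quasi_data S) (s : nat) :
    mcone (susp_map (m r) (inc S s)) -> Susp s.+1 (msusp r.+1 s.+2) :=
  susp_swap s.+1 (m r) (msusp r s.+1) \o susp_map (m r) (w s) \o
  psi (m r) (inc S s).
Arguments wt_quasi w s _ : clear implicits.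

Definition inv_data : Type :=
  forall s, Susp s.+1 (msusp r.+1 s.+2) -> mcone (susp_map (m r) (inc S s)).

(* T depends on the choice of homotopy inverses of the [wt_quasi w s]. *)
Definition inverses (w : quasi_data S) (v : inv_data) : Prop :=
  forall s, (s < r.-1)%N -> homotopy_inverse (wt_quasi w s) (v s).

Definition T_upper (s : nat) : ptopologicalType := mcone (restr s).

Definition T_spc : nat -> ptopologicalType := chain (X r.+1) T_upper.

Definition T_att (f : Susp (m r) (X r) -> X r.+1) (v : inv_data) (s : nat) :
    Susp s (msusp r.+1 s.+1) -> T_spc s :=
  match s return Susp s (msusp r.+1 s.+1) -> T_spc s with
  | 0 => f
  | s'.+1 => mcone_map (susp_map (m r) (inc S s')) (restr s')
               (restr s'.+1) idfun \o v s'
  end.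
Arguments T_att f v s _ : clear implicits.

Definition T_inc (s : nat) : T_spc s -> T_spc s.+1 :=
  match s return T_spc s -> T_spc s.+1 with
  | 0 => mcl (restr 0)
  | s'.+1 => mcone_map (restr s') (restr s'.+1) idfun (susp_map (m r) (inc S s'))
  end.
Arguments T_inc s _ : clear implicits.

Definition T (f : Susp (m r) (X r) -> X r.+1) (v : inv_data) : sys r.+1 :=
  System (T_att f v) T_inc.

Definition T_quasi (w : quasi_data S) f (v : inv_data) : quasi_data (T f v) :=
  fun s => match s return mcone (T_inc s) -> Susp s.+1 (msusp r.+1 s.+1) with
  | 0 => qprime (restr 0)
  | s'.+1 => susp_map 1 (wt_quasi w s') \o
      @pinch _ _ (mcone_map (susp_map (m r) (inc S s')) idfun (restr s'.+1)
               (restr s')) \o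
      xi (susp_map (m r) (inc S s')) (restr s'.+1) (restr s')
  end.

End T.
Arguments T {r S} fb f v.
Arguments T_quasi {r S} fb w f v s _.

Variable n : nat.
Variable f : forall i, Susp (m i) (X i) -> X i.+1.
Arguments f i _ : clear implicits.

(* The systems and extensions of a presentation; only [csys r] for
   [2 <= r <= n] and [cext r] for [2 <= r < n] are relevant. *)
Record collection := Collection {
  csys : forall r, sys r;
  cext : forall r, ext_data (csys r);
  clast : Susp (m n) (spc (csys n) n.-2) -> X n.+1
}.
Arguments cext _ r _ : clear implicits.
Arguments clast _ _ : clear implicits.

Definition admissible (P : collection) : Prop :=
  [/\ forall r, (1 <= r < n)%N -> att (csys P r.+1) 0 = f r,
      quasi_imc 1 (csys P 2),
      forall r, (3 <= r <= n)%N -> imc r.-1 (csys P r),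
      forall r, (2 <= r < n)%N -> pointed_map (cext P r) /\
        cext P r \o susp_map (m r) (inc_to (inc (csys P r)) 0 r.-1) =
        f r
    & pointed_map (clast P) /\
      clast P \o susp_map (m n) (inc_to (inc (csys P n)) 0 n.-2) = f n].

Definition T_step (P : collection) (r : nat) (w : quasi_data (csys P r)) : Prop :=
  exists v, inverses w v /\ csys P r.+1 = T (cext P r) (f r) v.

Definition q_pres (P : collection) (w : forall r, quasi_data (csys P r)) : Prop :=
  [/\ admissible P,
      forall r, (2 <= r <= n)%N -> quasi_structure r.-1 (w r)
    & forall r, (2 <= r < n)%N -> T_step (w r)].

(* The equality of quasi-structures is one of pairs (system, quasi-structure). *)
Definition aq_pres (P : collection) (w : forall r, quasi_data (csys P r)) : Prop :=
  q_pres w /\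
  forall r, (2 <= r < n)%N -> exists v, inverses (w r) v /\
    existT (@quasi_data _ _) (csys P r.+1) (w r.+1) =
    existT (@quasi_data _ _) (T (cext P r) (f r) v)
      (T_quasi (cext P r) (w r) (f r) v).

Definition q2_pres (P : collection) (w : quasi_data (csys P 2))
    (a : forall r, str_data (csys P r)) : Prop :=
  [/\ admissible P,
      quasi_structure 1 w /\
        forall r, (3 <= r <= n)%N -> structure r.-1 (a r),
      T_step w /\ forall r, (3 <= r < n)%N -> T_step (quasi_of_str (a r))
    & forall r, (3 <= r <= n)%N -> reduced_str (a r)].

Definition st_pres (P : collection) (a : forall r, str_data (csys P r)) : Prop :=
  [/\ admissible P /\ imc 1 (csys P 2),
      forall r, (2 <= r <= n)%N -> structure r.-1 (a r),
      forall r, (2 <= r < n)%N -> T_step (quasi_of_str (a r))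
    & forall r, (3 <= r <= n)%N -> reduced_str (a r)].

(* The suffixes [ds2], [dst] and [dds2], [ddst] stand for one and two dots. *)
Inductive symbol :=
  | star_q | star_aq | star_q2
  | star_qs2 | star_qds2 | star_qdds2
  | star_aqs2 | star_aqds2 | star_aqdds2
  | star_st | star_dst | star_ddst.

Definition presentation (star : symbol) (P : collection) : Prop :=
  match star with
  | star_q => exists w, q_pres (P := P) w
  | star_aq => exists w, aq_pres (P := P) w
  | star_q2 => exists w a, q2_pres (P := P) w a
  | star_qs2 => exists w, q_pres (P := P) w /\ imc 1 (csys P 2)
  | star_qds2 => exists w,
      [/\ q_pres (P := P) w, imc 1 (csys P 2) & reduced (csys P 2)]
  | star_qdds2 => exists w, [/\ q_pres (P := P) w, imc 1 (csys P 2),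
      reduced (csys P 2) & reduced_quasi (w 2)]
  | star_aqs2 => exists w, aq_pres (P := P) w /\ imc 1 (csys P 2)
  | star_aqds2 => exists w,
      [/\ aq_pres (P := P) w, imc 1 (csys P 2) & reduced (csys P 2)]
  | star_aqdds2 => exists w, [/\ aq_pres (P := P) w, imc 1 (csys P 2),
      reduced (csys P 2) & reduced_quasi (w 2)]
  | star_st => exists a, st_pres (P := P) a
  | star_dst => exists a, st_pres (P := P) a /\ reduced (csys P 2)
  | star_ddst => exists a,
      [/\ st_pres (P := P) a, reduced (csys P 2) & reduced_str (a 2)]
  end.

(* Here [Susp (m n) (msusp n n.-2.+1)] is Sigma^|m| X_1, for [2 <= n]. *)
Definition pres_map (P : collection) :
    Susp n.-2 (Susp (m n) (msusp n n.-2.+1)) -> X n.+1 :=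
  clast P \o susp_map (m n) (att (csys P n) n.-2) \o
  susp_swap (m n) n.-2 (msusp n n.-2.+1).

Definition bracket (star : symbol) :
    set (set (Susp n.-2 (Susp (m n) (msusp n n.-2.+1)) -> X n.+1)) :=
  [set K | exists P, presentation star P /\ K = hclass (pres_map P)].

End Brackets.
End Topology.
Arguments bracket {R X m} n f star _.

(* Main.v *)
(** Let [S_r], [fb_r], ... be a presentation of [f].  Step by step one builds a
presentation [S'_r], [fb'_r], ... of [f'] together with pointed homotopy
equivalences [e_s : C'_(r,s) -> C_(r,s)] which start with the identity, commute
strictly with the inclusions and commute with the attaching maps up to homotopy.
Since the inclusion of [Sigma^m X_r] is a cofibration, the composite of
[fb_r] with [Sigma^m e] can be deformed into an extension [fb'_r] of [f'_r]; the
deformation, which is compatible with all the restrictions of [fb_r], yields the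
equivalences between the mapping cones making up [S'_(r+1)] and [S_(r+1)].  All
the (quasi-)structures are transported along these equivalences, structures by
the relative lifting property of cofibrations against homotopy equivalences.
The resulting map [pres_map] is unchanged up to homotopy.  *)

Require Import Defs.
From HB Require Import structures.
From mathcomp Require Import all_boot all_order all_algebra.
From mathcomp Require Import all_classical reals topology normedtype.
From mathcomp Require Import lra.

Set Implicit Arguments.
Unset Strict Implicit.
Unset Printing Implicit Defensive.

Import Order.TTheory GRing.Theory Num.Theory.
Import numFieldNormedType.Exports.
Local Open Scope classical_set_scope.
Local Open Scope ring_scope.

(** * Continuity *)

(** Three kinds of data must agree on the nose, and this shapes the proof: the spaces of the next
    system are cones of restrictions of one extension, a structure satisfies [a \o inc = mcl]
    exactly, and being reduced is an equality of spaces. Attaching maps and quasi-structures, which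
    involve freely chosen homotopy inverses, are compared up to homotopy only. The comparison maps
    point from the new system to the old one, because the old extension is pulled back along them.
    At stage 2 the attaching map is [f_1] itself: in the non-reduced case it is merely replaced, in
    the reduced case the second space has to become the mapping cone of the new map. The spaces are
    arbitrary topological spaces, so a homotopy on a cone or a suspension can be defined piecewise
    only after showing that the quotient maps involved survive a product with [I] (by local
    compactness of [I]) and that [X * I -> X * S^1] is a quotient map (by compactness of [I]).
    Extending homotopies over cones and suspensions then becomes one extension problem over a
    square, solved in [hep_box]. *)

Definition ctn (T U : topologicalType) (f : T -> U) : Prop := continuous f.

Lemma ctn_continuous (T U : topologicalType) (f : T -> U) : ctn f -> continuous f.
Proof. by []. Qed.

Section Ctn.
Variables T U V : topologicalType.

Lemma ctn_id : ctn (fun x : T => x).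
Proof. by move=> x; exact: cvg_id. Qed.

Lemma ctn_cst (c : U) : ctn (fun _ : T => c).
Proof. by move=> x; exact: cvg_cst. Qed.

Lemma ctn_comp (f : T -> U) (g : U -> V) :
  ctn g -> ctn f -> ctn (fun x => g (f x)).
Proof. by move=> cg cf x; apply: continuous_comp; [exact: cf|exact: cg]. Qed.

Lemma ctn_pair (f : T -> U) (g : T -> V) :
  ctn f -> ctn g -> ctn (fun x => (f x, g x)).
Proof. by move=> cf cg x; apply: cvg_pair; [exact: cf|exact: cg]. Qed.

Lemma ctn_fst : ctn (@fst T U).
Proof. by move=> x; exact: cvg_fst. Qed.

Lemma ctn_snd : ctn (@snd T U).
Proof. by move=> x; exact: cvg_snd. Qed.

Lemma ctn_eq (f g : T -> U) : (forall x, f x = g x) -> ctn g -> ctn f.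
Proof. by move=> /funext ->. Qed.

End Ctn.

Section CtnReal.
Variables (R : realType) (T : topologicalType).
Implicit Types f g : T -> R.

Lemma ctn_add f g : ctn f -> ctn g -> ctn (fun x => f x + g x).
Proof. by move=> cf cg x; apply: (@continuousD R R^o); [exact: cf|exact: cg]. Qed.

Lemma ctn_opp f : ctn f -> ctn (fun x => - f x).
Proof. by move=> cf x; apply: (@continuousN R R^o); exact: cf. Qed.

Lemma ctn_mul f g : ctn f -> ctn g -> ctn (fun x => f x * g x).
Proof. by move=> cf cg x; apply: continuousM; [exact: cf|exact: cg]. Qed.

Lemma ctn_inv f : (forall x, f x != 0) -> ctn f -> ctn (fun x => (f x)^-1).
Proof. by move=> f0 cf x; apply: continuousV; [exact: f0|exact: cf]. Qed.

Lemma ctn_norm f : ctn f -> ctn (fun x => `|f x|).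
Proof.
move=> cf x; apply: (@continuous_comp _ _ _ f (fun y : R => `|y|)); first exact: cf.
exact: (@norm_continuous R R^o).
Qed.

Lemma ctn_max f g : ctn f -> ctn g -> ctn (fun x => Num.max (f x) (g x)).
Proof. by move=> cf cg x; apply: continuous_max; [exact: cf|exact: cg]. Qed.

Lemma ctn_min f g : ctn f -> ctn g -> ctn (fun x => Num.min (f x) (g x)).
Proof. by move=> cf cg x; apply: continuous_min; [exact: cf|exact: cg]. Qed.

(** The closed sets [k x <= c] and [c <= k x] cover [T], and [f] and [g] agree where they meet. *)
Lemma ctn_paste (Z : topologicalType) (k : T -> R) c (f g : T -> Z) :
  ctn k -> ctn f -> ctn g -> (forall x, k x = c -> f x = g x) ->
  ctn (fun x => if k x <= c then f x else g x).
Proof.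
move=> ck cf cg e; set h := fun x => _.
apply/continuous_closedP => C clC.
rewrite (_ : h @^-1` C = ([set x | k x <= c] `&` f @^-1` C) `|`
                         ([set x | c <= k x] `&` g @^-1` C)); last first.
  rewrite eqEsubset /h; split=> x /=.
    by case: (leP (k x) c) => [kc fC|/ltW kc gC]; [left|right].
  case=> -[kx Cx]; first by rewrite kx.
  by case: ifPn => // kc; rewrite (e x) //; apply/eqP; rewrite eq_le kc kx.
apply: closedU; apply: closedI.
- by apply: (@closed_comp _ _ k [set y | y <= c]) => [x _|]; [exact: ck|exact: closed_le].
- by move/continuous_closedP : cf; apply.
- by apply: (@closed_comp _ _ k [set y | c <= y]) => [x _|]; [exact: ck|exact: closed_ge].
- by move/continuous_closedP : cg; apply.
Qed.
End CtnReal.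

Section Interval.
Variable R : realType.
Local Notation I := (I01 R).

Definition ival (t : I) : R := set_val t.

Lemma ival_ge0 t : 0 <= ival t.
Proof. by have := set_mem (valP t); rewrite /= in_itv /= => /andP[]. Qed.

Lemma ival_le1 t : ival t <= 1.
Proof. by have := set_mem (valP t); rewrite /= in_itv /= => /andP[]. Qed.

Lemma ival_inj : injective ival.
Proof. exact: val_inj. Qed.

Lemma ctn_ival : ctn ival.
Proof. exact: initial_continuous. Qed.

Lemma clamp_subproof (x : R) : Num.max 0 (Num.min 1 x) \in (`[0, 1]%classic : set R).
Proof.
rewrite inE /= in_itv /= le_max lexx /= ge_max ler01 /=.
by rewrite ge_min lexx.
Qed.

(** A retraction of the real line onto [I]. Homotopy parameters are computed in [R] and clamped, so
    each branch of a pasted homotopy is total and continuous. *)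
Definition clamp (x : R) : I :=
  exist (fun y : R => y \in (`[0, 1]%classic : set R)) _ (clamp_subproof x).

Lemma clampE x : ival (clamp x) = Num.max 0 (Num.min 1 x).
Proof. by []. Qed.

Lemma ctn_clamp : ctn clamp.
Proof.
apply: (@continuous_comp_initial _ _ _ set_val clamp).
apply: (@ctn_max R _ (fun=> 0)); first exact: ctn_cst.
by apply: ctn_min; [exact: ctn_cst|exact: ctn_id].
Qed.

Lemma clampK x : 0 <= x <= 1 -> ival (clamp x) = x.
Proof. by move=> /andP[x0 x1]; rewrite clampE (min_idPr x1) (max_idPr x0). Qed.

Lemma ivalK t : clamp (ival t) = t.
Proof. by apply: ival_inj; rewrite clampK // ival_ge0 ival_le1. Qed.

Lemma clamp0 x : x <= 0 -> clamp x = i0 R.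
Proof.
move=> x0; apply: ival_inj; rewrite clampE; apply/max_idPl.
by rewrite ge_min x0 orbT.
Qed.

Lemma clamp1 x : 1 <= x -> clamp x = i1 R.
Proof.
by move=> x1; apply: ival_inj; rewrite clampE (min_idPl x1); apply/max_idPr.
Qed.

Lemma ival0 : ival (i0 R) = 0. Proof. by []. Qed.
Lemma ival1 : ival (i1 R) = 1. Proof. by []. Qed.
Lemma ivalpt : ival point = 1. Proof. by []. Qed.

Lemma I_compact : compact [set: I].
Proof.
rewrite (_ : [set: I] = clamp @` `[0, 1]).
  apply: continuous_compact; last exact: segment_compact.
  exact/continuous_subspaceT/ctn_clamp.
rewrite eqEsubset; split=> // t _; exists (ival t); last exact: ivalK.
by rewrite /= in_itv /= ival_ge0 ival_le1.
Qed.

Lemma I_hausdorff : hausdorff_space I.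
Proof.
move=> p q pq; apply: ival_inj; apply: (@Rhausdorff R) => A B.
move=> /(@ctn_ival p) Ap /(@ctn_ival q) Bq.
by have [x [Ax Bx]] := pq _ _ Ap Bq; exists (ival x).
Qed.

Lemma I_regular : regular_space I.
Proof.
move=> x; apply: (@compact_regular _ x setT) => //; first exact: I_hausdorff.
  exact: I_compact.
exact: filterT.
Qed.

Lemma I_locally_compact : locally_compact [set: I].
Proof.
move=> x _; exists setT; last by split; [exact: I_compact|exact: closedT].
exact: filterT.
Qed.

End Interval.

(** Syntax-directed proof of continuity. [ctn] provides a head symbol to match on, [continuous]
    being a quantified statement; this is why continuity hypotheses are restated with [ctn] before
    they are used by [assumption]. *)
Ltac cts :=
  lazymatch goal with
  | |- ctn (fun x => x) => exact: ctn_id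
  | |- ctn (fun _ => ?c) => exact: ctn_cst
  | |- ctn (fun x => (@?a x, @?b x)) => apply: (@ctn_pair _ _ _ a b); [cts|cts]
  | |- ctn (fun x => @GRing.add _ (@?a x) (@?b x)) =>
      apply: (@ctn_add _ _ a b); [cts|cts]
  | |- ctn (fun x => @GRing.opp _ (@?a x)) => apply: (@ctn_opp _ _ a); cts
  | |- ctn (fun x => @GRing.mul _ (@?a x) (@?b x)) =>
      apply: (@ctn_mul _ _ a b); [cts|cts]
  | |- ctn (fun x => @Num.norm _ _ (@?a x)) => apply: (@ctn_norm _ _ a); cts
  | |- ctn (fun x => @Order.max _ _ (@?a x) (@?b x)) =>
      apply: (@ctn_max _ _ a b); [cts|cts]
  | |- ctn (fun x => @Order.min _ _ (@?a x) (@?b x)) =>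
      apply: (@ctn_min _ _ a b); [cts|cts]
  | |- ctn (fun x => ?g (@?h x)) =>
      apply: (@ctn_comp _ _ _ h g);
      [first [exact: ctn_fst | exact: ctn_snd | exact: ctn_ival | exact: ctn_clamp
             | assumption | idtac] | cts]
  | |- ctn _ => first [exact: ctn_fst | exact: ctn_snd | exact: ctn_ival | exact: ctn_clamp
             | assumption | idtac]
  | |- _ => refine (ctn_continuous _); cts
  end.

(** * Quotient maps and their products with the interval and the circle *)

Section Final.
Variable R : realType.
Local Notation I := (I01 R).

(** [Q] has the final topology of two jointly surjective maps. Two are needed for a mapping cone,
    which is covered by [Y] and [X * I]; a single quotient map is the case [p = q]. *)
Definition final_pair (A B Q : topologicalType) (p : A -> Q) (q : B -> Q) : Prop :=
  [/\ ctn p, ctn q, forall x, (exists a, x = p a) \/ (exists b, x = q b)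
    & forall (Z : topologicalType) (H : Q -> Z),
        ctn (fun a => H (p a)) -> ctn (fun b => H (q b)) -> ctn H].

(** The product of a quotient map with an identity need not be a quotient map. For [I], locally
    compact and regular, the exponential law helps: continuity on [Q * I] follows from that of the
    transpose into the compact-open function space, which can be tested on [A] and [B]. *)
Lemma final_pairI (A B Q : topologicalType) (p : A -> Q) (q : B -> Q) :
  final_pair p q -> final_pair (fun x : A * I => (p x.1, x.2)) (fun x : B * I => (q x.1, x.2)).
Proof.
move=> [cp cq sur fin]; split.
- by cts.
- by cts.
- by move=> [x t]; have [[a ->]|[b ->]] := sur x; [left; exists (a, t)|right; exists (b, t)].
move=> Z H cHp cHq.
have [curp curp'] := continuous_curry cHp.
have [curq curq'] := continuous_curry cHq.
pose Hc (x : Q) (t : I) : Z := H (x, t).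
apply: (@ctn_eq _ _ _ (uncurry Hc)); first by case.
apply: continuous_uncurry_regular.
- exact: I_locally_compact.
- exact: I_regular.
- exact: (fin {compact-open, I -> Z} Hc curp curq).
- by move=> x; have [[a ->]|[b ->]] := sur x; [exact: (curp' a)|exact: (curq' b)].
Qed.

Lemma final_comp (A Q P : topologicalType) (p : A -> Q) (q : Q -> P) :
  final_pair p p -> final_pair q q -> final_pair (fun x => q (p x)) (fun x => q (p x)).
Proof.
move=> [cp _ sp fp] [cq _ sq fq]; split.
- by cts.
- by cts.
- move=> x; left; have [y ->] : exists y, x = q y by have [|] := sq x.
  by have [[a ->]|[a ->]] := sp y; exists a.
- by move=> Z H cH _; apply: fq; apply: fp.
Qed.

Lemma glue_final (T : topologicalType) (r : T -> T -> Prop) :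
  final_pair (glue_pi r) (glue_pi r).
Proof.
have cpi : ctn (glue_pi r) by exact: pi_continuous.
split=> // [x|Z H cH _]; first by left; exact: glue_pi_surj.
by apply/quotient_continuous.
Qed.

(** The factor [X] is arbitrary, so the exponential law does not apply. Instead, a neighbourhood of
    a point of [X * S^1] is found that works near each single parameter of [I], and compactness of
    [I] makes it uniform. *)
Lemma circle_final (X : topologicalType) :
  final_pair (fun p : X * I => (p.1, circle_pt p.2)) (fun p : X * I => (p.1, circle_pt p.2)).
Proof.
have [cpi _ spi fpi] := glue_final (fun s t : I => s = i0 R /\ t = i1 R).
have {}cpi : ctn (@circle_pt R) by [].
have cq : ctn (fun p : X * I => (p.1, circle_pt p.2)) by cts.
split=> //.
  by move=> [x c]; left; have [[t ->]|[t ->]] := spi c; exists (x, t).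
move=> Z H cH _ [x c]; have [t0 ->] : exists t0, c = circle_pt t0.
  by have [|] := spi c.
(* Distance from [t0] to [t] on the circle: the smaller of the direct distance and the one through
   the base point. It descends to the circle and vanishes only on the class of [t0]. *)
pose psi0 (t : I) : R := Num.min `|ival t - ival t0|
  (Num.min (ival t0) (1 - ival t0) + Num.min (ival t) (1 - ival t)).
have psi_glue s t : s = i0 R /\ t = i1 R -> psi0 s = psi0 t.
  case=> -> ->; have := ival_ge0 t0; have := ival_le1 t0.
  rewrite /psi0 ival0 ival1 subr0 sub0r normrN => ? ?.
  rewrite ger0_norm // ger0_norm; last lra.
  have -> : Num.min 0 1 = 0 :> R by apply/min_idPl.
  have -> : Num.min 1 (1 - 1) = 0 :> R by rewrite subrr; apply/min_idPr.
  have m1 : Num.min (ival t0) (1 - ival t0) <= ival t0 by rewrite ge_min lexx.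
  have m2 : Num.min (ival t0) (1 - ival t0) <= 1 - ival t0.
    by rewrite ge_min lexx orbT.
  by rewrite addr0 (min_idPr m1) (min_idPr m2).
have cpsi : ctn psi0 by rewrite /psi0; cts.
pose phi := glue_rec (r := fun s t : I => s = i0 R /\ t = i1 R) psi0.
have cphi : ctn phi by exact: glue_rec_continuous.
have phiE t : phi (circle_pt t) = psi0 t by exact: glue_recE.
have min_eq0 (y : R) : 0 <= y <= 1 -> Num.min y (1 - y) = 0 -> y = 0 \/ y = 1.
  rewrite /Order.min; case: ifPn => _ /andP[y0 y1] e; [by left|right; lra].
have min_ge0 (y : R) : 0 <= y <= 1 -> 0 <= Num.min y (1 - y).
  by rewrite /Order.min; case: ifPn; lra.
have I01b (t : I) : 0 <= ival t <= 1 by rewrite ival_ge0 ival_le1.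
have psi_ge0 t : 0 <= psi0 t.
  by rewrite le_min normr_ge0 addr_ge0 // min_ge0.
have ends t : ival t = 0 \/ ival t = 1 -> circle_pt t = point :> Circle R.
  case=> e; last by rewrite (ival_inj (etrans e (erefl (ival (i1 R))))).
  by rewrite (ival_inj (etrans e (erefl (ival (i0 R))))) circle_pt0.
have psi_eq0 t : psi0 t = 0 -> circle_pt t = circle_pt t0.
  rewrite /psi0; set u := `|_|; set v := (_ + _)%R; case: (leP u v) => _ uv0.
    by congr circle_pt; apply: ival_inj; apply/eqP; rewrite -subr_eq0 -normr_eq0 -/u uv0.
  have h1 := min_ge0 _ (I01b t); have h2 := min_ge0 _ (I01b t0).
  by rewrite !ends //; apply: min_eq0 => //; rewrite /v in uv0; lra.
have psi00 : psi0 t0 = 0.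
  rewrite /psi0 subrr normr0; apply/min_idPl.
  by rewrite addr_ge0 // min_ge0.
move=> O /= HO.
have /compact_near_coveringP ncI := @I_compact R.
(* If [t] and [t0] have the same class, continuity of [H] on [X * I] at [(x, t)] gives the
   neighbourhood. Otherwise the level [psi0 t / 2] separates the two classes and the premise fails
   nearby. *)
have near_t (t : I) : \forall t' \near t & p \near (x, circle_pt t0),
    circle_pt t' = p.2 -> O (H (p.1, p.2)).
  have [tE|tN] := pselect (circle_pt t = circle_pt t0).
    have Ht : nbhs (x, t) (fun p : X * I => O (H (p.1, circle_pt p.2))).
      by apply: cH => /=; rewrite tE.
    have [[A B] /= [Ax Bt] AB] := Ht.
    exists (B, [set p | A p.1]) => /=.
      split=> //; by have := @ctn_fst X (Circle R) (x, circle_pt t0) _ Ax.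
    move=> [t' [y c']] /= [Bt' Ay] tc'; rewrite -tc'.
    exact: (AB (y, t')).
  have pt : 0 < psi0 t.
    by rewrite lt_neqAle psi_ge0 andbT eq_sym; apply/eqP => /psi_eq0.
  exists ([set t' | psi0 t / 2 < psi0 t'],
          [set p : X * Circle R | phi p.2 < psi0 t / 2]) => /=; last first.
    by move=> [t' [y c']] /= [lt1 lt2] tc'; move: lt2; rewrite -tc' phiE ltNge ltW.
  split.
    have := cpsi t [set y | psi0 t / 2 < y]; apply.
    by apply: open_nbhs_nbhs; split; [exact: open_gt|rewrite /=; lra].
  have cphi2 : ctn (fun p : X * Circle R => phi p.2) by cts.
  have := cphi2 (x, circle_pt t0) [set y | y < psi0 t / 2]; apply.
  apply: open_nbhs_nbhs; split; first exact: open_lt.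
  by rewrite /= phiE psi00; lra.
have nc : nbhs (x, circle_pt t0) [set p : X * Circle R |
    forall t : I, [set: I] t -> circle_pt t = p.2 -> O (H (p.1, p.2))].
  exact: (ncI _ (nbhs (x, circle_pt t0))
    (fun p t => circle_pt t = p.2 -> O (H (p.1, p.2))) _ (fun t _ => near_t t)).
have sub : [set p : X * Circle R |
    forall t : I, [set: I] t -> circle_pt t = p.2 -> O (H (p.1, p.2))]
    `<=` (fun p => O (H p)).
  move=> [y c'] /= h; have [t tc'] : exists t, c' = circle_pt t by have [|] := spi c'.
  exact: (h t).
exact: (filterS sub nc).
Qed.
End Final.

(** * Topology of cones and suspensions *)

Arguments susp_map {R} k {X Y} f _.
Arguments susp_swap {R} s m A _.
Arguments mcone_map {R A B A' B'} j j' u v _.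
Arguments pinch {R X Y} f _.
Arguments qprime {R X Y} f _.
Arguments psi {R} l {X Y} f _.
Arguments mcl {R X Y} f y.
Arguments xi {R X P Q} h u u' _.

Section MconeTopology.
Variable R : realType.
Local Notation I := (I01 R).
Local Notation S1 := (Circle R).

Lemma smash_final (X Y : ptopologicalType) :
  final_pair (fun p : X * Y => smk p.1 p.2) (fun p : X * Y => smk p.1 p.2).
Proof.
have := glue_final (fun p q : X * Y => wedge_axes p /\ wedge_axes q).
rewrite (_ : glue_pi _ = fun p : X * Y => smk p.1 p.2) //.
by apply/funext => -[].
Qed.

Lemma susp1_final (X : ptopologicalType) :
  final_pair (fun p : X * I => smk p.1 (circle_pt p.2)) (fun p : X * I => smk p.1 (circle_pt p.2)).
Proof. exact: (final_comp (@circle_final R X) (smash_final X S1)). Qed.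

Lemma mcone_final (X Y : ptopologicalType) (f : X -> Y) :
  final_pair (@mcl R X Y f) (fun p : X * I => mcr f (cmk p.1 p.2)).
Proof.
have [cpi _ spi fpi] := glue_final (fun a b : cone_sum R X Y => exists x,
  a = csr Y (cmk x (i0 R)) /\ b = csl R X (f x)).
have [csm _ ssm fsm] := smash_final X I.
have cl : ctn (@mcl R X Y f).
  apply: (ctn_comp cpi).
  exact: (@existT_continuous _
    (fun b : bool => (if b then Y else Cone R X) : topologicalType) true).
have cr : ctn (@mcr R X Y f).
  apply: (ctn_comp cpi).
  exact: (@existT_continuous _
    (fun b : bool => (if b then Y else Cone R X) : topologicalType) false).
split=> //.
- exact: (ctn_comp cr csm).
- move=> w; have [[y ->]|[x [t ->]]] := mconeP w; [by left; exists y|].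
  by right; exists (x, t).
move=> Z H cHl cHr; apply: (fpi Z H _ _).
  pose K b := if b return ((if b then Y else Cone R X) : topologicalType) -> Z
    then fun y => H (mcl f y) else fun c => H (mcr f c).
  have /sigT_continuous cK : forall b, continuous (K b).
    by case=> //; exact: (fsm Z (fun c => H (mcr f c)) cHr cHr).
  by apply: ctn_eq cK => -[[]].
pose K b := if b return ((if b then Y else Cone R X) : topologicalType) -> Z
  then fun y => H (mcl f y) else fun c => H (mcr f c).
have /sigT_continuous cK : forall b, continuous (K b).
  by case=> //; exact: (fsm Z (fun c => H (mcr f c)) cHr cHr).
by apply: ctn_eq cK => -[[]].
Qed.

Section Maps.
Variables (X Y : ptopologicalType) (f : X -> Y).

Lemma ctn_mcl : ctn (@mcl R X Y f).
Proof. by have [] := mcone_final f. Qed.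

Lemma ctn_mcr : ctn (fun p : X * I => mcr f (cmk p.1 p.2)).
Proof. by have [] := mcone_final f. Qed.

Lemma ctn_smk1 : ctn (fun p : X * I => smk p.1 (circle_pt p.2)).
Proof. by have [] := susp1_final X. Qed.

Lemma ctn_mcone (Z : topologicalType) (H : mcone R f -> Z) :
  ctn (fun y => H (mcl f y)) -> ctn (fun p : X * I => H (mcr f (cmk p.1 p.2))) ->
  ctn H.
Proof. by have [_ _ _] := mcone_final f; apply. Qed.

Lemma ctn_mconeI (Z : topologicalType) (H : mcone R f * I -> Z) :
  ctn (fun p : Y * I => H (mcl f p.1, p.2)) ->
  ctn (fun p : X * I * I => H (mcr f (cmk p.1.1 p.1.2), p.2)) -> ctn H.
Proof. by have [_ _ _] := final_pairI R (mcone_final f); apply. Qed.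

Lemma ctn_susp1 (Z : topologicalType) (H : smash X S1 -> Z) :
  ctn (fun p : X * I => H (smk p.1 (circle_pt p.2))) -> ctn H.
Proof. by have [_ _ _ h] := susp1_final X; move=> cH; apply: h. Qed.

Lemma ctn_susp1I (Z : topologicalType) (H : smash X S1 * I -> Z) :
  ctn (fun p : X * I * I => H (smk p.1.1 (circle_pt p.1.2), p.2)) -> ctn H.
Proof. by have [_ _ _ h] := final_pairI R (susp1_final X); move=> cH; apply: h. Qed.

Lemma susp1P (w : smash X S1) : exists x t, w = smk x (circle_pt t).
Proof. by have [_ _ /(_ w)+ _] := susp1_final X; case=> -[[x t] ->]; exists x, t. Qed.

(** The three equations are the identifications made in the cone; continuity rests on the product of
    the cone's quotient maps with [I]. Base points may move, for use in the free homotopy extension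
    property. *)
Lemma mcone_homotopy (Z : topologicalType) (U : Y * I -> Z) (V : X * I * I -> Z) :
  ctn U -> ctn V -> (forall t s, V (point, t, s) = U (point, s)) ->
  (forall x s, V (x, point, s) = U (point, s)) ->
  (forall x s, V (x, i0 R, s) = U (f x, s)) ->
  exists H : mcone R f * I -> Z,
    [/\ ctn H, forall y s, H (mcl f y, s) = U (y, s)
      & forall x t s, H (mcr f (cmk x t), s) = V (x, t, s)].
Proof.
move=> cU cV hl hr hg.
pose H (p : mcone R f * I) :=
  mcone_rec (fun y => U (y, p.2)) (fun x t => V (x, t, p.2)) p.1.
have Hl y s : H (mcl f y, s) = U (y, s) by rewrite /H mcone_recl.
have Hr x t s : H (mcr f (cmk x t), s) = V (x, t, s).
  by rewrite /H (mcone_recr (u := fun y => U (y, s)) (v := fun x t => V (x, t, s))).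
exists H; split=> //; apply: ctn_mconeI.
  by apply: ctn_eq cU => -[].
by apply: ctn_eq cV => -[[]].
Qed.

Lemma susp1_homotopy (Z : topologicalType) (V : X * I * I -> Z) (z : I -> Z) :
  ctn V -> (forall t s, V (point, t, s) = z s) ->
  (forall x s, V (x, point, s) = z s) -> (forall x s, V (x, i0 R, s) = z s) ->
  exists H : smash X S1 * I -> Z,
    ctn H /\ forall x t s, H (smk x (circle_pt t), s) = V (x, t, s).
Proof.
move=> cV hl h1 h0.
pose G s (x : X) (c : S1) := glue_rec (r := fun s t : I => s = i0 R /\ t = i1 R)
  (fun t => V (x, t, s)) c.
have GE s x t : G s x (circle_pt t) = V (x, t, s).
  by apply: glue_recE => a b [-> ->]; rewrite h0 h1.
pose H (p : smash X S1 * I) := smash_rec (G p.2) p.1.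
have HE x t s : H (smk x (circle_pt t), s) = V (x, t, s).
  rewrite /H (smash_recE (z := z s)) // => [c|a].
    by have [a ->] := glue_pi_surj c; rewrite [LHS]GE.
  by rewrite [LHS]GE.
by exists H; split=> //; apply: ctn_susp1I; apply: ctn_eq cV => -[[]].
Qed.

Lemma mcone_homotopic (Z : ptopologicalType) (g h : mcone R f -> Z)
    (U : Y * I -> Z) (V : X * I * I -> Z) :
  ctn U -> ctn V -> (forall s, U (point, s) = point) ->
  (forall t s, V (point, t, s) = point) -> (forall x s, V (x, point, s) = point) ->
  (forall x s, V (x, i0 R, s) = U (f x, s)) ->
  (forall y, U (y, i0 R) = g (mcl f y)) -> (forall y, U (y, i1 R) = h (mcl f y)) ->
  (forall x t, V (x, t, i0 R) = g (mcr f (cmk x t))) ->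
  (forall x t, V (x, t, i1 R) = h (mcr f (cmk x t))) ->
  homotopic R g h.
Proof.
move=> cU cV Up hl hr hg Ug Uh Vg Vh.
have [||//|H [cH Hl Hr]] := mcone_homotopy cU cV.
- by move=> t s; rewrite hl Up.
- by move=> x s; rewrite hr Up.
exists H; split=> //.
- by move=> w; have [[y ->]|[x [t ->]]] := mconeP w; rewrite (Hl, Hr) (Ug, Vg).
- by move=> w; have [[y ->]|[x [t ->]]] := mconeP w; rewrite (Hl, Hr) (Uh, Vh).
- by move=> t; rewrite [LHS]Hl Up.
Qed.

End Maps.
End MconeTopology.

(** * Pointed homotopies and homotopy equivalences *)

Section Homotopy.
Variable R : realType.
Local Notation I := (I01 R).
Local Notation S1 := (Circle R).
Local Notation "f =h g" := (homotopic R f g) (at level 70).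
Local Notation he := (homotopy_equivalence R).

Section Basic.
Variables X Y Z : ptopologicalType.
Implicit Types (f g h : X -> Y).

Lemma pmap_id : pointed_map (@idfun X).
Proof. by split=> //; exact: ctn_id. Qed.

Lemma pmap_comp f (k : Y -> Z) :
  pointed_map k -> pointed_map f -> pointed_map (k \o f).
Proof. by move=> [ck pk] [cf pf]; split; [exact: ctn_comp ck cf|rewrite /= pf]. Qed.

Lemma hrefl f : pointed_map f -> f =h f.
Proof.
move=> [cf pf]; have {}cf : ctn f := cf.
by exists (fun p => f p.1); split=> //; cts.
Qed.

Lemma heq f g : pointed_map f -> (forall x, f x = g x) -> f =h g.
Proof. by move=> pf e; rewrite -(funext e); exact: hrefl. Qed.

Lemma hsym f g : f =h g -> g =h f.
Proof.
move=> [H [cH H0 H1 Hp]]; have {}cH : ctn H := cH.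
exists (fun p => H (p.1, clamp (1 - ival p.2))); split=> [|x|x|t] //=.
- by cts.
- by rewrite clamp1 ?H1 // ival0; lra.
- by rewrite clamp0 ?H0 // ival1; lra.
Qed.

Lemma htrans g f h : f =h g -> g =h h -> f =h h.
Proof.
move=> [H [cH H0 H1 Hp]] [K [cK K0 K1 Kp]].
have {}cH : ctn H := cH; have {}cK : ctn K := cK.
exists (fun p => if ival p.2 <= 1 / 2 then H (p.1, clamp (2 * ival p.2))
  else K (p.1, clamp (2 * ival p.2 - 1))); split=> [|x|x|t] /=.
- apply: ctn_paste => [|||[x t] /= e]; [by cts|by cts|by cts|].
  by rewrite e clamp1 ?clamp0 ?H1 ?K0 //; lra.
- by rewrite ival0 ifT ?clamp0 ?H0 //; lra.
- by rewrite ival1 ifF ?clamp1 ?K1 //; lra.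
- by case: ifP.
Qed.

Lemma hpmapl f g : f =h g -> pointed_map f.
Proof.
move=> [H [cH H0 H1 Hp]]; have {}cH : ctn H := cH.
split; last by rewrite -H0 Hp.
by apply: (@ctn_eq _ _ _ (fun x => H (x, i0 R))); [|cts].
Qed.

Lemma hpmapr f g : f =h g -> pointed_map g.
Proof. by move/hsym/hpmapl. Qed.

End Basic.

Section Comp.
Variables X Y Z : ptopologicalType.

Lemma hcompl (k : Y -> Z) (f g : X -> Y) : pointed_map k -> f =h g -> k \o f =h k \o g.
Proof.
move=> [ck kp] [H [cH H0 H1 Hp]]; have {}cH : ctn H := cH; have {}ck : ctn k := ck.
exists (fun p => k (H p)); split=> [|x|x|t] /=; first by cts.
- by rewrite H0.
- by rewrite H1.
- by rewrite Hp.
Qed.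

Lemma hcompr (k : X -> Y) (f g : Y -> Z) : pointed_map k -> f =h g -> f \o k =h g \o k.
Proof.
move=> [ck kp] [H [cH H0 H1 Hp]]; have {}cH : ctn H := cH; have {}ck : ctn k := ck.
exists (fun p => H (k p.1, p.2)); split=> [|x|x|t] /=; first by cts.
- by rewrite H0.
- by rewrite H1.
- by rewrite kp Hp.
Qed.

End Comp.

Lemma hidl (X Y : ptopologicalType) (k : Y -> Y) (f : X -> Y) :
  k =h idfun -> pointed_map f -> k \o f =h f.
Proof. by move=> hk pf; have := hcompr pf hk. Qed.

Lemma hidr (X Y : ptopologicalType) (k : X -> X) (f : X -> Y) :
  k =h idfun -> pointed_map f -> f \o k =h f.
Proof. by move=> hk pf; have := hcompl pf hk. Qed.

Lemma hclass_eq (X Y : ptopologicalType) (f g : X -> Y) :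
  f =h g -> hclass R f = hclass R g.
Proof.
move=> fg; apply/funext => h; apply/propext.
by split=> k; [exact: htrans (hsym fg) k|exact: htrans fg k].
Qed.

Section HE.

Lemma he_pmap (X Y : ptopologicalType) (f : X -> Y) : he f -> pointed_map f.
Proof. by case. Qed.

Lemma he_id (X : ptopologicalType) : he (@idfun X).
Proof.
split; first exact: pmap_id.
by exists idfun; split; [exact: pmap_id|exact/hrefl/pmap_id|exact/hrefl/pmap_id].
Qed.

Lemma he_comp (X Y Z : ptopologicalType) (f : X -> Y) (g : Y -> Z) :
  he g -> he f -> he (g \o f).
Proof.
move=> [pg [g' [pg' g'g gg']]] [pf [f' [pf' f'f ff']]]; split; first exact: pmap_comp.
exists (f' \o g'); split; first exact: pmap_comp.
  apply: (@htrans _ _ (f' \o f)) => //.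
  have /(@hcompl _ _ _ f' _ _ pf') := hcompr pf g'g; exact.
apply: (@htrans _ _ (g \o g')) => //.
have /(@hcompl _ _ _ g _ _ pg) := hcompr pg' ff'; exact.
Qed.

Lemma he_homotopic (X Y : ptopologicalType) (f g : X -> Y) : f =h g -> he f -> he g.
Proof.
move=> fg [pf [f' [pf' f'f ff']]]; split; first exact: hpmapr fg.
exists f'; split=> //.
  by apply: htrans f'f; apply: hcompl => //; exact: hsym.
by apply: htrans ff'; apply: hcompr => //; exact: hsym.
Qed.

Lemma he_linv_rinv (X Y : ptopologicalType) (f : X -> Y) (l r : Y -> X) :
  pointed_map f -> pointed_map l -> pointed_map r ->
  l \o f =h idfun -> f \o r =h idfun -> he f.
Proof.
move=> pf pl pr lf fr; split=> //; exists l; split=> //.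
have lr : l =h r.
  apply: (@htrans _ _ (l \o (f \o r))); first exact/hsym/hcompl.
  by have := hcompr pr lf.
by apply: htrans fr; exact: hcompl.
Qed.

Lemma he_cancell (X Y Z : ptopologicalType) (f : X -> Y) (g : Y -> Z) :
  pointed_map f -> he g -> he (g \o f) -> he f.
Proof.
move=> pf [pg [g' [pg' g'g gg']]] [_ [k [pk kgf gfk]]].
apply: (@he_linv_rinv _ _ f (k \o g) (k \o g)) => //; do ?exact: pmap_comp.
apply: (@htrans _ _ (g' \o ((g \o f) \o k) \o g)).
  have := hcompr (pmap_comp pf (pmap_comp pk pg)) (hsym g'g); exact.
apply: htrans g'g; have := hcompl pg' (hcompr pg gfk); exact.
Qed.

(** The two composites supply a left and a right inverse of [f] up to homotopy, although neither [p]
    nor [q] is claimed to be an inverse. *)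
Lemma he_2of6 (X Y Z W : ptopologicalType) (f : X -> Y) (p : Y -> Z) (q : W -> X) :
  pointed_map f -> pointed_map p -> pointed_map q -> he (p \o f) -> he (f \o q) -> he f.
Proof.
move=> pf pp pq [_ [k [pk kpf pfk]]] [_ [l [pl lfq fql]]].
by apply: (@he_linv_rinv _ _ f (k \o p) (q \o l)); do ?exact: pmap_comp.
Qed.

End HE.

Section SuspFunctor.

Lemma susp_map1 k (X Y : ptopologicalType) (f : X -> Y) w c : f point = point ->
  susp_map k.+1 f (smk w c : Susp R k.+1 X) = smk (susp_map k f w) c.
Proof. by move=> pf; rewrite /= smash_mapE // susp_map_pt. Qed.

Lemma susp1_mapE (X Y : ptopologicalType) (f : X -> Y) w c : f point = point ->
  susp_map 1 f (smk w c : Susp R 1 X) = smk (f w) c.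
Proof. exact: (@susp_map1 0). Qed.

(** Joint continuity in the point and the parameter, by induction through [ctn_susp1I]. The
    parameter is a homotopy time in [susp_homotopic], a cone coordinate in [pmap_psi] and a circle
    coordinate in [pmap_susp_swap]. *)
Lemma ctn_susp_map_homotopy k (X Y : ptopologicalType) (F : X * I -> Y) :
  ctn F -> (forall t, F (point, t) = point) ->
  ctn (fun p : Susp R k X * I => susp_map k (fun x => F (x, p.2)) p.1).
Proof.
move=> cF pF; elim: k => [|k IH] /=.
  by apply: ctn_eq cF => -[].
apply: ctn_susp1I.
apply: (@ctn_eq _ _ _ (fun p : Susp R k X * I * I =>
   smk (susp_map k (fun x => F (x, p.2)) p.1.1) (circle_pt p.1.2))).
  by move=> [[w t] s] /=; rewrite smash_mapE //= susp_map_pt.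
have h : ctn (fun p : Susp R k X * I * I =>
    (susp_map k (fun x => F (x, p.2)) p.1.1, p.1.2)).
  apply: ctn_pair; last by cts.
  apply: (@ctn_comp _ _ _ (fun p : Susp R k X * I * I => (p.1.1, p.2)) _ IH).
  by cts.
exact: (ctn_comp (@ctn_smk1 R (Susp R k Y)) h).
Qed.

Lemma pmap_susp k (X Y : ptopologicalType) (f : X -> Y) :
  pointed_map f -> pointed_map (susp_map (R := R) k f).
Proof.
move=> [cf pf]; split; last exact: susp_map_pt.
have {}cf : ctn f := cf.
have h := @ctn_susp_map_homotopy k X Y (fun p => f p.1) (ctn_comp cf (@ctn_fst _ _)) (fun=> pf).
apply: (@ctn_eq _ _ _ (fun w => susp_map k f ((w, i0 R) : Susp R k X * I).1)) => //.
by apply: (@ctn_comp _ _ _ (fun w => (w, i0 R)) _ h); cts.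
Qed.

Lemma susp_homotopic k (X Y : ptopologicalType) (f g : X -> Y) :
  f =h g -> susp_map (R := R) k f =h susp_map k g.
Proof.
move=> [H [cH H0 H1 Hp]]; exists (fun p => susp_map k (fun x => H (x, p.2)) p.1).
split=> [|x|x|t] /=; first exact: ctn_susp_map_homotopy.
- by rewrite (funext H0).
- by rewrite (funext H1).
- by rewrite susp_map_pt.
Qed.

Lemma susp_map_id k (X : ptopologicalType) : susp_map (R := R) k (@idfun X) = idfun.
Proof. by apply/funext => w; have [x [s ->]] := swedge_surj w; rewrite susp_mapE. Qed.

Lemma susp_map_comp k (X Y Z : ptopologicalType) (f : X -> Y) (g : Y -> Z) :
  f point = point -> g point = point ->
  susp_map (R := R) k (g \o f) = susp_map k g \o susp_map k f.
Proof.
move=> pf pg; apply/funext => w; have [x [s ->]] := swedge_surj w.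
by rewrite /= !susp_mapE //= pf.
Qed.

Lemma he_susp k (X Y : ptopologicalType) (f : X -> Y) : he f -> he (susp_map (R := R) k f).
Proof.
move=> [pf [g [pg gf fg]]]; split; first exact: pmap_susp.
exists (susp_map k g); split; first exact: pmap_susp.
  by rewrite -susp_map_comp ?pf.2 ?pg.2 // -susp_map_id; exact: susp_homotopic.
by rewrite -susp_map_comp ?pf.2 ?pg.2 // -susp_map_id; exact: susp_homotopic.
Qed.

Lemma susp_swapS s m (A : ptopologicalType) (w : Susp R m (Susp R s A)) (c : S1) :
  susp_swap s m.+1 A (smk w c) =
  susp_map s (fun y => smk y c : Susp R m.+1 A) (susp_swap s m A w).
Proof.
rewrite /= (smash_recE (z := point)) // => [t|v].
  by rewrite susp_swap_pt susp_map_pt // smk_ptl.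
rewrite (_ : (fun y => _) = fun=> point) ?susp_map_cst //.
by apply/funext => y; rewrite smk_ptr.
Qed.

Lemma pmap_susp_swap s m (A : ptopologicalType) : pointed_map (@susp_swap R s m A).
Proof.
split; last exact: susp_swap_pt.
elim: m => [|m IH]; first exact: ctn_id.
have {}IH : ctn (@susp_swap R s m A) := IH.
apply: ctn_susp1.
apply: (@ctn_eq _ _ _ (fun p : Susp R m (Susp R s A) * I =>
  susp_map s (fun y => smk y (circle_pt p.2) : Susp R m.+1 A) (susp_swap s m A p.1))).
  by move=> [w t]; rewrite susp_swapS.
pose F (p : Susp R m A * I) : Susp R m.+1 A := smk p.1 (circle_pt p.2).
have cF : ctn F by exact: ctn_smk1.
have pF t : F (point, t) = point by rewrite /F smk_ptl.
have h := @ctn_susp_map_homotopy s _ _ F cF pF.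
apply: (@ctn_comp _ _ _ (fun p : Susp R m (Susp R s A) * I => (susp_swap s m A p.1, p.2)) _ h).
by cts.
Qed.

Section Psi.
Variables (l : nat) (X Y : ptopologicalType) (f : X -> Y).
Hypothesis pf : pointed_map f.

Lemma psi_l z : psi l f (mcl (susp_map l f) z) = susp_map l (mcl f : Y -> mcone R f) z.
Proof.
have [y [s ->]] := swedge_surj z.
by rewrite psil ?susp_mapE //; exact: pf.2.
Qed.

Lemma psi_r z t : psi l f (mcr (susp_map l f) (cmk z t)) =
  susp_map l (fun x => mcr f (cmk x t) : mcone R f) z.
Proof.
have [x [s ->]] := swedge_surj z.
rewrite psir ?susp_mapE // ?(pf.2) // /cmk smk_ptl mcr_pt //; exact: pf.2.
Qed.

Lemma pmap_psi : pointed_map (@psi R l X Y f).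
Proof.
split; last by rewrite (psi_l point) susp_map_pt.
apply: ctn_mcone.
  apply: (@ctn_eq _ _ _ (susp_map l (mcl f : Y -> mcone R f))); first exact: psi_l.
  by have [] := @pmap_susp l Y (mcone R f) (mcl f) (conj (@ctn_mcl R X Y f) (erefl _)).
apply: (@ctn_eq _ _ _ (fun p : Susp R l X * I =>
   susp_map l (fun x => mcr f (cmk x p.2) : mcone R f) p.1)).
  by move=> [z t]; exact: psi_r.
pose F (p : X * I) : mcone R f := mcr f (cmk p.1 p.2).
apply: (@ctn_susp_map_homotopy l X (mcone R f) F); first exact: ctn_mcr.
by move=> t; rewrite /F /cmk smk_ptl mcr_pt //; exact: pf.2.
Qed.

End Psi.
End SuspFunctor.

Section MconeMap.
Variables (A B A' B' : ptopologicalType) (j : A -> B) (j' : A' -> B').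
Variables (u : B -> B') (v : A -> A').
Hypotheses (pj' : j' point = point) (pu : pointed_map u) (pv : pointed_map v).
Hypothesis uj : forall a, u (j a) = j' (v a).

Lemma mcone_map_l b : mcone_map j j' u v (mcl j b : mcone R j) = mcl j' (u b).
Proof. by apply: mcone_mapl => //; [exact: pu.2|exact: pv.2]. Qed.

Lemma mcone_map_r a t :
  mcone_map j j' u v (mcr j (cmk a t) : mcone R j) = mcr j' (cmk (v a) t).
Proof. by apply: mcone_mapr => //; [exact: pu.2|exact: pv.2]. Qed.

Lemma pmap_mcone_map : pointed_map (mcone_map j j' u v : mcone R j -> mcone R j').
Proof.
have [cu pu'] := pu; have [cv pv'] := pv.
have {}cu : ctn u := cu; have {}cv : ctn v := cv.
split; last by rewrite [LHS](mcone_map_l point) pu'.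
apply: ctn_mcone.
  by apply: (ctn_eq mcone_map_l); have := @ctn_mcl R A' B' j' => ?; cts.
apply: (@ctn_eq _ _ _ (fun p : A * I => mcr j' (cmk (v p.1) p.2))).
  by move=> [a t]; exact: mcone_map_r.
apply: (@ctn_comp _ _ _ (fun p : A * I => (v p.1, p.2)) _ (@ctn_mcr R A' B' j')).
by cts.
Qed.

End MconeMap.

Lemma pmap_mcl (X Y : ptopologicalType) (f : X -> Y) :
  pointed_map (mcl f : Y -> mcone R f).
Proof. by split=> //; exact: ctn_mcl. Qed.

End Homotopy.

(** * Cofibrations *)

Section Box.
Variable R : realType.
Local Notation I := (I01 R).

Lemma clampE' (x : R) : 0 <= x -> x <= 1 -> ival (clamp x) = x.
Proof. by move=> h k; rewrite clampK // h. Qed.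

(** For [z = (t, u)], the ray from [(1/2, 2)] through [z] meets the bottom line at the factor
    [1 / (1 - u/2)] and a side line at [1 / |2t - 1|]. The smaller factor, at which the ray leaves
    the square, is the inverse of this maximum. *)
Definition box_max (z : I * I) : R :=
  Num.max (1 - ival z.2 / 2) `|2 * ival z.1 - 1|.

Definition box_scale (z : I * I) : R := (box_max z)^-1.

(** First coordinate of a point that moves along this ray from the retracted position back to [z]:
    the factor decreases at unit speed until it reaches 1. *)
Definition box_x (p : I * I * I) : I :=
  clamp (1 / 2 + Num.max (box_scale p.1 - ival p.2) 1 * (ival p.1.1 - 1 / 2)).

Definition box_y (p : I * I * I) : I :=
  clamp (2 + Num.max (box_scale p.1 - ival p.2) 1 * (ival p.1.2 - 2)).

Definition box_path (p : I * I * I) : I * I := (box_x p, box_y p).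

(** The time of arrival at [z]. It is at most 1 because the centre has height 2, which bounds
    [box_scale] by 2, and it is 0 on bottom and sides. *)
Definition box_time (z : I * I) : I := clamp (box_scale z - 1).

Arguments box_x : simpl never.
Arguments box_y : simpl never.

Lemma box_maxP z : 1 / 2 <= box_max z <= 1.
Proof.
have := ival_ge0 z.2; have := ival_le1 z.2; have := ival_ge0 z.1; have := ival_le1 z.1.
move=> *; rewrite /box_max le_max ge_max; apply/andP; split; first by apply/orP; left; lra.
by apply/andP; split; [lra|rewrite ler_norml; apply/andP; split; lra].
Qed.

Lemma ctn_box_scale : ctn box_scale.
Proof.
apply: ctn_inv => [z|]; last by rewrite /box_max; cts.
by have /andP[h _] := box_maxP z; apply: lt0r_neq0; lra.
Qed.

Lemma ctn_box_x : ctn box_x.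
Proof. by rewrite /box_x; have := ctn_box_scale => ?; cts. Qed.

Lemma ctn_box_y : ctn box_y.
Proof. by rewrite /box_y; have := ctn_box_scale => ?; cts. Qed.

Lemma ctn_box_time : ctn box_time.
Proof. by rewrite /box_time; have := ctn_box_scale => ?; cts. Qed.

Lemma box_maxV z : 1 <= box_scale z <= 2.
Proof.
rewrite /box_scale; have /andP[h k] := box_maxP z; have p : 0 < box_max z by lra.
rewrite -[X in X <= _]invr1 lef_pV2 ?posrE // k /=.
by rewrite -[X in _ <= X]invrK lef_pV2 ?posrE ?invr_gt0; lra.
Qed.

Lemma box_path_stop z s : box_scale z - ival s <= 1 -> box_path (z, s) = z.
Proof.
move=> h; rewrite /box_path /box_x /box_y /= (max_idPr h) !mul1r; case: z h => t u _ /=.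
by rewrite !(addrC _ (_ - _)%R) !subrK !ivalK.
Qed.

Lemma box_path_time z : box_path (z, box_time z) = z.
Proof.
apply: box_path_stop; rewrite /box_time clampE'; have /andP[] := box_maxV z; lra.
Qed.

Lemma box_path_edge z s : box_max z = 1 -> box_path (z, s) = z.
Proof. by move=> e; apply: box_path_stop; rewrite /box_scale e invr1; have := ival_ge0 s; lra. Qed.

Lemma box_time_edge z : box_max z = 1 -> box_time z = i0 R.
Proof. by move=> e; rewrite /box_time /box_scale e invr1 subrr clamp0. Qed.

Lemma box_max_bot t : box_max (t, i0 R) = 1.
Proof.
have := ival_ge0 t; have := ival_le1 t => *.
by rewrite /box_max /= ival0 mul0r subr0; apply/max_idPl; rewrite ler_norml; lra.
Qed.

Lemma box_max_left s : box_max (i0 R, s) = 1.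
Proof.
have := ival_ge0 s => *; rewrite /box_max /= ival0 mulr0 sub0r normrN normr1.
by apply/max_idPr; lra.
Qed.

Lemma box_max_right s : box_max (i1 R, s) = 1.
Proof.
have := ival_ge0 s => *; rewrite /box_max /= ival1.
by rewrite (_ : _ - 1 = 1) ?normr1; [apply/max_idPr|]; lra.
Qed.

Lemma box_scale0 z : Num.max (box_scale z - ival (i0 R)) 1 = box_scale z.
Proof. by rewrite ival0 subr0; have /andP[/max_idPl -> _] := box_maxV z. Qed.

Lemma box_path_bot t s : `|2 * ival t - 1| <= 1 - ival s / 2 ->
  box_y (t, s, i0 R) = i0 R.
Proof.
move=> h; rewrite /box_y box_scale0; apply: clamp0.
have p : 0 < 1 - ival s / 2 by have := ival_le1 s; lra.
rewrite /box_scale /box_max /= (max_idPl h); move: p.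
set a := 1 - _ => p; rewrite (_ : ival s - 2 = - 2 * a); last by rewrite /a; lra.
by rewrite mulrCA mulVf ?mulr1 ?subrr ?lt0r_neq0 //; lra.
Qed.

Lemma box_path_left t s : 1 - ival s / 2 <= 1 - 2 * ival t ->
  box_x (t, s, i0 R) = i0 R.
Proof.
move=> h; rewrite /box_x box_scale0; apply: clamp0.
have p : 0 < 1 - 2 * ival t by have := ival_le1 s; lra.
have n : `|2 * ival t - 1| = 1 - 2 * ival t by rewrite distrC gtr0_norm.
rewrite /box_scale /box_max /= n (max_idPr h); move: p.
set a := 1 - _ => p; rewrite (_ : ival t - 1 / 2 = - (1 / 2) * a); last by rewrite /a; lra.
by rewrite mulrCA mulVf ?lt0r_neq0 // mulr1; lra.
Qed.

Lemma box_path_right t s : 1 - ival s / 2 <= 2 * ival t - 1 ->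
  box_x (t, s, i0 R) = i1 R.
Proof.
move=> h; rewrite /box_x box_scale0; apply: clamp1.
have p : 0 < 2 * ival t - 1 by have := ival_le1 s; lra.
have n : `|2 * ival t - 1| = 2 * ival t - 1 by rewrite gtr0_norm.
rewrite /box_scale /box_max /= n (max_idPr h); move: p.
set a := _ - 1 => p; rewrite (_ : ival t - 1 / 2 = (1 / 2) * a); last by rewrite /a; lra.
by rewrite mulrCA mulVf ?lt0r_neq0 // mulr1; lra.
Qed.

Definition box_agree (W : Type) (k : I * I -> W) (h g0 g1 : I -> W) :=
  [/\ forall t, k (t, i0 R) = h t, forall s, k (i0 R, s) = g0 s
    & forall s, k (i1 R, s) = g1 s].

(* [box_path (z, i0)] is the radial retraction of the square onto its bottom and
   sides, with centre (1/2, 2); [F] is the given map on bottom and sides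
   composed with it. *)
Lemma box_fill (X W : topologicalType) (h g0 g1 : X * I -> W) :
  ctn h -> ctn g0 -> ctn g1 ->
  (forall x, h (x, i0 R) = g0 (x, i0 R)) -> (forall x, h (x, i1 R) = g1 (x, i0 R)) ->
  exists F : X * I * I -> W,
    [/\ ctn F,
        forall x, box_agree (fun z => F (x, z.1, z.2)) (fun t => h (x, t))
          (fun s => g0 (x, s)) (fun s => g1 (x, s))
      & forall x k, box_agree k (fun t => h (x, t)) (fun s => g0 (x, s))
          (fun s => g1 (x, s)) ->
        forall t s, F (x, t, s) = k (box_path (t, s, i0 R))].
Proof.
move=> ch c0 c1 e0 e1.
pose F (p : X * I * I) : W :=
  if ival p.1.2 <= 1 / 2 then
    if (1 - 2 * ival p.1.2) - (1 - ival p.2 / 2) <= 0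
      then h (p.1.1, box_x (p.1.2, p.2, i0 R)) else g0 (p.1.1, box_y (p.1.2, p.2, i0 R))
  else
    if (2 * ival p.1.2 - 1) - (1 - ival p.2 / 2) <= 0
      then h (p.1.1, box_x (p.1.2, p.2, i0 R)) else g1 (p.1.1, box_y (p.1.2, p.2, i0 R)).
have cbx := ctn_box_x; have cby := ctn_box_y.
have cF : ctn F.
  apply: ctn_paste; first by cts.
  - apply: ctn_paste; [by cts|by cts|by cts|move=> [[x t] s] /= e].
    rewrite box_path_left; last lra.
    rewrite e0 box_path_bot // ler_norml.
    by have := ival_ge0 t; have := ival_le1 t; have := ival_ge0 s; have := ival_le1 s; lra.
  - apply: ctn_paste; [by cts|by cts|by cts|move=> [[x t] s] /= e].
    rewrite box_path_right; last lra.
    rewrite e1 box_path_bot // ler_norml.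
    by have := ival_ge0 t; have := ival_le1 t; have := ival_ge0 s; have := ival_le1 s; lra.
  - move=> [[x t] s] /= e; rewrite e.
    by rewrite !ifT //; have := ival_ge0 s; have := ival_le1 s; lra.
have FE x k : box_agree k (fun t => h (x, t)) (fun s => g0 (x, s))
    (fun s => g1 (x, s)) -> forall t s, F (x, t, s) = k (box_path (t, s, i0 R)).
  move=> [kb kl kr] t s; rewrite /F /= /box_path.
  have := ival_ge0 t; have := ival_le1 t; have := ival_ge0 s; have := ival_le1 s => *.
  case: ifPn => [t2|/negP t2]; case: ifPn => [h2|/negP h2].
  - by rewrite (@box_path_bot t s) ?kb // ler_norml; lra.
  - by rewrite (@box_path_left t s) ?kl //; lra.
  - by rewrite (@box_path_bot t s) ?kb // ler_norml; lra.
  - by rewrite (@box_path_right t s) ?kr //; lra.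
exists F; split=> // x.
(* A function with the prescribed values on bottom and sides, not claimed to be continuous; it
   serves to read off [F] there. *)
pose k (z : I * I) := if z.2 == i0 R then h (x, z.1)
  else if z.1 == i0 R then g0 (x, z.2) else g1 (x, z.2).
have i10 : (i1 R == i0 R) = false.
  by apply/eqP => /(congr1 (@ival R)); rewrite ival0 ival1; lra.
have ka : box_agree k (fun t => h (x, t)) (fun s => g0 (x, s)) (fun s => g1 (x, s)).
  rewrite /k; split=> [t|s|s] /=; first by rewrite eqxx.
    by case: eqP => [->|_]; rewrite ?eqxx ?e0.
  by rewrite i10; case: eqP => [->|_]; rewrite ?e1.
have [kb kl kr] := ka.
split=> [t|s|s] /=; rewrite (FE x k ka) box_path_edge //.
- exact: box_max_bot.
- exact: box_max_left.
- exact: box_max_right.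
Qed.

(** By the exponential law, extending a homotopy of maps from [B * I] to [W] amounts to extending a
    homotopy of maps from [B] to the space of paths in [W]. *)
Lemma cof_prodI (A B : topologicalType) (j : A -> B) : free_cofibration R j ->
  free_cofibration R (fun p : A * I => (j p.1, p.2)).
Proof.
move=> [cj hep]; have {}cj : ctn j := cj; split; first by cts.
move=> W h G ch cG hG; have {}ch : ctn h := ch; have {}cG : ctn G := cG.
(* The carrier of [{compact-open, I -> W}] contains all functions. Restricting to the continuous
   ones forces the extended homotopy to have continuous values, as uncurrying requires. *)
pose M : set {compact-open, I -> W} := [set k | continuous (k : I -> W)].
have mh b : (fun t => h (b, t)) \in M.
  by apply/mem_set; have ? : ctn (fun t => h (b, t)) by cts.
have mG (p : A * I) : (fun t => G (p.1, t, p.2)) \in M.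
  by apply/mem_set; have ? : ctn (fun t => G (p.1, t, p.2)) by cts.
pose h' b : set_type M := exist _ (fun t => h (b, t)) (mh b).
pose G' p : set_type M := exist _ (fun t => G (p.1, t, p.2)) (mG p).
have ch' : ctn h'.
  apply: (@continuous_comp_initial _ _ _ set_val h').
  have := @continuous_curry_fun _ _ _ (fun p : B * I => h p).
  by apply; cts.
have cG' : ctn G'.
  apply: (@continuous_comp_initial _ _ _ set_val G').
  have := @continuous_curry_fun _ _ _ (fun p : A * I * I => G (p.1.1, p.2, p.1.2)).
  by apply; cts.
have [a|H [cH H0 HG]] := hep (set_type M) h' G' ch' cG'.
  by apply: val_inj; apply/funext => t /=; exact: hG (a, t).
have {}cH : ctn H := cH.
pose K (q : B * I) : I -> W := set_val (H q).
have cK : ctn (uncurry K).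
  apply: continuous_uncurry_regular.
  - exact: I_locally_compact.
  - exact: I_regular.
  - apply: (@ctn_comp _ _ _ H (set_val : set_type M -> {compact-open, I -> W})) => //.
    exact: initial_continuous.
  - by move=> q; have := set_mem (valP (H q)).
exists (fun p => uncurry K (p.1.1, p.2, p.1.2)); split=> [|[b t]|[a t] s] /=.
- apply: (@ctn_comp _ _ _ (fun p : B * I * I => (p.1.1, p.2, p.1.2)) _ cK).
  by cts.
- by rewrite /K H0.
- by rewrite /K HG.
Qed.

(** Apply the extension property of [j * I * I] with [F], the boundary data composed with the radial
    retraction, at time 0, and over [A] with [G] evaluated along [box_path]. Reading the result at
    [box_time] gives [G] over [A], where the path has arrived at its point, and the boundary data on
    bottom and sides, where the time is 0. *)
Lemma hep_box (A B W : topologicalType) (j : A -> B) (h g0 g1 : B * I -> W)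
    (G : A * I * I -> W) :
  free_cofibration R j -> ctn h -> ctn g0 -> ctn g1 -> ctn G ->
  (forall b, h (b, i0 R) = g0 (b, i0 R)) -> (forall b, h (b, i1 R) = g1 (b, i0 R)) ->
  (forall a t, G (a, t, i0 R) = h (j a, t)) ->
  (forall a s, G (a, i0 R, s) = g0 (j a, s)) ->
  (forall a s, G (a, i1 R, s) = g1 (j a, s)) ->
  exists H : B * I * I -> W,
    [/\ ctn H, forall b t, H (b, t, i0 R) = h (b, t),
        forall b s, H (b, i0 R, s) = g0 (b, s),
        forall b s, H (b, i1 R, s) = g1 (b, s)
      & forall a t s, H (j a, t, s) = G (a, t, s)].
Proof.
move=> cj ch c0 c1 cG e0 e1 Gh Gl Gr.
have [F [cF Fa FE]] := box_fill ch c0 c1 e0 e1.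
have cbx := ctn_box_x; have cby := ctn_box_y; have cbt := ctn_box_time.
pose K (p : A * I * I * I) : W :=
  G (p.1.1.1, box_x (p.1.1.2, p.1.2, p.2), box_y (p.1.1.2, p.1.2, p.2)).
have cK : ctn K by rewrite /K; cts.
have [_ /(_ W F K cF cK)] := cof_prodI (cof_prodI cj).
case=> [[[a t] s]|H [cH H0 HK]].
  have ka : box_agree (fun z => G (a, z.1, z.2)) (fun t => h (j a, t))
      (fun s => g0 (j a, s)) (fun s => g1 (j a, s)).
    by split=> [t'|s'|s'] /=; [exact: Gh|exact: Gl|exact: Gr].
  by rewrite /K /= (FE _ _ ka).
have {}cH : ctn H := cH.
exists (fun p => H (p, box_time (p.1.2, p.2))); split.
- by apply: (@ctn_comp _ _ _ (fun p : B * I * I => (p, box_time (p.1.2, p.2)))) => //; cts.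
- move=> b t; rewrite box_time_edge ?box_max_bot // H0.
  by have [/(_ t)/= -> _ _] := Fa b.
- move=> b s; rewrite box_time_edge ?box_max_left // H0.
  by have [_ /(_ s)/= -> _] := Fa b.
- move=> b s; rewrite box_time_edge ?box_max_right // H0.
  by have [_ _ /(_ s)/= ->] := Fa b.
- move=> a t s; rewrite (HK (a, t, s)) /K /=.
  by have := box_path_time (t, s); rewrite /box_path => -[-> ->].
Qed.

Section Cofibrations.

Lemma cof_comp (A B C : topologicalType) (i : A -> B) (j : B -> C) :
  free_cofibration R i -> free_cofibration R j -> free_cofibration R (j \o i).
Proof.
move=> [ci hi] [cj hj]; split; first exact: ctn_comp cj ci.
move=> W h G ch cG hG.
have [|H [cH H0 HG]] := hi W (h \o j) G _ cG hG; first exact: ctn_comp ch cj.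
have [|K [cK K0 KH]] := hj W h H ch cH; first by move=> b; rewrite H0.
by exists K; split=> // a t /=; rewrite KH HG.
Qed.

Lemma set_val_point (X : ptopologicalType) (a : set_type [set point : X]) :
  set_val a = point.
Proof. exact: (set_mem (valP a)). Qed.

Lemma well_pointed_hep (X : ptopologicalType) : well_pointed R X ->
  forall (W : topologicalType) (h : X -> W) (g : I -> W), ctn h -> ctn g ->
  g (i0 R) = h point -> exists H : X * I -> W,
    [/\ ctn H, forall x, H (x, i0 R) = h x & forall t, H (point, t) = g t].
Proof.
move=> [_ hep] W h g ch cg hg.
have [||a|H [cH H0 HG]] := hep W h (fun p => g p.2).
- exact: ch.
- by cts.
- by rewrite /= hg set_val_point.
exists H; split=> // t.
by have := HG (exist _ (point : X) (mem_set (erefl : [set point : X] point))) t.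
Qed.

Lemma hep_well_pointed (X : ptopologicalType) :
  (forall (W : topologicalType) (h : X -> W) (g : I -> W), ctn h -> ctn g ->
  g (i0 R) = h point -> exists H : X * I -> W,
    [/\ ctn H, forall x, H (x, i0 R) = h x & forall t, H (point, t) = g t]) ->
  well_pointed R X.
Proof.
move=> hep; split; first exact: initial_continuous.
move=> W h G ch cG hG; have {}cG : ctn G := cG.
pose pt : set_type [set point : X] := exist _ (point : X) (mem_set (erefl : [set point : X] point)).
have ptE a : a = pt by apply: val_inj; exact: set_val_point.
have [||H [cH H0 HG]] := hep W h (fun t => G (pt, t)) ch; first by cts.
  by rewrite hG.
by exists H; split=> // a t; rewrite (ptE a) HG.
Qed.

Lemma well_pointed_cof (A B : ptopologicalType) (j : A -> B) :
  free_cofibration R j -> j point = point -> well_pointed R A -> well_pointed R B.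
Proof.
move=> [cj hj] pj /well_pointed_hep wA; apply: hep_well_pointed => W h g ch cg hg.
have [||H [cH H0 HG]] := wA W (h \o j) g _ cg; first exact: ctn_comp ch cj.
  by rewrite /= pj.
have [|K [cK K0 KH]] := hj W h H ch cH; first by move=> b; rewrite H0.
by exists K; split=> // t; rewrite -pj KH HG.
Qed.

(** The suspension coordinate leads to [hep_box]: the bottom carries the given map, and at both ends
    the homotopy is forced to be that of the base point. The same device serves for
    [well_pointed_susp], [cof_mcl] and [cof_mcone_map]. *)
Lemma cof_susp1 (A B : ptopologicalType) (j : A -> B) : free_cofibration R j ->
  j point = point -> free_cofibration R (smash_map j (@idfun (Circle R))).
Proof.
move=> cj pj; have [ccj _] := cj.
have [cm pm] : pointed_map (smash_map j (@idfun (Circle R))).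
  exact: (@pmap_susp R 1 A B j (conj ccj pj)).
split=> //.
move=> W h G ch cG hG; have {}ch : ctn h := ch; have {}cG : ctn G := cG.
have csB := @ctn_smk1 R B; have csA := @ctn_smk1 R A.
have [|||||||||H [cH H0 Hl Hr HG]] := @hep_box A B W j
  (fun p : B * I => h (smk p.1 (circle_pt p.2))) (fun p : B * I => G (point, p.2))
  (fun p : B * I => G (point, p.2))
  (fun p : A * I * I => G (smk p.1.1 (circle_pt p.1.2), p.2)) cj.
- exact: ctn_comp ch csB.
- by cts.
- by cts.
- apply: (@ctn_comp _ _ _ (fun p : A * I * I => (smk p.1.1 (circle_pt p.1.2), p.2))) => //.
  by apply: ctn_pair; [apply: (@ctn_comp _ _ _ fst _ csA)|]; cts.
- by move=> b; rewrite /= circle_pt0 smk_ptr hG pm.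
- by move=> b; rewrite /= smk_ptr hG pm.
- by move=> a t; rewrite /= hG smash_mapE.
- by move=> a t; rewrite /= circle_pt0 smk_ptr.
- by move=> a t; rewrite /= smk_ptr.
have [|||K [cK KE]] := @susp1_homotopy R B W H (fun s => G (point, s)) cH.
- by move=> t s; rewrite -pj HG /= smk_ptl.
- by move=> x s; rewrite Hr.
- by move=> x s; rewrite Hl.
exists K; split=> [//|w|w s].
  by have [x [t ->]] := susp1P w; rewrite KE H0.
by have [x [t ->]] := susp1P w; rewrite smash_mapE // KE HG.
Qed.

Lemma cof_susp k (A B : ptopologicalType) (j : A -> B) : free_cofibration R j ->
  j point = point -> free_cofibration R (susp_map (R := R) k j).
Proof.
move=> cj pj; elim: k => //= k IH.
by apply: cof_susp1 => //; exact: susp_map_pt.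
Qed.

Lemma well_pointed_susp k (A : ptopologicalType) :
  well_pointed R A -> well_pointed R (Susp R k A).
Proof.
move=> wA; elim: k => //= k wk; apply: hep_well_pointed => W h g ch cg hg.
have csA := @ctn_smk1 R (Susp R k A).
have [|||||||||H [cH H0 Hl Hr HG]] := @hep_box _ _ W _
  (fun p : Susp R k A * I => h (smk p.1 (circle_pt p.2))) (fun p => g p.2)
  (fun p => g p.2) (fun p => g p.2) wk.
- exact: ctn_comp ch csA.
- by cts.
- by cts.
- by cts.
- by move=> b; rewrite /= circle_pt0 smk_ptr hg.
- by move=> b; rewrite /= smk_ptr hg.
- by move=> a t; rewrite /= hg set_val_point smk_ptl.
- by [].
- by [].
have pE t s : H (point, t, s) = g s.
  exact: (HG (exist _ (point : Susp R k A) (mem_set (erefl : [set point : Susp R k A] point))) t s).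
have [|||K [cK KE]] := @susp1_homotopy R (Susp R k A) W H g cH.
- exact: pE.
- by move=> x s; rewrite Hr.
- by move=> x s; rewrite Hl.
exists K; split=> [//|w|s].
  by have [x [t ->]] := susp1P w; rewrite KE H0.
by rewrite susp_ptE KE pE.
Qed.

(** Here [hep_box] is applied to the inclusion of the base point of [A]. At cone coordinate 0 the
    homotopy is already given on [X], at coordinate 1 it follows the base point. *)
Lemma cof_mcl (A X : ptopologicalType) (f : A -> X) : pointed_map f ->
  well_pointed R A -> free_cofibration R (mcl f : X -> mcone R f).
Proof.
move=> [cf pf] wA; split; first exact: ctn_mcl.
move=> W h G ch cG hG; have {}ch : ctn h := ch; have {}cG : ctn G := cG.
have {}cf : ctn f := cf; have cm := @ctn_mcr R A X f.
have [|||||||||H [cH H0 Hl Hr HG]] := @hep_box _ _ W _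
  (fun p : A * I => h (mcr f (cmk p.1 p.2))) (fun p : A * I => G (f p.1, p.2))
  (fun p => G (point, p.2)) (fun p => G (point, p.2)) wA.
- exact: ctn_comp ch cm.
- by cts.
- by cts.
- by cts.
- by move=> b; rewrite /= mcone_glue hG.
- by move=> b; rewrite /= /cmk smk_ptr mcr_pt // hG.
- by move=> a t; rewrite /= hG set_val_point /cmk smk_ptl mcr_pt.
- by move=> a t; rewrite /= set_val_point pf.
- by [].
have pE t s : H (point, t, s) = G (point, s).
  exact: (HG (exist _ (point : A) (mem_set (erefl : [set point : A] point))) t s).
have [|||K [cK Kl Kr]] := @mcone_homotopy R A X f W G H cG cH.
- exact: pE.
- by move=> x s; rewrite Hr.
- by move=> x s; rewrite Hl.
exists K; split=> [//|w|x s]; last by rewrite Kl.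
by have [[y ->]|[x [t ->]]] := mconeP w; rewrite ?Kl ?Kr ?hG ?H0.
Qed.

Lemma well_pointed_mcone (A X : ptopologicalType) (f : A -> X) : pointed_map f ->
  well_pointed R A -> well_pointed R X -> well_pointed R (mcone R f).
Proof. by move=> pf wA; apply: well_pointed_cof (cof_mcl pf wA) _. Qed.

(** The homotopy is given on [X] and on the cone of [P]. The first fixes the side at coordinate 0,
    the second is the datum over [j], and the side at coordinate 1 follows the base point. *)
Lemma cof_mcone_map (P Q X : ptopologicalType) (j : P -> Q) (u : Q -> X) (u' : P -> X) :
  free_cofibration R j -> j point = point -> pointed_map u -> (forall p, u' p = u (j p)) ->
  free_cofibration R (mcone_map u' u idfun j : mcone R u' -> mcone R u).
Proof.
move=> cj pj [cu pu] uE; have [ccj _] := cj.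
have pi := pmap_id X; have pmj : pointed_map j by split.
have pm : pointed_map (mcone_map u' u idfun j : mcone R u' -> mcone R u).
  by apply: pmap_mcone_map.
have ml x : mcone_map u' u idfun j (mcl u' x : mcone R u') = mcl u x.
  by rewrite mcone_map_l.
have mr p t : mcone_map u' u idfun j (mcr u' (cmk p t) : mcone R u') = mcr u (cmk (j p) t).
  by rewrite mcone_map_r.
have pu' : u' point = point by rewrite uE pj.
split; first by case: pm.
move=> W h G ch cG hG; have {}ch : ctn h := ch; have {}cG : ctn G := cG.
have {}cu : ctn u := cu; have cm := @ctn_mcr R Q X u; have cm' := @ctn_mcr R P X u'.
have cl' := @ctn_mcl R P X u'.
have [|||||||||H [cH H0 Hl Hr HG]] := @hep_box P Q W j
  (fun p : Q * I => h (mcr u (cmk p.1 p.2))) (fun p : Q * I => G (mcl u' (u p.1), p.2))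
  (fun p => G (mcl u' point, p.2)) (fun p : P * I * I => G (mcr u' (cmk p.1.1 p.1.2), p.2)) cj.
- exact: ctn_comp ch cm.
- by cts.
- by cts.
- apply: (@ctn_comp _ _ _ (fun p : P * I * I => (mcr u' (cmk p.1.1 p.1.2), p.2))) => //.
  by apply: ctn_pair; [apply: (@ctn_comp _ _ _ fst _ cm')|]; cts.
- by move=> b; rewrite /= mcone_glue hG ml.
- by move=> b; rewrite /= /cmk smk_ptr mcr_pt // hG ml.
- by move=> a t; rewrite /= hG mr.
- by move=> a t; rewrite /= mcone_glue uE.
- by move=> a t; rewrite /= /cmk smk_ptr mcr_pt.
have cU : ctn (fun p : X * I => G (mcl u' p.1, p.2)) by cts.
have [|||K [cK Kl Kr]] := @mcone_homotopy R Q X u W _ H cU cH.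
- by move=> t s; rewrite -pj HG /= /cmk smk_ptl mcr_pt.
- by move=> x s; rewrite Hr.
- by move=> x s; rewrite Hl.
exists K; split=> [//|w|w s].
  by have [[y ->]|[x [t ->]]] := mconeP w; rewrite ?Kl ?Kr ?hG ?H0 ?ml.
by have [[y ->]|[x [t ->]]] := mconeP w; rewrite ?ml ?mr ?Kl ?Kr ?HG.
Qed.

(* The extended homotopy is automatically pointed, since [j] is. *)
Lemma pointed_hep (A B Z : ptopologicalType) (j : A -> B) (h : B -> Z) (G : A * I -> Z) :
  free_cofibration R j -> j point = point -> ctn h -> ctn G ->
  (forall t, G (point, t) = point) -> (forall a, G (a, i0 R) = h (j a)) ->
  exists H : B * I -> Z, [/\ ctn H, forall b, H (b, i0 R) = h b,
    forall a t, H (j a, t) = G (a, t) & forall t, H (point, t) = point].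
Proof.
move=> [_ hep] pj ch cG Gp hG; have [H [cH H0 HG]] := hep Z h G ch cG hG.
by exists H; split=> // t; rewrite -pj HG.
Qed.

End Cofibrations.
End Box.

(** * Maps of mapping cones induced by homotopy commutative squares *)

Section Hsq.
Variable R : realType.
Local Notation I := (I01 R).
Local Notation "f =h g" := (homotopic R f g) (at level 70).
Local Notation he := (homotopy_equivalence R).

(** Interpolate linearly between the reparametrizations. They start at the same value and both end
    at 1, so the gluing at coordinate 0 and the collapse at 1 are untouched. *)
Lemma mcone_reparam (X Y Z : ptopologicalType) (f : X -> Y) (g h : mcone R f -> Z)
    (V : X * I -> Z) (phi psi : I -> I) :
  pointed_map g -> ctn V -> ctn phi -> ctn psi ->
  (forall t, V (point, t) = point) -> (forall x, V (x, i1 R) = point) ->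
  phi (i0 R) = psi (i0 R) -> phi (i1 R) = i1 R -> psi (i1 R) = i1 R ->
  (forall y, g (mcl f y) = h (mcl f y)) ->
  (forall x t, g (mcr f (cmk x t)) = V (x, phi t)) ->
  (forall x t, h (mcr f (cmk x t)) = V (x, psi t)) ->
  g =h h.
Proof.
move=> [cg pg] cV cphi cpsi Vp V1 e0 phi1 psi1 ml Vg Vh; have {}cg : ctn g := cg.
have cl := @ctn_mcl R X Y f.
pose chi (t s : I) := clamp ((1 - ival s) * ival (phi t) + ival s * ival (psi t)).
have chi_cst t s : phi t = psi t -> chi t s = phi t.
  by rewrite /chi => ->; rewrite -mulrDl subrK mul1r ivalK.
apply: (@mcone_homotopic R X Y f Z g h (fun p => g (mcl f p.1))
  (fun p => V (p.1.1, chi p.1.2 p.2))) => //= [||x s|x s|x t|x t].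
- by cts.
- by rewrite /chi; cts.
- by rewrite chi_cst ?phi1 ?psi1.
- by rewrite chi_cst // -Vg mcone_glue.
- by rewrite /chi ival0 subr0 mul1r mul0r addr0 ivalK -Vg.
- by rewrite /chi ival1 subrr mul1r mul0r add0r ivalK -Vh.
Qed.

Section Hsq.
Variables (A B A' B' : ptopologicalType) (f : A -> B) (f' : A' -> B').

Definition hsq_data (b : B -> B') (K : A * I -> B') (a : A -> A') : Prop :=
  [/\ pointed_map b, pointed_map a,
      ctn K /\ forall t, K (point, t) = point,
      forall x, K (x, i0 R) = b (f x)
    & forall x, K (x, i1 R) = f' (a x)].

(** The homotopy from [b \o f] to [f' \o a] needs room: it runs on the first half of the cone
    coordinate, and the cone of [a] occupies the second half. *)
Definition hsq_cone (K : A * I -> B') (a : A -> A') (p : A * I) : mcone R f' :=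
  if ival p.2 <= 1 / 2 then mcl f' (K (p.1, clamp (2 * ival p.2)))
  else mcr f' (cmk (a p.1) (clamp (2 * ival p.2 - 1))).

Definition hsq (b : B -> B') (K : A * I -> B') (a : A -> A') : mcone R f -> mcone R f' :=
  mcone_rec (fun y => mcl f' (b y)) (fun x t => hsq_cone K a (x, t)).

Variables (b : B -> B') (K : A * I -> B') (a : A -> A').
Hypotheses (pf' : f' point = point) (sq : hsq_data b K a).

Lemma ctn_hsq_cone : ctn (hsq_cone K a).
Proof.
have [_ [ca pa] [cK _] _ K1] := sq; have {}ca : ctn a := ca.
have cl := @ctn_mcl R _ _ f'; have cr := @ctn_mcr R _ _ f'.
apply: ctn_paste => [|||[x t] /= e]; [by cts|by cts| |].
  apply: (@ctn_comp _ _ _ (fun p : A * I => (a p.1, clamp (2 * ival p.2 - 1))) _ cr).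
  by cts.
by rewrite e clamp1 ?clamp0 ?K1 ?mcone_glue //; lra.
Qed.

Lemma hsq_cone_pt t : hsq_cone K a (point, t) = point.
Proof.
have [_ [_ pa] [_ Kp] _ _] := sq; rewrite /hsq_cone /=; case: ifP => _.
  by rewrite Kp.
by rewrite pa /cmk smk_ptl mcr_pt.
Qed.

Lemma hsq_cone1 x : hsq_cone K a (x, i1 R) = point.
Proof.
rewrite /hsq_cone /= ival1 ifF; last by lra.
by rewrite clamp1; [rewrite /cmk smk_ptr mcr_pt|lra].
Qed.

Lemma hsq_cone0 x : hsq_cone K a (x, i0 R) = mcl f' (b (f x)).
Proof.
have [_ _ _ K0 _] := sq; rewrite /hsq_cone /= ival0 ifT; last by lra.
by rewrite clamp0 ?K0 //; lra.
Qed.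

Lemma hsq_l y : hsq b K a (mcl f y) = mcl f' (b y).
Proof.
have [[_ pb] _ _ _ _] := sq.
by apply: mcone_recl => *; rewrite ?hsq_cone_pt ?hsq_cone0 ?hsq_cone1 ?pb.
Qed.

Lemma hsq_r x t : hsq b K a (mcr f (cmk x t)) = hsq_cone K a (x, t).
Proof.
have [[_ pb] _ _ _ _] := sq.
by apply: (mcone_recr (u := fun y => mcl f' (b y)) (v := fun x t => hsq_cone K a (x, t)))
  => *; rewrite ?hsq_cone_pt ?hsq_cone0 ?hsq_cone1 ?pb.
Qed.

Lemma pmap_hsq : pointed_map (hsq b K a).
Proof.
have [[cb pb] _ _ _ _] := sq; have {}cb : ctn b := cb.
have cl := @ctn_mcl R _ _ f'.
split; last by rewrite [LHS](hsq_l point) pb.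
apply: ctn_mcone; first by apply: (ctn_eq hsq_l); cts.
by apply: ctn_eq ctn_hsq_cone => -[x t]; exact: hsq_r.
Qed.

End Hsq.
Arguments hsq {A B A' B'} f f' b K a _.

Section Family.
Variables (A B A' B' : ptopologicalType) (f : A -> B) (f' : A' -> B').
Variables (be : B * I -> B') (F : A * I * I -> B') (al : A * I -> A').
Hypotheses (pf' : f' point = point).
Hypotheses (cbe : ctn be) (cF : ctn F) (cal : ctn al).
Hypotheses (pbe : forall s, be (point, s) = point) (pF : forall t s, F (point, t, s) = point).
Hypotheses (pal : forall s, al (point, s) = point).
Hypotheses (F0 : forall x s, F (x, i0 R, s) = be (f x, s)).
Hypotheses (F1 : forall x s, F (x, i1 R, s) = f' (al (x, s))).

Lemma hsq_data_slice s :
  hsq_data f f' (fun y => be (y, s)) (fun p => F (p.1, p.2, s)) (fun x => al (x, s)).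
Proof.
split=> //=.
- by split=> //; have : ctn (fun y => be (y, s)) by cts.
- by split=> //; have : ctn (fun x => al (x, s)) by cts.
- by split=> //; cts.
Qed.

Lemma hsq_family :
  hsq f f' (fun y => be (y, i0 R)) (fun p => F (p.1, p.2, i0 R)) (fun x => al (x, i0 R)) =h
  hsq f f' (fun y => be (y, i1 R)) (fun p => F (p.1, p.2, i1 R)) (fun x => al (x, i1 R)).
Proof.
have cl := @ctn_mcl R _ _ f'; have cr := @ctn_mcr R _ _ f'.
have sq := hsq_data_slice.
apply: (@mcone_homotopic R A B f _ _ _ (fun p => mcl f' (be p))
  (fun p : A * I * I => hsq_cone f' (fun q => F (q.1, q.2, p.2)) (fun x => al (x, p.2)) p.1)).
- by cts.
- apply: ctn_paste => [|||[[x t] s] /= e]; [by cts|by cts| |].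
    apply: (@ctn_comp _ _ _
      (fun p : A * I * I => (al (p.1.1, p.2), clamp (2 * ival p.1.2 - 1))) _ cr).
    by cts.
  by rewrite e clamp1 ?clamp0 ?F1 ?mcone_glue //; lra.
- by move=> s; rewrite pbe.
- by move=> t s; apply: hsq_cone_pt (sq s) _.
- by move=> x s; apply: hsq_cone1 (x).
- by move=> x s; rewrite (hsq_cone0 (sq s)).
- by move=> y; rewrite (hsq_l pf' (sq _)).
- by move=> y; rewrite (hsq_l pf' (sq _)).
- by move=> x t; rewrite (hsq_r pf' (sq _)).
- by move=> x t; rewrite (hsq_r pf' (sq _)).
Qed.

End Family.

(** [K1] is the top edge of a filled square with bottom [K0] and with the homotopies [be \o f] and
    [f' \o al] as its sides. The horizontal slices form the family needed by [hsq_family]. *)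
Lemma hsq_homotopy (A B A' B' : ptopologicalType) (f : A -> B) (f' : A' -> B')
    (b0 b1 : B -> B') (K0 : A * I -> B') (a0 a1 : A -> A') :
  pointed_map f -> pointed_map f' -> hsq_data f f' b0 K0 a0 ->
  b0 =h b1 -> a0 =h a1 ->
  exists2 K1, hsq_data f f' b1 K1 a1 & hsq f f' b0 K0 a0 =h hsq f f' b1 K1 a1.
Proof.
move=> [cf pf] [cf' pf'] sq [be [cbe be0 be1 pbe]] [al [cal al0 al1 pal]].
have {}cf : ctn f := cf; have {}cf' : ctn f' := cf'.
have {}cbe : ctn be := cbe; have {}cal : ctn al := cal.
have [_ _ [cK Kp] K00 K01] := sq.
have [||||F [cF Fa FE]] := @box_fill R A B' K0 (fun p => be (f p.1, p.2))
  (fun p => f' (al p)) cK.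
- by cts.
- by cts.
- by move=> x; rewrite K00 be0.
- by move=> x; rewrite K01 al0.
(* Over the base point the boundary data are constant, so the constant function is an admissible [k]
   in the description of [F]. *)
have pF t s : F (point, t, s) = point.
  have [kb kl kr] := Fa point.
  apply: (FE point (fun=> point)); split=> [t'|s'|s'].
  - by rewrite Kp.
  - by rewrite /= pf pbe.
  - by rewrite /= pal pf'.
have F0 x s : F (x, i0 R, s) = be (f x, s) by have [_ /(_ s)/= -> _] := Fa x.
have F1 x s : F (x, i1 R, s) = f' (al (x, s)) by have [_ _ /(_ s)/= ->] := Fa x.
have sqs := hsq_data_slice cbe cF cal pbe pF pal F0 F1.
have fam := hsq_family pf' cbe cF cal pbe pF pal F0 F1.
exists (fun p => F (p.1, p.2, i1 R)).
  by have := sqs (i1 R); rewrite (funext be1) (funext al1).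
move: fam; rewrite (funext be1) (funext al1) (funext be0) (funext al0).
rewrite (_ : (fun p => F (p.1, p.2, i0 R)) = K0) //.
by apply/funext => -[x t]; have [/(_ t)/= -> _ _] := Fa x.
Qed.

Definition hconcat (X Z : Type) (H K : X * I -> Z) (p : X * I) : Z :=
  if ival p.2 <= 1 / 2 then H (p.1, clamp (2 * ival p.2))
  else K (p.1, clamp (2 * ival p.2 - 1)).

Section Compose.
Variables (A B A' B' A'' B'' : ptopologicalType).
Variables (f : A -> B) (f' : A' -> B') (f'' : A'' -> B'').
Variables (b : B -> B') (K : A * I -> B') (a : A -> A').
Variables (b' : B' -> B'') (K' : A' * I -> B'') (a' : A' -> A'').
Hypotheses (pf' : f' point = point) (pf'' : f'' point = point).
Hypotheses (sq : hsq_data f f' b K a) (sq' : hsq_data f' f'' b' K' a').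

Let KK := hconcat (fun p => b' (K p)) (fun p => K' (a p.1, p.2)).

Lemma hsq_data_comp : hsq_data f f'' (b' \o b) KK (a' \o a).
Proof.
have [pb pa [cK Kp] K0 K1] := sq; have [pb' pa' [cK' Kp'] K0' K1'] := sq'.
have cb' : ctn b' by case: pb'. have ca : ctn a by case: pa.
split=> [|||x|x]; [exact: pmap_comp|exact: pmap_comp| | |].
- split; last by move=> t; rewrite /KK /hconcat /= Kp pb'.2 pa.2 Kp'; case: ifP.
  apply: ctn_paste => [|||[x t] /= e]; [by cts|by cts|by cts|].
  by rewrite e clamp1 ?clamp0 ?K1 ?K0' //; lra.
- by rewrite /KK /hconcat /= ival0 ifT ?clamp0 ?K0 //; lra.
- by rewrite /KK /hconcat /= ival1 ifF ?clamp1 ?K1' //; lra.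
Qed.

Lemma hsq_comp : hsq f' f'' b' K' a' \o hsq f f' b K a =h hsq f f'' (b' \o b) KK (a' \o a).
Proof.
have sq2 := hsq_data_comp.
(* The composite runs [K], [K'] and the cone on [[0,1/2]], [[1/2,3/4]] and [[3/4,1]]; the square of
   the concatenation does so on [[0,1/4]], [[1/4,1/2]] and [[1/2,1]]. This maximum of three affine
   functions carries the first subdivision to the second. *)
pose phi (t : I) : I := clamp (Num.max (ival t / 2) (Num.max (ival t - 1 / 4) (2 * ival t - 1))).
apply: (@mcone_reparam _ _ _ f _ _ (hsq_cone f'' KK (a' \o a)) phi (fun t => t)).
- by apply: pmap_comp; exact: pmap_hsq.
- exact: ctn_hsq_cone sq2.
- by rewrite /phi; cts.
- exact: ctn_id.
- by move=> t; exact: hsq_cone_pt sq2 _.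
- by move=> x; exact: hsq_cone1.
- by rewrite /phi ival0; apply: clamp0; rewrite !ge_max; lra.
- by rewrite /phi ival1; apply: clamp1; rewrite !le_max; apply/orP; right; apply/orP; right; lra.
- by [].
- by move=> y; rewrite /= (hsq_l pf' sq) (hsq_l pf'' sq') (hsq_l pf'' sq2).
- move=> x t; rewrite /= (hsq_r pf' sq) /hsq_cone /=.
  have := ival_ge0 t; have := ival_le1 t => t1 t0.
  case: ifPn => [t2|/negP t2].
    rewrite (hsq_l pf'' sq') /phi.
    have -> : Num.max (ival t / 2) (Num.max (ival t - 1 / 4) (2 * ival t - 1)) = ival t / 2.
      by apply/max_idPl; rewrite ge_max; lra.
    have e : ival (clamp (ival t / 2)) = ival t / 2 by rewrite clampE' //; lra.
    rewrite e ifT; last lra.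
    rewrite (_ : 2 * (ival t / 2) = ival t); last lra.
    by rewrite ivalK /KK /hconcat /= t2.
  rewrite (hsq_r pf'' sq') /hsq_cone /=.
  have e : ival (clamp (2 * ival t - 1)) = 2 * ival t - 1 by rewrite clampE' //; lra.
  rewrite e; case: ifPn => [t3|/negP t3].
    have -> : phi t = clamp (ival t - 1 / 4).
      have h : Num.max (ival t - 1 / 4) (2 * ival t - 1) = ival t - 1 / 4.
        by apply/max_idPl; lra.
      by rewrite /phi h; congr clamp; apply/max_idPr; lra.
    have e1 : ival (clamp (ival t - 1 / 4)) = ival t - 1 / 4 by rewrite clampE' //; lra.
    rewrite e1 ifT; last lra.
    have e2 : ival (clamp (2 * (ival t - 1 / 4))) = 2 * (ival t - 1 / 4).
      by rewrite clampE' //; lra.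
    rewrite /KK /hconcat /= e2 ifF; last lra.
    by congr (mcl _ (K' (_, clamp _))); lra.
  have -> : phi t = clamp (2 * ival t - 1).
    have h : Num.max (ival t - 1 / 4) (2 * ival t - 1) = 2 * ival t - 1.
      by apply/max_idPr; lra.
    by rewrite /phi h; congr clamp; apply/max_idPr; lra.
  by rewrite e ifF; last lra.
- by move=> x t; rewrite (hsq_r pf'' sq2).
Qed.

End Compose.

(** With a constant homotopy the first half of the cone coordinate stands still, so the two maps
    differ by the reparametrization [2t - 1], clamped at 0. *)
Lemma hsq_strict (A B A' B' : ptopologicalType) (f : A -> B) (f' : A' -> B')
    (b : B -> B') (a : A -> A') :
  pointed_map f -> f' point = point -> pointed_map b -> pointed_map a ->
  (forall x, b (f x) = f' (a x)) ->
  hsq_data f f' b (fun p => b (f p.1)) a /\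
  hsq f f' b (fun p => b (f p.1)) a =h mcone_map f f' b a.
Proof.
move=> [cf pf] pf' [cb pb] [ca pa] e.
have {}cf : ctn f := cf; have {}cb : ctn b := cb; have {}ca : ctn a := ca.
have cr := @ctn_mcr R _ _ f'.
have sq : hsq_data f f' b (fun p => b (f p.1)) a.
  by split=> //; split; [cts|move=> t /=; rewrite pf pb].
split=> //; apply: (@mcone_reparam _ _ _ f _ _ (fun p => mcr f' (cmk (a p.1) p.2))
  (fun t => clamp (2 * ival t - 1)) (fun t => t)).
- exact: pmap_hsq.
- by apply: (@ctn_comp _ _ _ (fun p : A * I => (a p.1, p.2)) _ cr); cts.
- by cts.
- exact: ctn_id.
- by move=> t /=; rewrite pa /cmk smk_ptl mcr_pt.
- by move=> x /=; rewrite /cmk smk_ptr mcr_pt.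
- by apply: clamp0; rewrite ival0; lra.
- by apply: clamp1; rewrite ival1; lra.
- by [].
- by move=> y; rewrite (hsq_l pf' sq) mcone_map_l.
- move=> x t; rewrite (hsq_r pf' sq) /hsq_cone /=; case: ifPn => // t2.
  by rewrite clamp0 ?mcone_glue ?e //; lra.
- by move=> x t; rewrite mcone_map_r.
Qed.

Lemma mcone_map_id (A B : ptopologicalType) (f : A -> B) : f point = point ->
  mcone_map f f idfun idfun = idfun :> (mcone R f -> mcone R f).
Proof.
move=> pf; apply/funext => w; have pB := pmap_id B; have pA := pmap_id A.
by have [[y ->]|[x [t ->]]] := mconeP w; rewrite ?mcone_map_l ?mcone_map_r.
Qed.

(** [K] followed by its reverse contracts along itself, which deforms the composite into the square
    of a constant homotopy. *)
Lemma hsq_loop_inv (A B : ptopologicalType) (f f' : A -> B) (K : A * I -> B) :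
  pointed_map f -> pointed_map f' -> hsq_data f f' idfun K idfun ->
  exists2 L, hsq_data f' f idfun L idfun &
    hsq f' f idfun L idfun \o hsq f f' idfun K idfun =h idfun.
Proof.
move=> pf pf' sq; have [cf qf] := pf; have [_ qf'] := pf'; have {}cf : ctn f := cf.
have [pB pA [cK Kp] K0 K1] := sq.
pose L (p : A * I) := K (p.1, clamp (1 - ival p.2)).
have sq' : hsq_data f' f idfun L idfun.
  split=> // [|x|x] /=; first by split; [rewrite /L; cts|move=> t; exact: Kp].
  - by rewrite /L /= clamp1 ?K1 // ival0; lra.
  - by rewrite /L /= clamp0 ?K0 // ival1; lra.
exists L => //.
apply: htrans (hsq_comp qf' qf sq sq') _.
(* [min (2t, 2 - 2t)] runs along [K] and back; the factor [1 - s] shortens this excursion to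
   nothing. *)
pose F (p : A * I * I) : B := K (p.1.1,
  clamp ((1 - ival p.2) * Num.min (2 * ival p.1.2) (2 - 2 * ival p.1.2))).
have cF : ctn F by rewrite /F; cts.
have pF t s : F (point, t, s) = point by exact: Kp.
have F0 x s : F (x, i0 R, s) = f x.
  by rewrite /F /= ival0 mulr0 subr0 (min_idPl _) ?mulr0 ?clamp0 ?K0 //; lra.
have F1 x s : F (x, i1 R, s) = f x.
  by rewrite /F /= ival1 mulr1 subrr (min_idPr _) ?mulr0 ?clamp0 ?K0 //; lra.
have cfst : ctn (fun p : B * I => p.1) by cts.
have cfst' : ctn (fun p : A * I => p.1) by cts.
have := hsq_family qf cfst cF cfst' (fun=> erefl) pF (fun=> erefl) F0 F1.
rewrite (_ : (fun p => F (p.1, p.2, i0 R)) = hconcat K (fun p => L (p.1, p.2))); last first.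
  apply/funext => -[x t]; rewrite /F /hconcat /L /= ival0 subr0 mul1r.
  have := ival_ge0 t; have := ival_le1 t => t1 t0.
  case: ifPn => [t2|/negP t2]; first by rewrite (min_idPl _) //; lra.
  have e : ival (clamp (2 * ival t - 1)) = 2 * ival t - 1 by rewrite clampE' //; lra.
  rewrite e (min_idPr _); last by lra.
  by congr (K (x, clamp _)); lra.
move/htrans; apply.
rewrite (_ : (fun p => F (p.1, p.2, i1 R)) = fun p => f p.1); last first.
  by apply/funext => -[x t]; rewrite /F /= ival1 subrr mul0r clamp0 ?K0.
have [_] := @hsq_strict _ _ _ _ f f idfun idfun pf qf pB pA (fun=> erefl).
by rewrite mcone_map_id.
Qed.

(** The reverse square [L] is a left inverse of the given map and has in turn a left inverse [M]. So
    [L] is invertible on both sides, and the given map is an equivalence by cancellation. *)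
Lemma he_hsq_id (A B : ptopologicalType) (f f' : A -> B) (K : A * I -> B) :
  pointed_map f -> pointed_map f' -> hsq_data f f' idfun K idfun ->
  he (hsq f f' idfun K idfun).
Proof.
move=> pf pf' sq; have [L sqL LK] := hsq_loop_inv pf pf' sq.
have [M sqM ML] := hsq_loop_inv pf' pf sqL.
have pK := pmap_hsq pf'.2 sq; have pL := pmap_hsq pf.2 sqL; have pM := pmap_hsq pf'.2 sqM.
have heL : he (hsq f' f idfun L idfun) by exact: he_linv_rinv pL pM pK ML LK.
by apply: he_cancell pK heL _; exact: he_homotopic (hsym LK) (he_id R _).
Qed.

Lemma hsq_he_linv (A B A' B' : ptopologicalType) (f : A -> B) (f' : A' -> B')
    (b : B -> B') (K : A * I -> B') (a : A -> A') (b' : B' -> B) (K' : A' * I -> B)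
    (a' : A' -> A) :
  pointed_map f -> pointed_map f' -> hsq_data f f' b K a -> hsq_data f' f b' K' a' ->
  b' \o b =h idfun -> a' \o a =h idfun ->
  he (hsq f' f b' K' a' \o hsq f f' b K a).
Proof.
move=> pf pf' sq sq' hb ha.
have [L sqL h] := hsq_homotopy pf pf (hsq_data_comp sq sq') hb ha.
apply: he_homotopic (he_hsq_id pf pf sqL).
exact/hsym/(htrans (hsq_comp pf'.2 pf.2 sq sq')).
Qed.

(** The homotopy [K'] for the inverse maps is chosen without coherence with [K], so the composites
    need not be homotopic to the identity. They are squares over maps homotopic to identities, hence
    equivalences by [he_hsq_id], and this is enough for [he_2of6]. *)
Lemma he_hsq (A B A' B' : ptopologicalType) (f : A -> B) (f' : A' -> B')
    (b : B -> B') (K : A * I -> B') (a : A -> A') :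
  pointed_map f -> pointed_map f' -> hsq_data f f' b K a -> he b -> he a ->
  he (hsq f f' b K a).
Proof.
move=> pf pf' sq [pb [b' [pb' b'b bb']]] [pa [a' [pa' a'a aa']]].
have bf : b \o f =h f' \o a.
  have [_ _ [cK Kp] K0 K1] := sq; exists K; split=> //.
have : b' \o f' =h f \o a'.
  apply: (@htrans _ _ _ (b' \o f' \o (a \o a'))).
    have := hcompl (pmap_comp pb' pf') (hsym aa'); exact.
  apply: (@htrans _ _ _ (b' \o (b \o f) \o a')).
    have := hcompr pa' (hcompl pb' (hsym bf)); exact.
  have := hcompr (pmap_comp pf pa') b'b; exact.
move=> [K' [cK' K0' K1' Kp']].
have sq' : hsq_data f' f b' K' a' by split.
apply: (@he_2of6 R _ _ _ _ (hsq f f' b K a) (hsq f' f b' K' a') (hsq f' f b' K' a')).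
- exact: pmap_hsq pf'.2 sq.
- exact: pmap_hsq pf.2 sq'.
- exact: pmap_hsq pf.2 sq'.
- exact: hsq_he_linv.
- exact: hsq_he_linv.
Qed.

Lemma he_mcone_map (A B A' B' : ptopologicalType) (f : A -> B) (f' : A' -> B')
    (b : B -> B') (a : A -> A') :
  pointed_map f -> pointed_map f' -> he b -> he a -> (forall x, b (f x) = f' (a x)) ->
  he (mcone_map f f' b a : mcone R f -> mcone R f').
Proof.
move=> pf pf' hb ha e.
have [sq h] := hsq_strict pf pf'.2 (he_pmap hb) (he_pmap ha) e.
exact: he_homotopic h (he_hsq pf pf' sq hb ha).
Qed.

(** Each attaching map of [T] after the first is such a cone map composed with a homotopy inverse;
    this is its compatibility with the morphism built by [hsq]. *)
Lemma hsq_mcone_map (A B A' B' X : ptopologicalType) (j : A -> B) (j' : A' -> B')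
    (e : B' -> B) (a : A' -> A) (f : B -> X) (f1 : B' -> X) (g : A -> X) (g1 : A' -> X)
    (K : B' * I -> X) :
  pointed_map j -> pointed_map j' -> pointed_map e -> pointed_map a ->
  pointed_map f -> (forall x, e (j' x) = j (a x)) ->
  (forall x, g x = f (j x)) -> (forall x, g1 x = f1 (j' x)) ->
  ctn K -> (forall t, K (point, t) = point) ->
  (forall y, K (y, i0 R) = f1 y) -> (forall y, K (y, i1 R) = f (e y)) ->
  hsq_data g1 g idfun (fun p => K (j' p.1, p.2)) a /\
  hsq g1 g idfun (fun p => K (j' p.1, p.2)) a \o mcone_map j' g1 f1 idfun =h
  mcone_map j g f idfun \o mcone_map j' j e a.
Proof.
move=> pj pj' pe pa pf ej gE g1E cK Kp K0 K1.
have cj' : ctn j' by case: pj'.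
have pg : g point = point by rewrite gE pj.2 pf.2.
have pf1 : pointed_map f1.
  split; last by rewrite -K0 Kp.
  by apply: (@ctn_eq _ _ _ (fun y => K (y, i0 R))) => //; cts.
have pg1 : g1 point = point by rewrite g1E pj'.2 pf1.2.
have sq : hsq_data g1 g idfun (fun p => K (j' p.1, p.2)) a.
  split=> // [||x|x] /=.
  - exact: pmap_id.
  - by split; [cts|move=> t; rewrite pj'.2].
  - by rewrite K0 g1E.
  - by rewrite K1 ej gE.
have pX := pmap_id X; have pA := pmap_id A; have pA' := pmap_id A'.
have fj x : f (j x) = g (idfun x) by rewrite gE.
have fj1 x : f1 (j' x) = g1 (idfun x) by rewrite g1E.
have qj := pj.2.
split=> //; have cl := @ctn_mcl R _ _ g; have cc := ctn_hsq_cone sq.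
(* At time [s] the base has moved along [K] up to [s], and the cone starts at coordinate [s / 2],
   where [hsq_cone] has reached the same point of [K]. At the end only its second half, the cone of
   [a], remains. *)
apply: (@mcone_homotopic R A' B' j' _ _ _ (fun p => mcl g (K p))
  (fun p => hsq_cone g (fun p => K (j' p.1, p.2)) a (p.1.1,
     clamp (ival p.2 / 2 + ival p.1.2 * (1 - ival p.2 / 2))))).
- by cts.
- apply: (@ctn_comp _ _ _ (fun p : A' * I * I => (p.1.1,
     clamp (ival p.2 / 2 + ival p.1.2 * (1 - ival p.2 / 2)))) _ cc).
  by cts.
- by move=> s; rewrite Kp.
- by move=> t s; rewrite (hsq_cone_pt pg sq).
- by move=> x s /=; rewrite ivalpt mul1r addrC subrK clamp1 ?hsq_cone1.
- move=> x s /=; rewrite ival0 mul0r addr0 /hsq_cone /=.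
  have := ival_ge0 s; have := ival_le1 s => s1 s0.
  have h : ival (clamp (ival s / 2)) = ival s / 2 by rewrite clampE' //; lra.
  rewrite h ifT; last lra.
  by rewrite (_ : 2 * (ival s / 2) = ival s) ?ivalK //; lra.
- by move=> y; rewrite /= K0 mcone_map_l // (hsq_l pg sq).
- by move=> y; rewrite /= K1 !mcone_map_l.
- move=> x t; rewrite /= ival0 mul0r add0r subr0 mulr1 ivalK mcone_map_r //.
  by rewrite (hsq_r pg sq).
- move=> x t; rewrite /= !mcone_map_r // ival1 /hsq_cone /=.
  have := ival_ge0 t; have := ival_le1 t => t1 t0.
  have h : ival (clamp (1 / 2 + ival t * (1 - 1 / 2))) = 1 / 2 + ival t / 2.
    by rewrite clampE'; lra.
  rewrite h; case: ifPn => [t2|/negP t2].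
    have t00 : t = i0 R by apply: ival_inj; rewrite ival0; lra.
    rewrite clamp1; last lra.
    by rewrite K1 ej t00 mcone_glue gE.
  by rewrite (_ : 2 * _ - 1 = ival t) ?ivalK //; lra.
Qed.

(** After collapsing the base, a map built by [hsq] suspends [a] on the second half of the circle
    only. This self-map of the suspension, waiting at the base point during the first half, accounts
    for the difference. *)
Lemma susp_slow (W : ptopologicalType) : exists2 th : Susp R 1 W -> Susp R 1 W,
  th =h idfun &
  forall w t, th (smk w (circle_pt t)) = smk w (circle_pt (clamp (2 * ival t - 1))).
Proof.
pose la (t s : I) := clamp ((1 - ival s) * ival (clamp (2 * ival t - 1)) + ival s * ival t).
have cs := @ctn_smk1 R W.
have la0 s : la (i0 R) s = i0 R.
  rewrite /la ival0 [in ival (clamp _)]clamp0; last lra.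
  by rewrite ival0 !mulr0 addr0 clamp0.
have la1 s : la (i1 R) s = i1 R.
  rewrite /la ival1 [in ival (clamp _)]clamp1; last lra.
  by rewrite ival1 !mulr1 subrK clamp1.
have [||||H [cH HE]] := @susp1_homotopy R W (smash W (Circle R))
  (fun p => smk p.1.1 (circle_pt (la p.1.2 p.2))) (fun=> point).
- apply: (@ctn_comp _ _ _ (fun p : W * I * I => (p.1.1, la p.1.2 p.2)) _ cs).
  by rewrite /la; cts.
- by move=> t s; rewrite smk_ptl.
- by move=> x s; rewrite /= (la1 s) smk_ptr.
- by move=> x s; rewrite /= la0 circle_pt0 smk_ptr.
exists (fun w => H (w, i0 R)); last first.
  by move=> w t; rewrite HE /= /la ival0 subr0 mul1r mul0r addr0 ivalK.
exists H; split=> // [w|t].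
  by have [x [t ->]] := susp1P w; rewrite HE /= /la ival1 subrr mul0r mul1r add0r ivalK.
by rewrite susp_ptE HE /= smk_ptl.
Qed.

(** * Homotopy extension and lifting against homotopy equivalences *)

Section Help.
Variables (A B : ptopologicalType) (j : A -> B).
Hypotheses (cj : free_cofibration R j) (pj : j point = point).

Definition hrel (Z : ptopologicalType) (f g : B -> Z) : Prop :=
  exists D : B * I -> Z, [/\ ctn D, forall b, D (b, i0 R) = f b,
    forall b, D (b, i1 R) = g b & forall a t, D (j a, t) = f (j a)].

Lemma hrel_homotopic (Z : ptopologicalType) (f g : B -> Z) :
  f point = point -> hrel f g -> f =h g.
Proof. by move=> pf [D [cD D0 D1 DA]]; exists D; split=> // t; rewrite -pj DA pj. Qed.

Lemma hrel_comp (Z W : ptopologicalType) (k : Z -> W) (f g : B -> Z) :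
  ctn k -> hrel f g -> hrel (k \o f) (k \o g).
Proof.
move=> ck [D [cD D0 D1 DA]]; exists (fun p => k (D p)); split=> [|b|b|a t] /=.
- by cts.
- by rewrite D0.
- by rewrite D1.
- by rewrite DA.
Qed.

Section Deform.
Variables (P : ptopologicalType) (th : P -> P).
Hypothesis hth : th =h idfun.

(** [a'] is the end of a homotopy that starts at [V] and over [A] moves [th \o u] to [u]. *)
Lemma hrel_surj (u : A -> P) (V : B -> P) : pointed_map u -> pointed_map V ->
  (forall a, V (j a) = th (u a)) ->
  exists a', [/\ pointed_map a', forall a, a' (j a) = u a & hrel (th \o a') V].
Proof.
move=> [cu pu] [cV pV] Vj; have [T [cT T0 T1 Tp]] := hth.
have {}cT : ctn T := cT; have {}cu : ctn u := cu; have {}cV : ctn V := cV.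
have [|||E [cE E0 EA Ep]] := @pointed_hep R A B P j V (fun p => T (u p.1, p.2)) cj pj cV.
- by cts.
- by move=> t; rewrite /= pu Tp.
- by move=> a; rewrite /= T0 Vj.
have T1' x : T (x, i1 R) = x by exact: T1.
exists (fun b => E (b, i1 R)); split=> [|a|].
- by split=> //; have : ctn (fun b => E (b, i1 R)) by cts.
- by rewrite EA.
pose rv (t : I) := clamp (1 - ival t).
have rv0 : rv (i0 R) = i1 R by apply: clamp1; rewrite ival0; lra.
have rv1 : rv (i1 R) = i0 R by apply: clamp0; rewrite ival1; lra.
have crv : ctn rv by rewrite /rv; cts.
(* Run backwards, [T] joins [a'] to [th \o a'] and [E] joins [a'] to [V], in the same way over [A].
   The top edge of the square between them is a homotopy rel [A]. *)
have [|||||||||H [cH H0 Hl Hr HG]] := @hep_box R A B P j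
  (fun p => E (p.1, i1 R)) (fun p => T (E (p.1, i1 R), rv p.2)) (fun p => E (p.1, rv p.2))
  (fun p => T (u p.1.1, rv p.2)) cj.
- by cts.
- by cts.
- by cts.
- by cts.
- by move=> b; rewrite /= rv0 T1'.
- by move=> b; rewrite /= rv0.
- by move=> a t; rewrite /= rv0 EA.
- by move=> a t; rewrite /= EA T1'.
- by move=> a t; rewrite /= EA.
exists (fun p => H (p.1, p.2, i1 R)); split=> [|b|b|a t] /=.
- by cts.
- by rewrite Hl /= rv1 T0.
- by rewrite Hr /= rv1 E0.
- by rewrite HG /= rv1 T0 EA T1'.
Qed.

(** Take the given homotopy as the bottom of a square and the deformations of [th \o a] to [a] and
    of [th \o b] to [b] as its sides; the top edge is the required homotopy. *)
Lemma hrel_inj (a b : B -> P) : pointed_map a -> pointed_map b ->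
  (forall x, a (j x) = b (j x)) -> hrel (th \o a) (th \o b) -> hrel a b.
Proof.
move=> [ca _] [cb _] ab [D [cD D0 D1 DA]]; have [T [cT T0 T1 Tp]] := hth.
have [{}cj' _] := cj; have {}cj' : ctn j := cj'.
have {}cT : ctn T := cT; have {}ca : ctn a := ca; have {}cb : ctn b := cb.
have [||||||||H [cH H0 Hl Hr HG]] := @hep_box R A B P j D
  (fun p => T (a p.1, p.2)) (fun p => T (b p.1, p.2))
  (fun p => T (a (j p.1.1), p.2)) cj cD.
- by cts.
- by cts.
- by cts.
- by move=> x; rewrite D0 /= T0.
- by move=> x; rewrite D1 /= T0.
- by move=> x t; rewrite DA /= T0.
- by [].
- by move=> x t; rewrite /= ab.
exists (fun p => H (p.1, p.2, i1 R)); split=> [|x|x|x t] /=.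
- by cts.
- by rewrite Hl /= T1.
- by rewrite Hr /= T1.
- by rewrite HG /= T1.
Qed.

End Deform.

(* With [N] inverse to [mu], the composites of [N] and [mu] act bijectively on
   classes of maps rel [A]; hence so does [mu]. *)
Lemma help (P Q : ptopologicalType) (mu : P -> Q) (u : A -> P) (U : B -> Q) :
  he mu -> pointed_map u -> pointed_map U -> (forall a, U (j a) = mu (u a)) ->
  exists a', [/\ pointed_map a', forall a, a' (j a) = u a & hrel (mu \o a') U].
Proof.
move=> [pmu [N [pN Nmu muN]]] pu pU Uj.
have [|a' [pa' aj h]] := hrel_surj Nmu pu (pmap_comp pN pU).
  by move=> a; rewrite /= Uj.
exists a'; split=> //; apply: (hrel_inj muN) => //; first exact: pmap_comp.
  by move=> a; rewrite /= aj Uj.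
by have := hrel_comp pmu.1 h.
Qed.

End Help.

End Hsq.

Arguments susp_map {R} k {X Y} f _ : simpl never.
Arguments hsq {R A B A' B'} f f' b K a _.
Arguments att {R B Y} s0 s _ : rename.
Arguments inc {R B Y} s0 s _ : rename.
Arguments restr {R X m r S} fb s _.
Arguments wt_quasi {R X m r S} w s _.
Arguments T_att {R X m r S} fb f v s _.
Arguments T_inc {R X m r S} fb s _.
Arguments T {R X m r S} fb f v.
Arguments T_quasi {R X m r S} fb w f v s _.
Arguments inc_to {C} j s p _.
Arguments quasi_of_str {R B Y S} a s _.

(** * Naturality of the collapse maps and of [psi] *)

Section Suspensions.
Variable R : realType.
Local Notation I := (I01 R).
Local Notation "f =h g" := (homotopic R f g) (at level 70).
Local Notation he := (homotopy_equivalence R).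

Lemma pmap_pinch (X Y : ptopologicalType) (f : X -> Y) : f point = point ->
  pointed_map (pinch f : mcone R f -> Susp R 1 X).
Proof.
move=> pf; split; last by rewrite [LHS](pinchl R f point).
apply: ctn_mcone; first by apply: (@ctn_eq _ _ _ (fun=> point)); [exact: pinchl|cts].
by apply: ctn_eq (@ctn_smk1 R X) => -[x t]; rewrite pinchr.
Qed.

Lemma pmap_qprime (X Y : ptopologicalType) (f : X -> Y) : f point = point ->
  pointed_map (qprime f : mcone R (mcl f) -> Susp R 1 X).
Proof.
move=> pf; have [cp pp] := pmap_pinch pf.
split; last by rewrite [LHS](qprimel (mcl f point : mcone R f)) pinchl.
apply: ctn_mcone; first by apply: ctn_eq cp; exact: qprimel.
by apply: (@ctn_eq _ _ _ (fun=> point)); [move=> [y t]; exact: qprimer|cts].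
Qed.

(** The collapse kills the part of the cone on which the homotopy runs, so the left side equals the
    right side followed by the slow map [th]. *)
Lemma qprime_hsq (A B A' B' : ptopologicalType) (f : A -> B) (f' : A' -> B')
    (b : B -> B') (K : A * I -> B') (a : A -> A') :
  f point = point -> f' point = point -> hsq_data f f' b K a ->
  qprime f' \o mcone_map (mcl f) (mcl f') (hsq f f' b K a) b =h
  susp_map 1 a \o qprime f.
Proof.
move=> pf pf' sq; have [pb pa _ _ _] := sq.
have ph := pmap_hsq pf' sq.
have pm : pointed_map (mcone_map (mcl f) (mcl f') (hsq f f' b K a) b :
    mcone R (mcl f) -> mcone R (mcl f')).
  by apply: pmap_mcone_map => // x; rewrite (hsq_l pf' sq).
have [th hth thE] := susp_slow R A'.
have pth : th point = point by case: (hpmapl hth).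
apply: (@htrans _ _ _ (th \o (susp_map 1 a \o qprime f))); last first.
  by apply: hidl hth _; apply: pmap_comp; [exact: pmap_susp|exact: pmap_qprime].
apply: heq; first by apply: pmap_comp pm; exact: pmap_qprime.
have hl x : (hsq f f' b K a \o mcl f) x = mcl f' (b x) by rewrite /= (hsq_l pf' sq).
move=> w; have [[v ->]|[y [t ->]]] := mconeP w; last first.
  by rewrite /= mcone_map_r // !qprimer // susp_map_pt ?pa.2 ?pth.
rewrite /= mcone_map_l // !qprimel //.
have [[y ->]|[x [t ->]]] := mconeP v.
  by rewrite (hsq_l pf' sq) !pinchl // susp_map_pt ?pa.2 ?pth.
rewrite (hsq_r pf' sq) pinchr // susp1_mapE ?pa.2 // thE /hsq_cone /=.
case: ifPn => t2; last by rewrite pinchr.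
by rewrite pinchl // clamp0 ?circle_pt0 ?smk_ptr //; lra.
Qed.

Section PinchXi.
Variables (X P Q : ptopologicalType) (h : Q -> P) (u : P -> X) (u' : Q -> X).
Hypotheses (ph : pointed_map h) (pu : pointed_map u).
Hypothesis u'E : forall q, u' q = u (h q).

(** The quotient map after the interchange of cone coordinates, as it occurs in [T_quasi]. It is
    treated as one map, whose continuity is checked piece by piece. *)
Definition pinch_xi : mcone R (mcone_map u' u idfun h) -> Susp R 1 (mcone R h) :=
  pinch (mcone_map h idfun u u') \o xi h u u'.

Let pu' : u' point = point. Proof. by rewrite u'E ph.2 pu.2. Qed.

Let pk : mcone_map h (idfun : X -> X) u u' (point : mcone R h) = point.
Proof.
have [_ ->] // : pointed_map (mcone_map h (idfun : X -> X) u u' : mcone R h -> mcone R idfun).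
apply: pmap_mcone_map => // [|q]; last by rewrite /= u'E.
split=> //; apply: (@ctn_eq _ _ _ (u \o h)) => //.
by case: pu => cu _; case: ph => ch _; exact: ctn_comp.
Qed.

Lemma pinch_xi_base x : pinch_xi (mcl _ (mcl u x)) = point.
Proof. by rewrite /pinch_xi /= xi_base ?ph.2 ?pu.2 // pinchl. Qed.

Lemma pinch_xi_inner p t :
  pinch_xi (mcl _ (mcr u (cmk p t))) = smk (mcl h p : mcone R h) (circle_pt t).
Proof. by rewrite /pinch_xi /= xi_inner ?ph.2 ?pu.2 // pinchr. Qed.

Lemma pinch_xi_outer x t : pinch_xi (mcr _ (cmk (mcl u' x : mcone R u') t)) = point.
Proof. by rewrite /pinch_xi /= xi_outer ?ph.2 ?pu.2 // pinchl. Qed.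

Lemma pinch_xi_swap q t t' : pinch_xi (mcr _ (cmk (mcr u' (cmk q t) : mcone R u') t')) =
  smk (mcr h (cmk q t') : mcone R h) (circle_pt t).
Proof. by rewrite /pinch_xi /= xi_swap ?ph.2 ?pu.2 // pinchr. Qed.

Lemma pmap_pinch_xi : pointed_map pinch_xi.
Proof.
have cs := @ctn_smk1 R (mcone R h); have cl := @ctn_mcl R _ _ h.
have cr := @ctn_mcr R _ _ h.
split; last by rewrite [LHS](pinch_xi_base point).
apply: ctn_mcone.
  apply: ctn_mcone.
    by apply: (@ctn_eq _ _ _ (fun=> point)); [exact: pinch_xi_base|cts].
  apply: (@ctn_eq _ _ _ (fun p : P * I => smk (mcl h p.1 : mcone R h) (circle_pt p.2))).
    by move=> [p t]; exact: pinch_xi_inner.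
  by apply: (@ctn_comp _ _ _ (fun p : P * I => (mcl h p.1 : mcone R h, p.2)) _ cs); cts.
apply: (@ctn_mconeI _ _ _ _ _ (fun p => pinch_xi (mcr _ (cmk p.1 p.2)))).
  by apply: (@ctn_eq _ _ _ (fun=> point)); [move=> [x t]; exact: pinch_xi_outer|cts].
apply: (@ctn_eq _ _ _ (fun p : Q * I * I =>
    smk (mcr h (cmk p.1.1 p.2) : mcone R h) (circle_pt p.1.2))).
  by move=> [[q t] t']; exact: pinch_xi_swap.
apply: (@ctn_comp _ _ _ (fun p : Q * I * I => (mcr h (cmk p.1.1 p.2) : mcone R h, p.1.2)) _ cs).
apply: ctn_pair; last by cts.
by apply: (@ctn_comp _ _ _ (fun p : Q * I * I => (p.1.1, p.2)) _ cr); cts.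
Qed.

End PinchXi.
Arguments pinch_xi {X P Q} h u u' _.

(** The cone coordinate slowed down by [hsq] becomes, after the interchange, the suspension
    coordinate. Hence one slow map on the suspension of [mcone h] corrects both the base and the
    cone part. *)
Lemma pinch_xi_hsq (X P Q P1 Q1 : ptopologicalType) (h : Q -> P) (h1 : Q1 -> P1)
    (u : P -> X) (u' : Q -> X) (u1 : P1 -> X) (u1' : Q1 -> X)
    (aP : P1 -> P) (aQ : Q1 -> Q) (K : P1 * I -> X) (K' : Q1 * I -> X) :
  pointed_map h -> pointed_map h1 -> pointed_map u -> pointed_map u1 ->
  (forall q, u' q = u (h q)) -> (forall q, u1' q = u1 (h1 q)) ->
  (forall q, aP (h1 q) = h (aQ q)) -> (forall q t, K' (q, t) = K (h1 q, t)) ->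
  hsq_data u1 u idfun K aP -> hsq_data u1' u' idfun K' aQ ->
  pinch_xi h u u' \o mcone_map (mcone_map u1' u1 idfun h1) (mcone_map u' u idfun h)
     (hsq u1 u idfun K aP) (hsq u1' u' idfun K' aQ) =h
  susp_map 1 (mcone_map h1 h aP aQ) \o pinch_xi h1 u1 u1'.
Proof.
move=> ph ph1 pu pu1 u'E u1'E aE KE sq sq'.
have [pX pP _ _ _] := sq; have [_ pQ _ _ _] := sq'.
have pu' : u' point = point by rewrite u'E ph.2 pu.2.
have pu1' : u1' point = point by rewrite u1'E ph1.2 pu1.2.
have qu := pu.2; have qu1 := pu1.2; have qh := ph.2; have qh1 := ph1.2.
have pE : pointed_map (mcone_map h1 h aP aQ : mcone R h1 -> mcone R h).
  exact: pmap_mcone_map.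
have pJ : pointed_map (mcone_map u' u idfun h : mcone R u' -> mcone R u).
  by apply: pmap_mcone_map => // q; rewrite u'E.
have hq := pmap_hsq qu sq; have hq' := pmap_hsq pu' sq'.
have uE q : (idfun (u' q)) = u (h q) by rewrite u'E.
have u1E q : (idfun (u1' q)) = u1 (h1 q) by rewrite u1'E.
(* A strict equality, because [K'] is the restriction of [K] along [h1]: here it matters that all
   levels share one deformation. *)
have com w : hsq u1 u idfun K aP (mcone_map u1' u1 idfun h1 w) =
    mcone_map u' u idfun h (hsq u1' u' idfun K' aQ w).
  have [[x ->]|[q [t ->]]] := mconeP w.
    by rewrite mcone_map_l // (hsq_l qu sq) (hsq_l pu' sq') mcone_map_l.
  rewrite mcone_map_r // (hsq_r qu sq) (hsq_r pu' sq') /hsq_cone /=.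
  by case: ifPn => _; rewrite ?mcone_map_l ?mcone_map_r // ?KE // aE.
have [th hth thE] := susp_slow R (mcone R h).
have pth : th point = point by case: (hpmapl hth).
have px := pmap_pinch_xi ph pu u'E; have px1 := pmap_pinch_xi ph1 pu1 u1'E.
apply: (@htrans _ _ _
  (th \o (susp_map 1 (mcone_map h1 h aP aQ) \o pinch_xi h1 u1 u1'))); last first.
  by apply: hidl hth _; apply: pmap_comp; [exact: pmap_susp|].
have qJ := pJ.2; have qE := pE.2.
apply: heq; first exact: (pmap_comp px (pmap_mcone_map R qJ hq hq' com)).
have sE : susp_map 1 (mcone_map h1 h aP aQ) point = point :> Susp R 1 (mcone R h).
  exact: susp_map_pt.
move=> w; have [[v ->]|[v [t' ->]]] := mconeP w; rewrite /= ?mcone_map_l ?mcone_map_r //.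
  have [[x ->]|[p [t ->]]] := mconeP v.
    by rewrite (hsq_l qu sq) !pinch_xi_base // sE pth.
  rewrite (hsq_r qu sq) pinch_xi_inner // susp1_mapE // thE mcone_map_l // /hsq_cone /=.
  case: ifPn => t2; last by rewrite pinch_xi_inner.
  by rewrite pinch_xi_base // clamp0 ?circle_pt0 ?smk_ptr //; lra.
have [[x ->]|[q [t ->]]] := mconeP v.
  by rewrite (hsq_l pu' sq') !pinch_xi_outer // sE pth.
rewrite (hsq_r pu' sq') pinch_xi_swap // susp1_mapE // thE mcone_map_r // /hsq_cone /=.
case: ifPn => t2; last by rewrite pinch_xi_swap.
by rewrite pinch_xi_outer // clamp0 ?circle_pt0 ?smk_ptr //; lra.
Qed.

Lemma psi_natural l (A B A' B' : ptopologicalType) (j : A -> B) (j' : A' -> B')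
    (b : B' -> B) (a : A' -> A) :
  pointed_map j -> pointed_map j' -> pointed_map b -> pointed_map a ->
  (forall x, b (j' x) = j (a x)) ->
  susp_map l (mcone_map j' j b a) \o @psi R l _ _ j' =
  psi l j \o mcone_map (susp_map l j') (susp_map l j) (susp_map l b) (susp_map l a).
Proof.
move=> pj pj' pb pa e; apply/funext => w.
have qj := pj.2; have qb := pb.2; have qa := pa.2; have qj' := pj'.2.
have pm : mcone_map j' j b a (point : mcone R j') = point.
  by have [] := @pmap_mcone_map R _ _ _ _ j' j b a qj pb pa e.
have psj : susp_map l j (point : Susp R l A) = point by rewrite susp_map_pt.
have se x : susp_map (R := R) l b (susp_map l j' x) = susp_map l j (susp_map l a x).
  have := @susp_map_comp R l _ _ _ j' b qj' qb.
  rewrite (_ : b \o j' = j \o a); last exact/funext.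
  by rewrite susp_map_comp // => /(congr1 (@^~ x)).
have psb := @pmap_susp R l _ _ b pb; have psa := @pmap_susp R l _ _ a pa.
have [[y ->]|[x [t ->]]] := mconeP w.
  have [z [s ->]] := swedge_surj y.
  by rewrite /= mcone_map_l // susp_mapE // !psil // susp_mapE // mcone_map_l.
have [z [s ->]] := swedge_surj x.
by rewrite /= mcone_map_r // susp_mapE // !psir // susp_mapE // mcone_map_r.
Qed.

End Suspensions.

(** * Morphisms of systems *)

Section Morphism.
Variables (R : realType) (B : ptopologicalType) (Y : nat -> ptopologicalType).
Local Notation I := (I01 R).
Local Notation "f =h g" := (homotopic R f g) (at level 70).
Local Notation he := (homotopy_equivalence R).
Implicit Types S : system R B Y.

(** The last clause is only a homotopy, since the two attaching maps contain different, homotopic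
    maps [f] and independently chosen homotopy inverses. *)
Definition morph (k : nat) S' S (e : forall s, spc S' s -> spc S s) : Prop :=
  [/\ e 0%N = idfun, forall s, (s <= k)%N -> he (e s),
      forall s, (s < k)%N -> forall x, e s.+1 (inc S' s x) = inc S s (e s x)
    & forall s, (s < k)%N -> e s \o att S' s =h att S s].

Definition cone_morph S' S (e : forall s, spc S' s -> spc S s) s :
    mcone R (inc S' s) -> mcone R (inc S s) :=
  mcone_map (inc S' s) (inc S s) (e s.+1) (e s).

Arguments cone_morph {S' S} e s _.

(* The part of [quasi_imc] that is not invariant under homotopy equivalence. *)
Definition pre_imc (k : nat) S : Prop :=
  (forall s, (s <= k)%N -> well_pointed R (spc S s)) /\
  forall s, (s < k)%N -> [/\ pointed_map (att S s), pointed_map (inc S s)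
    & free_cofibration R (inc S s)].

Lemma quasi_imc_pre k S : quasi_imc k S -> pre_imc k S.
Proof. by move=> [w h]; split=> // s /h[]. Qed.

(** A test map on [C'] is moved to [C] by [c']; extensions over [D] are brought back by [d], and
    those over [D'] are carried to [D] by [d']. *)
Lemma coexact_equiv (Z C C' D D' : ptopologicalType) (g : Z -> C) (j : C -> D)
    (g' : Z -> C') (j' : C' -> D') (c : C' -> C) (d : D' -> D) :
  pointed_map j -> pointed_map j' -> he c -> he d ->
  (forall x, d (j' x) = j (c x)) -> c \o g' =h g -> pointed_map g' ->
  coexact R g j -> coexact R g' j'.
Proof.
move=> pj pj' [pc [c' [pc' c'c cc']]] [pd [d' [pd' d'd dd']]] e cg pg' ex W wW u pu.
have pg := hpmapr cg.
have dj : d \o j' = j \o c by exact/funext.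
have ug : u \o g' =h (u \o c') \o g.
  apply: (@htrans _ _ _ (u \o ((c' \o c) \o g'))).
    by apply: hcompl => //; exact/hsym/hidl.
  have := hcompl pu (hcompl pc' cg); exact.
have [ex1 ex2] := ex W wW (u \o c') (pmap_comp pu pc').
split=> [null|[v [pv vj]]].
  have [v [pv vj]] := ex1 (htrans (hsym ug) null).
  exists (v \o d); split; first exact: pmap_comp.
  have -> : (v \o d) \o j' = (v \o j) \o c by rewrite -compA dj compA.
  apply: htrans (hcompr pc vj) _; rewrite -compA.
  exact: (hidr c'c pu).
apply: htrans ug _; apply: ex2; exists (v \o d'); split; first exact: pmap_comp.
apply: (@htrans _ _ _ (v \o d' \o (j \o (c \o c')))).
  apply: hcompl; [exact: pmap_comp|apply: hsym; exact: hidr].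
rewrite (_ : _ \o _ = v \o ((d' \o d) \o (j' \o c'))); last first.
  by apply/funext => x /=; rewrite e.
apply: (@htrans _ _ _ (v \o (j' \o c'))).
  by apply: hcompl => //; apply: hidl => //; exact: pmap_comp.
by rewrite compA; exact: hcompr.
Qed.

Section Transfer.
Variables (k : nat) (S' S : system R B Y) (e : forall s, spc S' s -> spc S s).
Arguments e : clear implicits.
Hypotheses (me : morph k e) (pS' : pre_imc k S') (qS : quasi_imc k S).

Lemma he_cone_morph s : (s < k)%N -> he (cone_morph e s).
Proof.
move=> sk; have [_ he_e ej _] := me; have [_ /(_ s sk)[_ pj' _]] := pS'.
have [_ /(_ s sk)[_ pj _ _ _]] := qS.
exact: (he_mcone_map pj' pj (he_e s.+1 sk) (he_e s (ltnW sk)) (ej s sk)).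
Qed.

Lemma morph_quasi_imc : quasi_imc k S'.
Proof.
have [_ he_e ej eg] := me; have [wS' hS'] := pS'; have [_ hS] := qS.
split=> // s sk; have [pg' pj' cj'] := hS' s sk.
have [pg pj _ ex [w hw]] := hS s sk; split=> //.
  by apply: coexact_equiv pj pj' (he_e s (ltnW sk)) (he_e s.+1 sk) (ej s sk) (eg s sk) pg' ex.
by exists (w \o cone_morph e s); apply: he_comp => //; exact: he_cone_morph.
Qed.

(* [a'] lifts [a \o e] through the equivalence of mapping cones induced by [e]. *)
Lemma structure_lift s (a : spc S s.+1 -> mcone R (att S s)) : (s < k)%N ->
  homotopy_cofibre_equiv a ->
  exists2 a' : spc S' s.+1 -> mcone R (att S' s), homotopy_cofibre_equiv a' &
    qprime (att S' s) \o mcone_map (inc S' s) (mcl (att S' s)) a' idfun =h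
    (qprime (att S s) \o mcone_map (inc S s) (mcl (att S s)) a idfun) \o
      cone_morph e s.
Proof.
move=> sk [ha aj].
have [_ he_e ej eg] := me; have [_ /(_ s sk)[pg' pj' cj']] := pS'.
have [_ /(_ s sk)[pg pj _ _ _]] := qS.
have he0 := he_e s (ltnW sk); have he1 := he_e s.+1 sk.
have [K [cK K0 K1 Kp]] := eg s sk.
have sq : hsq_data (att S' s) (att S s) (e s) K idfun.
  by split=> //; [exact: (he_pmap he0)|exact: pmap_id].
pose mu := hsq (att S' s) (att S s) (e s) K idfun.
have hmu : he mu := he_hsq pg' pg sq he0 (@he_id R _).
have pa := he_pmap ha; have pe0 := he_pmap he0; have pe1 := he_pmap he1.
have qg := pg.2; have qg' := pg'.2.
have muE x : mu (mcl (att S' s) x) = mcl (att S s) (e s x) by rewrite /mu (hsq_l qg sq).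
have ajE x : a (inc S s x) = mcl (att S s) x by rewrite -aj.
have pi' : pointed_map (mcl (att S' s) : spc S' s -> mcone R (att S' s)).
  exact: pmap_mcl.
(* [mcl] is prescribed on the image of the inclusion of [S'], and only [a \o e] is reached up to
   homotopy; thus [a'] extends [mcl] exactly. *)
have [|a' [pa' a'j rel]] := help cj' pj'.2 hmu pi' (pmap_comp pa pe1).
  by move=> x; rewrite /= ej // ajE muE.
have rh := hrel_homotopic pj'.2 _ rel.
have pmu : pointed_map mu := pmap_hsq qg sq.
have {}rh : mu \o a' =h a \o e s.+1 by apply: rh; rewrite /= pa'.2 pmu.2.
exists a'.
  split; last by apply/funext => x /=; rewrite a'j.
  by apply: (he_cancell pa' hmu); apply: he_homotopic (hsym rh) _; exact: he_comp.
have [D [cD D0 D1 Dj]] := rel.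
have pid := pmap_id (spc S' s); have pidC := pmap_id (spc S s).
have pm : pointed_map (mcone_map (mcl (att S' s)) (mcl (att S s)) mu (e s) :
    mcone R (mcl (att S' s)) -> mcone R (mcl (att S s))).
  by apply: pmap_mcone_map => // x; rewrite muE.
have pma' : pointed_map (mcone_map (inc S' s) (mcl (att S' s)) a' idfun :
    mcone R (inc S' s) -> mcone R (mcl (att S' s))).
  exact: pmap_mcone_map.
have pma : pointed_map (mcone_map (inc S s) (mcl (att S s)) a idfun :
    mcone R (inc S s) -> mcone R (mcl (att S s))).
  exact: pmap_mcone_map.
have qh := qprime_hsq qg' qg sq.
have pq := pmap_qprime R qg'.
apply: (@htrans _ _ _ (qprime (att S s) \o
    (mcone_map (mcl (att S' s)) (mcl (att S s)) mu (e s) \o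
     mcone_map (inc S' s) (mcl (att S' s)) a' idfun))).
  apply: (@htrans _ _ _ (susp_map 1 idfun \o qprime (att S' s) \o
     mcone_map (inc S' s) (mcl (att S' s)) a' idfun)).
    by rewrite susp_map_id; apply: heq => //; exact: pmap_comp.
  by apply: htrans (hcompr pma' (hsym qh)) _; rewrite -compA; apply: hrefl;
    apply: pmap_comp; [exact: pmap_qprime|exact: pmap_comp].
rewrite -compA; apply: hcompl; first exact: pmap_qprime.
have cl := @ctn_mcl R _ _ (mcl (att S s) : spc S s -> mcone R (att S s)).
have cr := @ctn_mcr R _ _ (mcl (att S s) : spc S s -> mcone R (att S s)).
have ce0 : ctn (e s) by case: pe0.
have qj' := pj'.2; have qj := pj.2.
have ejE := ej s sk.
(* [D] is constant on the image of [inc S' s], so the cone part of the homotopy can stay fixed. This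
   is why a homotopy rel the image is asked for. *)
apply: (@mcone_homotopic R _ _ (inc S' s) _ _ _
   (fun p => mcl (mcl (att S s)) (D p))
   (fun p => mcr (mcl (att S s)) (cmk (e s p.1.1) p.1.2))).
- by cts.
- by apply: (@ctn_comp _ _ _ (fun p : spc S' s * I * I => (e s p.1.1, p.1.2)) _ cr); cts.
- by move=> t; rewrite -qj' Dj /= a'j pi'.2 pmu.2.
- by move=> t t'; rewrite /= pe0.2 /cmk smk_ptl mcr_pt.
- by move=> x t; rewrite /= /cmk smk_ptr mcr_pt.
- by move=> x t; rewrite /= mcone_glue Dj /= a'j muE.
- by move=> y; rewrite /= D0 !mcone_map_l.
- by move=> y; rewrite /= D1 /cone_morph !mcone_map_l.
- by move=> x t; rewrite /= !mcone_map_r.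
- by move=> x t; rewrite /= /cone_morph !mcone_map_r.
Qed.

Lemma morph_imc : imc k S -> imc k S'.
Proof.
move=> [_ aS]; split; first exact: morph_quasi_imc.
by move=> s sk; have [a /(structure_lift sk)[a' ha' _]] := aS s sk; exists a'.
Qed.

End Transfer.
End Morphism.

Arguments cone_morph {R B Y S' S} e s _.
Arguments pinch_xi {R X P Q} h u u' _.

(** * Composite inclusions and the transfer of extensions *)

Section Towers.
Variable R : realType.
Local Notation I := (I01 R).
Local Notation "f =h g" := (homotopic R f g) (at level 70).
Local Notation he := (homotopy_equivalence R).

(** [inc_toS] splits off the last inclusion; comparing the restrictions of an extension at
    successive levels requires splitting off the first. *)
Lemma inc_to_l (C : nat -> ptopologicalType) (j : forall s, C s -> C s.+1) s p :
  (s < p)%N -> inc_to j s p = inc_to j s.+1 p \o j s.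
Proof.
elim: p => // p IH; rewrite ltnS leq_eqVlt => /orP[/eqP ->|sp].
  by rewrite inc_toS // !inc_to_id.
by rewrite inc_toS ?(ltnW sp) // IH // inc_toS // compA.
Qed.

Lemma cof_id (A : topologicalType) : free_cofibration R (@idfun A).
Proof. by split=> [|W h G ch cG hG]; [exact: ctn_id|exists G]. Qed.

Section IncTo.
Variables (B : ptopologicalType) (Y : nat -> ptopologicalType) (k : nat).
Implicit Types S : system R B Y.

Lemma pmap_inc_to S s p : pre_imc k S -> (s <= p)%N -> (p <= k)%N ->
  pointed_map (inc_to (inc S) s p).
Proof.
move=> [_ hS]; elim: p => [|p IH]; first by
  rewrite leqn0 => /eqP ->; rewrite inc_to_id => _; exact: pmap_id.
rewrite leq_eqVlt => /orP[/eqP ->|sp pk]; first by rewrite inc_to_id => _; exact: pmap_id.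
rewrite inc_toS //; have [_ pj _] := hS p pk.
by apply: pmap_comp => //; apply: IH => //; exact: ltnW.
Qed.

Lemma cof_inc_to S s p : pre_imc k S -> (s <= p)%N -> (p <= k)%N ->
  free_cofibration R (inc_to (inc S) s p).
Proof.
move=> [_ hS]; elim: p => [|p IH]; first by
  rewrite leqn0 => /eqP ->; rewrite inc_to_id => _; exact: cof_id.
rewrite leq_eqVlt => /orP[/eqP ->|sp pk]; first by rewrite inc_to_id => _; exact: cof_id.
rewrite inc_toS //; have [_ _ cj] := hS p pk.
by apply: cof_comp => //; apply: IH => //; exact: ltnW.
Qed.

Section Morph.
Variables (S' S : system R B Y) (e : forall s, spc S' s -> spc S s).
Arguments e : clear implicits.
Hypotheses (me : morph k e) (pS' : pre_imc k S') (pS : pre_imc k S).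

Lemma morph_inc_to s p x : (s <= p)%N -> (p <= k)%N ->
  e p (inc_to (inc S') s p x) = inc_to (inc S) s p (e s x).
Proof.
have [_ _ ej _] := me.
elim: p => [|p IH].
  by rewrite leqn0 => /eqP s0 _; move: x; rewrite s0 => x; rewrite !inc_to_id.
rewrite leq_eqVlt => /orP[/eqP sp _|sp pk].
  by move: x IH; rewrite sp => x _; rewrite !inc_to_id.
by rewrite !inc_toS //= ej // IH // ltnW.
Qed.

(** As [e] is the identity at level 0, [fb \o susp_map l (e p)] restricts to [f] exactly, so the
    homotopy from [f] to [f'] extends from there. *)
Lemma extension_transfer p l (Z : ptopologicalType) (fb : Susp R l (spc S p) -> Z)
    (f f' : Susp R l B -> Z) :
  (p <= k)%N -> pointed_map fb -> fb \o susp_map l (inc_to (inc S) 0 p) = f ->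
  f =h f' ->
  exists (fb' : Susp R l (spc S' p) -> Z) (K : Susp R l (spc S' p) * I -> Z),
    [/\ pointed_map fb', fb' \o susp_map l (inc_to (inc S') 0 p) = f',
        ctn K /\ forall t, K (point, t) = point,
        forall y, K (y, i0 R) = fb' y
      & forall y, K (y, i1 R) = fb (susp_map l (e p) y)].
Proof.
move=> pk pfb fbE [G [cG G0 G1 Gp]]; have {}cG : ctn G := cG.
have [e0 he_e _ _] := me; have pe := he_pmap (he_e p pk).
have pi := pmap_inc_to pS (leq0n p) pk; have pi' := pmap_inc_to pS' (leq0n p) pk.
have ci' := cof_inc_to pS' (leq0n p) pk.
have ps := @pmap_susp R l _ _ _ pe; have psi := @pmap_susp R l _ _ _ pi'.
have cs := cof_susp l ci' pi'.2.
have [cfs pfs] := pmap_comp pfb ps.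
have eE : e p \o inc_to (inc S') 0 p = inc_to (inc S) 0 p.
  apply/funext => x; rewrite /= morph_inc_to //.
  by rewrite (_ : e 0%N x = x) // e0.
have GE x : G (x, i0 R) = (fb \o susp_map l (e p)) (susp_map l (inc_to (inc S') 0 p) x).
  rewrite G0 -fbE -eE susp_map_comp //; [exact: pi'.2|exact: pe.2].
have [H [cH H0 HG Hp]] := pointed_hep cs psi.2 cfs cG Gp GE.
(* The homotopy is reversed, so that it runs from [fb'] to the pulled back [fb], as a square over
   the identity of the target demands. *)
exists (fun y => H (y, i1 R)), (fun q => H (q.1, clamp (1 - ival q.2))); split.
- by split; [have : ctn (fun y => H (y, i1 R)) by cts|exact: Hp].
- by apply/funext => x /=; rewrite HG G1.
- by split=> [|t]; [cts|exact: Hp].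
- by move=> y /=; rewrite clamp1 // ival0; lra.
- by move=> y /=; rewrite clamp0 ?H0 // ival1; lra.
Qed.

End Morph.
End IncTo.
End Towers.

(** * Applying [T] to a morphism of systems *)

Section TStep.
Variables (R : realType) (X : nat -> ptopologicalType) (m : nat -> nat) (r : nat).
Local Notation I := (I01 R).
Local Notation "f =h g" := (homotopic R f g) (at level 70).
Local Notation he := (homotopy_equivalence R).

Section One.
Variables (S : sys R X m r) (fb : ext_data S).
Hypotheses (pS : pre_imc r.-1 S) (pfb : pointed_map fb).

Lemma pmap_restr s : (s <= r.-1)%N -> pointed_map (restr fb s).
Proof.
by move=> sr; apply: pmap_comp => //; apply: pmap_susp; exact: pmap_inc_to pS sr (leqnn _).
Qed.

Lemma restrE s z : (s < r.-1)%N -> restr fb s z = restr fb s.+1 (susp_map (m r) (inc S s) z).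
Proof.
move=> sr; have [_ /(_ s sr)[_ pj _]] := pS.
have pi := pmap_inc_to pS sr (leqnn _).
by rewrite /restr /= inc_to_l // susp_map_comp //; [exact: pj.2|exact: pi.2].
Qed.

Lemma pmap_T_inc f v s : (s < r)%N -> pointed_map (inc (T fb f v) s).
Proof.
case: s => [|s] sr /=; first exact: pmap_mcl.
have sr' : (s < r.-1)%N by case: (r) sr.
have [_ /(_ s sr')[_ pj _]] := pS.
have [_ p1] := pmap_restr sr'.
apply: pmap_mcone_map => //; [exact: pmap_id|exact: pmap_susp|].
by move=> a; rewrite -restrE.
Qed.

Lemma pre_imc_T f v : pointed_map f -> well_pointed R (X r.+1) ->
  (forall s, (s < r.-1)%N -> pointed_map (v s)) -> pre_imc r (T fb f v).
Proof.
move=> pf wX pv; split=> [[|s] sr /=|s sr] //.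
  have sr' : (s <= r.-1)%N by case: (r) sr.
  have [wS _] := pS; apply: well_pointed_mcone => //; first exact: pmap_restr.
  by apply: well_pointed_susp; exact: wS.
split; [|exact: pmap_T_inc|].
  case: s sr => [|s] sr //=.
  have sr' : (s < r.-1)%N by case: (r) sr.
  have [_ /(_ s sr')[_ pj _]] := pS.
  apply: pmap_comp; last exact: pv.
  have [_ p0] := pmap_restr (ltnW sr').
  apply: pmap_mcone_map; [exact: p0|exact: (pmap_restr sr')|exact: pmap_id|].
  by move=> a; rewrite -restrE.
case: s sr => [|s] sr /=.
  have [wS _] := pS; apply: cof_mcl; first exact: pmap_restr.
  by apply: well_pointed_susp; exact: (wS 0%N).
have sr' : (s < r.-1)%N by case: (r) sr.
have [_ /(_ s sr')[_ pj cj]] := pS.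
apply: cof_mcone_map.
- by apply: cof_susp => //; exact: pj.2.
- by rewrite susp_map_pt //; exact: pj.2.
- exact: pmap_restr.
- by move=> a; rewrite -restrE.
Qed.

Lemma pmap_wt_quasi (w : quasi_data S) s : (s < r.-1)%N -> pointed_map (w s) ->
  pointed_map (wt_quasi w s).
Proof.
move=> sr pw; have [_ /(_ s sr)[_ pj _]] := pS.
apply: pmap_comp; last exact: pmap_psi.
apply: pmap_comp; [exact: pmap_susp_swap|exact: pmap_susp].
Qed.

End One.

Section Two.
Variables (S' S : sys R X m r) (e : forall s, spc S' s -> spc S s).
Arguments e : clear implicits.
Variables (fb' : ext_data S') (fb : ext_data S) (K : Susp R (m r) (spc S' r.-1) * I -> X r.+1).
Hypotheses (me : morph r.-1 e) (pS' : pre_imc r.-1 S') (pS : pre_imc r.-1 S).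
Hypotheses (pfb' : pointed_map fb') (pfb : pointed_map fb).
Hypotheses (cK : ctn K) (Kp : forall t, K (point, t) = point).
Hypotheses (K0 : forall y, K (y, i0 R) = fb' y).
Hypotheses (K1 : forall y, K (y, i1 R) = fb (susp_map (m r) (e r.-1) y)).

Definition restr_homotopy s (p : Susp R (m r) (spc S' s) * I) : X r.+1 :=
  K (susp_map (m r) (inc_to (inc S') s r.-1) p.1, p.2).

Definition T_morph s : T_spc fb' s -> T_spc fb s :=
  match s return T_spc fb' s -> T_spc fb s with
  | 0 => idfun
  | s'.+1 => hsq (restr fb' s') (restr fb s') idfun (@restr_homotopy s') (susp_map (m r) (e s'))
  end.

Lemma restr_hsq s : (s <= r.-1)%N ->
  hsq_data (restr fb' s) (restr fb s) idfun (@restr_homotopy s) (susp_map (m r) (e s)).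
Proof.
move=> sr; have [_ he_e _ _] := me; have pe := he_pmap (he_e s sr).
have pe1 := he_pmap (he_e r.-1 (leqnn _)).
have pi' := pmap_inc_to pS' sr (leqnn _); have pi := pmap_inc_to pS sr (leqnn _).
have [cs ps] := @pmap_susp R (m r) _ _ _ pi'; have {}cs : ctn _ := cs.
split=> [||| |x]; [exact: pmap_id|exact: pmap_susp| | |].
- by split=> [|t]; rewrite /restr_homotopy; [cts|rewrite ps Kp].
- by move=> x; rewrite /restr_homotopy K0.
rewrite /restr_homotopy K1 /restr /=; congr fb.
have := susp_map_comp R (m r) pi'.2 pe1.2 => /(congr1 (@^~ x)) /= <-.
have := susp_map_comp R (m r) pe.2 pi.2 => /(congr1 (@^~ x)) /= <-.
by congr susp_map; apply/funext => y /=; exact: (morph_inc_to me).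
Qed.

Lemma restr_homotopyE s z t : (s < r.-1)%N ->
  restr_homotopy (z, t) = restr_homotopy (susp_map (m r) (inc S' s) z, t).
Proof.
move=> sr; have [_ /(_ s sr)[_ pj _]] := pS'.
have pi := pmap_inc_to pS' sr (leqnn _).
by rewrite /restr_homotopy /= inc_to_l // susp_map_comp //; [exact: pj.2|exact: pi.2].
Qed.

Lemma he_T_morph s : (s <= r)%N -> he (@T_morph s).
Proof.
case: s => [_|s sr]; first exact: he_id.
have sr' : (s <= r.-1)%N by case: (r) sr.
have [_ he_e _ _] := me.
apply: he_hsq; [exact: pmap_restr|exact: pmap_restr|exact: restr_hsq|exact: he_id|].
by apply: he_susp; exact: he_e.
Qed.

Lemma susp_e_inc s z : (s < r.-1)%N ->
  susp_map (R := R) (m r) (e s.+1) (susp_map (m r) (inc S' s) z) =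
  susp_map (m r) (inc S s) (susp_map (m r) (e s) z).
Proof.
move=> sr; have [_ he_e ej _] := me.
have pe := he_pmap (he_e s (ltnW sr)); have pe1 := he_pmap (he_e s.+1 sr).
have [_ /(_ s sr)[_ pj' _]] := pS'; have [_ /(_ s sr)[_ pj _]] := pS.
have := susp_map_comp R (m r) pj'.2 pe1.2 => /(congr1 (@^~ z)) /= <-.
have := susp_map_comp R (m r) pe.2 pj.2 => /(congr1 (@^~ z)) /= <-.
by congr susp_map; apply/funext => y /=; exact: ej.
Qed.

(** Strictness comes from the fact that every [restr_homotopy] is a restriction of the single [K],
    together with the strictness of [e]. *)
Lemma T_morph_inc f' f v' v s x : (s < r)%N ->
  T_morph (inc (T fb' f' v') s x) = inc (T fb f v) s (T_morph x).
Proof.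
case: s x => [|s] x sr.
  have sq := restr_hsq (leq0n _); have p0 := (pmap_restr pS pfb (leq0n _)).2.
  by rewrite /= (hsq_l p0 sq).
have sr' : (s < r.-1)%N by case: (r) sr.
have sq := restr_hsq (ltnW sr'); have sq1 := restr_hsq sr'.
have p0 := (pmap_restr pS pfb (ltnW sr')).2; have p1 := (pmap_restr pS pfb sr').2.
have p0' := (pmap_restr pS' pfb' (ltnW sr')).2; have p1' := (pmap_restr pS' pfb' sr').2.
have [_ /(_ s sr')[_ pj' _]] := pS'; have [_ /(_ s sr')[_ pj _]] := pS.
have pX := pmap_id (X r.+1).
have psj' := @pmap_susp R (m r) _ _ _ pj'; have psj := @pmap_susp R (m r) _ _ _ pj.
have com' a : idfun (restr fb' s a) = restr fb' s.+1 (susp_map (m r) (inc S' s) a).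
  by rewrite /= restrE.
have com a : idfun (restr fb s a) = restr fb s.+1 (susp_map (m r) (inc S s) a).
  by rewrite /= restrE.
rewrite /T_morph; have [[y ->]|[z [t ->]]] := mconeP x.
  by rewrite /= mcone_map_l // (hsq_l p1 sq1) (hsq_l p0 sq) mcone_map_l.
rewrite /= mcone_map_r // (hsq_r p1 sq1) (hsq_r p0 sq) /hsq_cone /=.
case: ifPn => _; first by rewrite mcone_map_l // -restr_homotopyE.
by rewrite mcone_map_r // susp_e_inc.
Qed.

Definition susp_cone_morph s : mcone R (susp_map (R := R) (m r) (inc S' s)) ->
    mcone R (susp_map (R := R) (m r) (inc S s)) :=
  mcone_map (susp_map (m r) (inc S' s)) (susp_map (m r) (inc S s))
    (susp_map (m r) (e s.+1)) (susp_map (m r) (e s)).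

Lemma he_susp_cone_morph s : (s < r.-1)%N -> he (@susp_cone_morph s).
Proof.
move=> sr; have [_ he_e _ _] := me.
have [_ /(_ s sr)[_ pj' _]] := pS'; have [_ /(_ s sr)[_ pj _]] := pS.
apply: he_mcone_map; do ?exact: pmap_susp.
- by apply: he_susp; exact: (he_e s.+1 sr).
- by apply: he_susp; exact: (he_e s (ltnW sr)).
- by move=> x; exact: susp_e_inc.
Qed.

Variables (w' : quasi_data S') (w : quasi_data S).
Arguments w' : clear implicits.
Arguments w : clear implicits.
Hypothesis pw : forall s, (s < r.-1)%N -> pointed_map (w s).
Hypothesis ww : forall s, (s < r.-1)%N -> w' s =h w s \o cone_morph e s.

Lemma wt_quasi_morph s : (s < r.-1)%N ->
  wt_quasi w' s =h wt_quasi w s \o @susp_cone_morph s.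
Proof.
move=> sr; have [_ he_e ej _] := me.
have pe := he_pmap (he_e s (ltnW sr)); have pe1 := he_pmap (he_e s.+1 sr).
have [_ /(_ s sr)[_ pj' _]] := pS'; have [_ /(_ s sr)[_ pj _]] := pS.
have pws := pw sr.
have pc : pointed_map (cone_morph e s).
  by apply: pmap_mcone_map => //; [exact: pj.2|exact: ej].
have -> : wt_quasi w s \o @susp_cone_morph s =
    susp_swap s.+1 (m r) (msusp R X m r s.+1) \o
    susp_map (m r) (w s \o cone_morph e s) \o psi (m r) (inc S' s).
  rewrite (susp_map_comp R (m r) pc.2 pws.2); apply/funext => x.
  have := congr1 (@^~ x) (psi_natural R (m r) pj pj' pe1 pe (ej s sr)).
  by rewrite /wt_quasi /= => ->.
apply: hcompr; first exact: pmap_psi.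
by apply: hcompl; [exact: pmap_susp_swap|apply: susp_homotopic; exact: ww].
Qed.

(** Any inverses of the new equivalences will do: homotopy inverses are unique up to homotopy, which
    makes them compatible with [v]. *)
Lemma inverses_morph (v : inv_data S) : inverses w v ->
  exists v' : inv_data S', inverses w' v' /\
    forall s, (s < r.-1)%N -> @susp_cone_morph s \o v' s =h v s.
Proof.
move=> hv.
have hv' s : exists v's : Susp R s.+1 (msusp R X m r.+1 s.+2) ->
    mcone R (susp_map (R := R) (m r) (inc S' s)), (s < r.-1)%N ->
    homotopy_inverse R (wt_quasi w' s) v's /\ @susp_cone_morph s \o v's =h v s.
  (* From level [r.-1] on, the constant map is the default value of the total family. *)
  case: (ltnP s r.-1) => sr; last by exists (fun=> point).
  have [pv vw wv] := hv s sr.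
  have pwt := pmap_wt_quasi pS sr (pw sr).
  have hE := he_susp_cone_morph sr; have pE := he_pmap hE.
  have ww' := wt_quasi_morph sr.
  have hwt : he (wt_quasi w s) by split=> //; exists (v s); split.
  have [pwt' [v's [pv' v'w' w'v']]] : he (wt_quasi w' s).
    by apply: he_homotopic (hsym ww') _; exact: he_comp.
  exists v's => _; split=> //.
  apply: (@htrans _ _ _ (v s \o wt_quasi w s \o (@susp_cone_morph s \o v's))).
    by apply: hsym; apply: hidl => //; exact: pmap_comp.
  rewrite -compA (compA (wt_quasi w s)).
  apply: (@htrans _ _ _ (v s \o (wt_quasi w' s \o v's))).
    by apply: hcompl => //; apply: hcompr => //; exact: hsym.
  exact: hidr.
exists (fun s => projT1 (cid (hv' s))).
by split=> s sr; have [] := projT2 (cid (hv' s)) sr.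
Qed.

Section Att.
Variables (f' f : Susp R (m r) (X r) -> X r.+1) (v' : inv_data S') (v : inv_data S).
Arguments v' : clear implicits.
Arguments v : clear implicits.
Hypotheses (ff' : f' =h f).
Hypotheses (pv' : forall s, (s < r.-1)%N -> pointed_map (v' s)).
Hypotheses (pv : forall s, (s < r.-1)%N -> pointed_map (v s)).

Lemma T_morph_morph :
  (forall s, (s < r.-1)%N -> @susp_cone_morph s \o v' s =h v s) ->
  morph (S' := T fb' f' v') (S := T fb f v) r T_morph.
Proof.
move=> ev; split=> //.
- exact: he_T_morph.
- by move=> s sr x; exact: T_morph_inc.
case=> [|s] sr; first exact: ff'.
have sr' : (s < r.-1)%N by case: (r) sr.
have [_ he_e _ _] := me.
have pe := he_pmap (he_e s (ltnW sr')); have pe1 := he_pmap (he_e s.+1 sr').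
have [_ /(_ s sr')[_ pj' _]] := pS'; have [_ /(_ s sr')[_ pj _]] := pS.
have [cs ps] := @pmap_susp R (m r) _ _ _ (pmap_inc_to pS' sr' (leqnn _)).
have {}cs : ctn _ := cs.
have psj' := @pmap_susp R (m r) _ _ _ pj'; have psj := @pmap_susp R (m r) _ _ _ pj.
have pse := @pmap_susp R (m r) _ _ _ pe; have pse1 := @pmap_susp R (m r) _ _ _ pe1.
have [sqb _ [cK1 Kp1] K01 K11] := restr_hsq sr'.
have [_ h] := hsq_mcone_map psj psj' pse1 pse (pmap_restr pS pfb sr')
  (fun x => susp_e_inc x sr') (fun x => restrE fb pS x sr') (fun x => restrE fb' pS' x sr')
  cK1 Kp1 K01 K11.
have KE : (fun p => restr_homotopy (susp_map (m r) (inc S' s) p.1, p.2)) = @restr_homotopy s.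
  by apply/funext => -[z t]; rewrite [RHS]restr_homotopyE.
rewrite KE in h.
have p0 := (pmap_restr pS pfb (ltnW sr')).2.
have pX := pmap_id (X r.+1); have pid := pmap_id (Susp R (m r) (spc S s)).
have pA : pointed_map (mcone_map (susp_map (m r) (inc S s)) (restr fb s)
    (restr fb s.+1) idfun : mcone R (susp_map (R := R) (m r) (inc S s)) -> mcone R (restr fb s)).
  apply: pmap_mcone_map; [exact: p0|exact: (pmap_restr pS pfb sr')|exact: pid|].
  by move=> a; rewrite -restrE.
(* First the cone maps are exchanged, then [ev] exchanges the homotopy inverses. *)
apply: (htrans (hcompr (pv' sr') h)).
exact: (hcompl pA (ev s sr')).
Qed.

(** Since [e 0] is the identity, so is the suspended map that appears in [qprime_hsq]. *)
Lemma T_quasi_morph0 : qprime (restr fb' 0) =h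
  qprime (restr fb 0) \o cone_morph (S' := T fb' f' v') (S := T fb f v) T_morph 0.
Proof.
have [e0 _ _ _] := me.
have := qprime_hsq (pmap_restr pS' pfb' (leq0n _)).2 (pmap_restr pS pfb (leq0n _)).2
  (restr_hsq (leq0n _)).
have e1 : susp_map (R := R) (m r) (e 0%N) = @idfun (Susp R (m r) (X r)).
  by rewrite e0; exact: susp_map_id.
have e2 := susp_map_id R 1 (Susp R (m r) (X r)); rewrite -e1 in e2.
by rewrite e2 => /hsym.
Qed.

Lemma T_quasiS (U : sys R X m r) (gb : ext_data U) (z : quasi_data U) g y s :
  T_quasi gb z g y s.+1 = susp_map 1 (wt_quasi z s) \o
    pinch_xi (susp_map (m r) (inc U s)) (restr gb s.+1) (restr gb s).
Proof. by rewrite /pinch_xi compA. Qed.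

Lemma T_quasi_morph s : (s < r)%N -> T_quasi fb' w' f' v' s =h
  T_quasi fb w f v s \o cone_morph (S' := T fb' f' v') (S := T fb f v) T_morph s.
Proof.
case: s => [|s] sr; first exact: T_quasi_morph0.
have sr' : (s < r.-1)%N by case: (r) sr.
have [_ he_e _ _] := me.
have pe := he_pmap (he_e s (ltnW sr')); have pe1 := he_pmap (he_e s.+1 sr').
have [_ /(_ s sr')[_ pj' _]] := pS'; have [_ /(_ s sr')[_ pj _]] := pS.
have psj' := @pmap_susp R (m r) _ _ _ pj'; have psj := @pmap_susp R (m r) _ _ _ pj.
have pu := pmap_restr pS pfb sr'; have pu' := pmap_restr pS' pfb' sr'.
have h := pinch_xi_hsq psj psj' pu pu'
  (fun x => restrE fb pS x sr') (fun x => restrE fb' pS' x sr') (fun x => susp_e_inc x sr')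
  (fun q t => restr_homotopyE q t sr') (restr_hsq sr') (restr_hsq (ltnW sr')).
have pwt := pmap_wt_quasi pS sr' (pw sr').
have pE := he_pmap (he_susp_cone_morph sr').
have px' := @pmap_pinch_xi R _ _ _ _ _ _ psj' pu' (fun x => restrE fb' pS' x sr').
have hwt := hcompr px' (susp_homotopic 1 (wt_quasi_morph sr')).
rewrite !T_quasiS; apply: htrans hwt _.
rewrite (susp_map_comp R 1 pE.2 pwt.2).
rewrite -(compA (susp_map 1 (wt_quasi w s)) (susp_map 1 (@susp_cone_morph s))).
rewrite -(compA (susp_map 1 (wt_quasi w s)) (pinch_xi _ _ _)).
apply: hcompl; first exact: pmap_susp.
exact: (hsym h).
Qed.

End Att.
End Two.
End TStep.

(** * Presentations over homotopic sequences *)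

Arguments T_morph {R X m r S' S} e {fb'} fb K s _.

(** The second components agree up to transport along an equality [x = x], which proof irrelevance
    identifies with [erefl]. *)
Lemma existT_inj (T : Type) (P : T -> Type) (x : T) (a b : P x) :
  existT P x a = existT P x b -> a = b.
Proof.
have tagE u v (h : u = v) :
    eq_rect (projT1 u) P (projT2 u) (projT1 v) (congr1 (@projT1 T P) h) = projT2 v.
  by case: v / h.
move=> h; move: (tagE _ _ h) => /=.
by move: (congr1 _ h) => /= p; rewrite (Prop_irrelevance p erefl).
Qed.

Section StructureTransfer.
Variables (R : realType) (B : ptopologicalType) (Y : nat -> ptopologicalType).
Local Notation "f =h g" := (homotopic R f g) (at level 70).
Local Notation he := (homotopy_equivalence R).
Implicit Types S : system R B Y.

Lemma pmap_quasi_of_str k S (a : str_data S) s : pre_imc k S -> structure k a ->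
  (s < k)%N -> pointed_map (quasi_of_str a s).
Proof.
move=> [_ hS] ha sk; have [pg pj _] := hS s sk; have [hea aj] := ha s sk.
apply: pmap_comp; first exact: (pmap_qprime R pg.2).
apply: pmap_mcone_map => //; [exact: (he_pmap hea)|exact: pmap_id|].
by move=> x; rewrite -aj.
Qed.

(** The first member is prescribed instead of lifted, because a reduced structure must have the
    identity there; the others come from [structure_lift]. *)
Lemma structure_transfer k S' S (e : forall s, spc S' s -> spc S s) (a : str_data S)
    (a0 : spc S' 1 -> mcone R (att S' 0)) :
  morph k e -> pre_imc k S' -> quasi_imc k S -> structure k a ->
  ((0 < k)%N -> homotopy_cofibre_equiv (S := S') (s := 0%N) a0 /\
    qprime (att S' 0) \o mcone_map (inc S' 0) (mcl (att S' 0)) a0 idfun =h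
    quasi_of_str a 0%N \o cone_morph e 0%N) ->
  exists a' : str_data S', [/\ a' 0%N = a0, structure k a'
    & forall s, (s < k)%N -> quasi_of_str a' s =h quasi_of_str a s \o cone_morph e s].
Proof.
move=> me pS' qS ha ha0.
have lift s : exists a's : spc S' s.+2 -> mcone R (att S' s.+1), (s.+1 < k)%N ->
    homotopy_cofibre_equiv (S := S') (s := s.+1) a's /\
    qprime (att S' s.+1) \o mcone_map (inc S' s.+1) (mcl (att S' s.+1)) a's idfun =h
    quasi_of_str a s.+1 \o cone_morph e s.+1.
  case: (ltnP s.+1 k) => sk; last by exists (fun=> point).
  by have [a's h1 h2] := structure_lift me pS' qS sk (ha s.+1 sk); exists a's.
pose a' (s : nat) : spc S' s.+1 -> mcone R (att S' s) :=
  match s return spc S' s.+1 -> mcone R (att S' s) with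
  | 0%N => a0
  | s'.+1 => projT1 (cid (lift s'))
  end.
exists a'; split=> // -[|s] sk.
- by have [] := ha0 sk.
- by have [] := projT2 (cid (lift s)) sk.
- by have [] := ha0 sk.
- by have [] := projT2 (cid (lift s)) sk.
Qed.

Lemma structure_transfer_lift k S' S (e : forall s, spc S' s -> spc S s) (a : str_data S) :
  morph k e -> pre_imc k S' -> quasi_imc k S -> structure k a ->
  exists a' : str_data S', structure k a' /\
    forall s, (s < k)%N -> quasi_of_str a' s =h quasi_of_str a s \o cone_morph e s.
Proof.
move=> me pS' qS ha.
have [a0 h0] : exists a0 : spc S' 1 -> mcone R (att S' 0), (0 < k)%N ->
    homotopy_cofibre_equiv (S := S') (s := 0%N) a0 /\
    qprime (att S' 0) \o mcone_map (inc S' 0) (mcl (att S' 0)) a0 idfun =h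
    quasi_of_str a 0%N \o cone_morph e 0%N.
  case: (ltnP 0 k) => k0; last by exists (fun=> point).
  by have [a0 h1 h2] := structure_lift me pS' qS k0 (ha 0%N k0); exists a0.
by have [a' [_ h1 h2]] := structure_transfer me pS' qS ha h0; exists a'.
Qed.

End StructureTransfer.

Section Step.
Variables (R : realType) (X : nat -> ptopologicalType) (m : nat -> nat).
Local Notation I := (I01 R).
Local Notation "f =h g" := (homotopic R f g) (at level 70).
Local Notation he := (homotopy_equivalence R).

(* The [r]-th part of a presentation.  Below, [stage_str] is only relevant under
   [str] and [stage_ext] only under [ext]. *)
Record stage (r : nat) := Stage {
  stage_sys : sys R X m r;
  stage_quasi : quasi_data stage_sys;
  stage_str : str_data stage_sys;
  stage_ext : ext_data stage_sys }.
Arguments Stage {r stage_sys} stage_quasi stage_str stage_ext.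
Arguments stage_sys {r} _ : rename.
Arguments stage_quasi {r} _ s _ : rename.
Arguments stage_str {r} _ s _ : rename.
Arguments stage_ext {r} _ _ : rename.

(** The invariant of the induction on [r]. For the new system it records only [pre_imc]; the
    homotopy invariant conditions, and the fact that the quasi-structure consists of equivalences,
    are recovered through [morph]. *)
Definition stage_over (r : nat) (str ext : Prop) (f' : Susp R (m r) (X r) -> X r.+1)
    (x x' : stage r) : Prop :=
  exists e : forall s, spc (stage_sys x') s -> spc (stage_sys x) s,
  [/\ morph r.-1 e, pre_imc r.-1 (stage_sys x'),
      forall s, (s < r.-1)%N ->
        stage_quasi x' s =h stage_quasi x s \o cone_morph e s,
      str -> [/\ structure r.-1 (stage_str x'),
        stage_quasi x' = quasi_of_str (stage_str x')
        & (3 <= r)%N -> reduced_str (stage_str x')]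
    & ext -> exists K : Susp R (m r) (spc (stage_sys x') r.-1) * I -> X r.+1,
      [/\ pointed_map (stage_ext x') /\
          stage_ext x' \o susp_map (m r) (inc_to (inc (stage_sys x')) 0 r.-1) = f',
          ctn K, forall t, K (point, t) = point,
          forall y, K (y, i0 R) = stage_ext x' y
        & forall y, K (y, i1 R) = stage_ext x (susp_map (m r) (e r.-1) y)]].

Definition stage_of (r : nat) (str ext : Prop) (f : Susp R (m r) (X r) -> X r.+1)
    (x : stage r) : Prop :=
  [/\ quasi_imc r.-1 (stage_sys x),
      str -> [/\ structure r.-1 (stage_str x),
        stage_quasi x = quasi_of_str (stage_str x)
        & (3 <= r)%N -> reduced_str (stage_str x)],
      ~ str -> forall s, (s < r.-1)%N -> pointed_map (stage_quasi x s)
    & ext -> pointed_map (stage_ext x) /\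
        stage_ext x \o susp_map (m r) (inc_to (inc (stage_sys x)) 0 r.-1) = f].

Lemma stage_over_extend r (str ext : Prop) (f f' : Susp R (m r) (X r) -> X r.+1)
    (x : stage r) S' (e : forall s, spc S' s -> spc (stage_sys x) s)
    (w' : quasi_data S') (a' : str_data S') :
  stage_of str ext f x -> f =h f' -> morph r.-1 e -> pre_imc r.-1 S' ->
  (forall s, (s < r.-1)%N -> w' s =h stage_quasi x s \o cone_morph e s) ->
  (str -> [/\ structure r.-1 a', w' = quasi_of_str a'
     & (3 <= r)%N -> reduced_str a']) ->
  exists fb' : ext_data S', stage_over str ext f' x (Stage w' a' fb').
Proof.
move=> [qS _ _ gext] ff' me pS' ww' sa'.
have [hext|next] := pselect ext; last first.
  by exists (fun=> point), e; split=> // /next.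
have [pfb fbE] := gext hext.
have [fb' [K [pfb' fb'E [cK Kp] K0 K1]]] :=
  extension_transfer me pS' (quasi_imc_pre qS) (leqnn _) pfb fbE ff'.
by exists fb', e; split=> // _; exists K.
Qed.

Lemma stage_of_pmap r (str ext : Prop) f (x : stage r) : stage_of str ext f x ->
  forall s, (s < r.-1)%N -> pointed_map (stage_quasi x s).
Proof.
move=> [qS gstr gq _] s sr; have [hs|hs] := pselect str; last exact: gq.
have [ha -> _] := gstr hs.
exact: pmap_quasi_of_str (quasi_imc_pre qS) ha sr.
Qed.

(** With the first attaching map written as [restr fb 0], the second space of [T] is literally its
    mapping cone, so the dependent equality compares elements of one type. *)
Lemma reduced_T_structure r (S : sys R X m r) (fb : ext_data S) v
    (a : str_data (T fb (restr fb 0) v)) : reduced_str a -> a 0%N = idfun.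
Proof. by move=> h; have [] := existT_inj h. Qed.

Lemma stage_over_step r (aq str ext str1 ext1 : Prop) (f f' : Susp R (m r) (X r) -> X r.+1)
    (f1 f1' : Susp R (m r.+1) (X r.+1) -> X r.+2) (x x' : stage r) (x1 : stage r.+1)
    (v : inv_data (stage_sys x)) :
  (2 <= r)%N -> ext -> well_pointed R (X r.+1) -> f =h f' -> f1 =h f1' ->
  stage_of str ext f x -> stage_of str1 ext1 f1 x1 -> (aq -> ~ str1) ->
  stage_over str ext f' x x' ->
  inverses (stage_quasi x) v -> stage_sys x1 = T (stage_ext x) f v ->
  (aq -> existT (@quasi_data R _ _) (stage_sys x1) (stage_quasi x1) =
    existT (@quasi_data R _ _) (T (stage_ext x) f v)
      (T_quasi (stage_ext x) (stage_quasi x) f v)) ->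
  exists x1' : stage r.+1, stage_over str1 ext1 f1' x1 x1' /\
    exists v' : inv_data (stage_sys x'),
    [/\ inverses (stage_quasi x') v', stage_sys x1' = T (stage_ext x') f' v'
      & aq -> existT (@quasi_data R _ _) (stage_sys x1') (stage_quasi x1') =
        existT (@quasi_data R _ _) (T (stage_ext x') f' v')
          (T_quasi (stage_ext x') (stage_quasi x') f' v')].
Proof.
move=> r2 hext wX ff' ff1'.
case: x v => S w a fb v; case: x' => S' w' a' fb'; case: x1 => S1 w1 a1 fb1.
move=> gx gx1 naq [e [me pS' ww' _ /(_ hext)[K [[pfb' fb'E] cK Kp K0 K1]]]] /= hv S1E aqE.
have pw := stage_of_pmap gx; have [qS _ _ /(_ hext)[pfb fbE]] := gx.
rewrite /= in e me pS' ww' K fb'E pfb' cK Kp K0 K1 pw qS pfb fbE.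
have pS := quasi_imc_pre qS.
subst S1.
have {}fbE : restr fb 0 = f by [].
have {}fb'E : restr fb' 0 = f' by [].
have pf := hpmapl ff'; have pf' := hpmapr ff'.
have [v' [hv' ev]] := inverses_morph me pS' pS pw ww' hv.
have pv' s : (s < r.-1)%N -> pointed_map (v' s) by case/hv'.
have mT := T_morph_morph me pS' pS pfb' pfb cK Kp K0 K1 (hsym ff') pv' ev.
have pT' := pre_imc_T pS' pfb' pf' wX pv'.
have [qT gstr1 _ _] := gx1; rewrite /= in qT gstr1.
pose eT := T_morph e (fb' := fb') fb K.
suff [w1' [a1' [ww1 sa1 aq1]]] : exists (w1' : quasi_data (T fb' f' v'))
    (a1' : str_data (T fb' f' v')),
    [/\ forall s, (s < r)%N -> w1' s =h w1 s \o cone_morph (S' := T fb' f' v')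
          (S := T fb f v) eT s,
        str1 -> [/\ structure r a1', w1' = quasi_of_str a1'
          & (3 <= r.+1)%N -> reduced_str a1']
      & aq -> w1' = T_quasi fb' w' f' v'].
  have [fb1' ov] := stage_over_extend gx1 ff1' mT pT' ww1 sa1.
  exists (Stage w1' a1' fb1'); split; first exact: ov.
  exists v'; split; [exact: hv'|reflexivity|move=> haq].
  by rewrite (aq1 haq); reflexivity.
(* Without structures the new quasi-structure is the iterated one under [aq], and otherwise the old
   one composed with the morphism. With structures it is induced by a transferred structure whose
   first member is the identity. *)
have [hs|hs] := pselect str1; last first.
  have [haq|haq] := pselect aq; last first.
    by exists (fun s => w1 s \o cone_morph (S' := T fb' f' v') (S := T fb f v) eT s),
      (fun s _ => point); split=> // s sr; apply: hrefl; apply: pmap_comp;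
      [exact: (stage_of_pmap gx1 sr)|exact: (he_pmap (he_cone_morph mT pT' qT sr))].
  exists (T_quasi fb' w' f' v'), (fun s _ => point); split=> // s sr.
  rewrite (existT_inj (aqE haq)).
  exact: (T_quasi_morph me pS' pS pfb' pfb cK Kp K0 K1 pw ww').
have [ha1 w1E /(_ r2) red1] := gstr1 hs.
rewrite w1E.
(* Now the second space of either system is convertible to the mapping cone of its first attaching
   map, and [idfun] is well typed as a first member. *)
subst f f'.
have a10 := reduced_T_structure red1.
have [|a1' [a1'0 ha1' h1]] := structure_transfer (S' := T fb' (restr fb' 0) v')
  (S := T fb (restr fb 0) v) (a0 := idfun) mT pT' qT ha1.
  move=> _; split; first by split; [exact: he_id|].
  rewrite /quasi_of_str a10 /= !mcone_map_id //.
  exact: (T_quasi_morph0 me pS' pS pfb' pfb cK Kp K0 K1).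
exists (quasi_of_str (S := T fb' (restr fb' 0) v') a1'), a1'.
split=> [s sr|_|haq]; [exact: (h1 s sr)| |case: (naq haq hs)].
split; [exact: ha1'|reflexivity|move=> _].
by rewrite /reduced_str a1'0; reflexivity.
Qed.

End Step.
Arguments Stage {R X m r stage_sys} stage_quasi stage_str stage_ext.
Arguments stage_sys {R X m r} _ : rename.
Arguments stage_quasi {R X m r} _ s _ : rename.
Arguments stage_str {R X m r} _ s _ : rename.
Arguments stage_ext {R X m r} _ _ : rename.
Arguments stage_over {R X m r} str ext f' x x'.
Arguments stage_of {R X m r} str ext f x.

(** * The second stage, where the first attaching map itself changes *)

Section Base.
Variables (R : realType) (B : ptopologicalType) (Y : nat -> ptopologicalType).
Local Notation I := (I01 R).
Local Notation "f =h g" := (homotopic R f g) (at level 70).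
Local Notation he := (homotopy_equivalence R).
Implicit Types S : system R B Y.

(** The choice for the non-reduced case: spaces and inclusions are kept, so the identities form a
    morphism to [S] as soon as [g] is homotopic to [att S 0]. *)
Definition change_att S (g : Y 0 -> B) : system R B Y :=
  System (upper := upper S)
    (fun s => match s return Susp R s (Y s) -> chain B (upper S) s with
      | 0 => g | s'.+1 => att S s'.+1 end)
    (fun s => inc S s).

(* Only [spc s] for [s <= 1] is relevant. *)
Definition cone_system (g : Y 0 -> B) : system R B Y :=
  System (upper := fun=> mcone R g)
    (fun s => match s return Susp R s (Y s) -> chain B (fun=> mcone R g) s with
      | 0 => g | _.+1 => fun=> point end)
    (fun s => match s return chain B (fun=> mcone R g) s -> mcone R g with
      | 0 => mcl g | _.+1 => fun=> point end).

Definition cone_system_map (g : Y 0 -> B) S (d : mcone R g -> spc S 1) s :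
    spc (cone_system g) s -> spc S s :=
  match s return spc (cone_system g) s -> spc S s with
  | 0 => idfun
  | 1 => d
  | _.+2 => fun=> point
  end.

Variables (S : system R B Y) (g : Y 0 -> B).
Hypotheses (qS : quasi_imc 1 S) (gg : g =h att S 0).

Lemma change_att_morph : morph (S' := change_att S g) (S := S) 1 (fun=> idfun).
Proof. split=> //; first by move=> s _; exact: he_id.
by case. Qed.

Lemma pre_imc_change_att : pre_imc 1 (change_att S g).
Proof.
have [wS hS] := qS; split=> [s|[|]// _]; first exact: wS.
by have [_ pj cj _ _] := hS 0%N isT; split=> //; exact: (hpmapl gg).
Qed.

(** Replaces the equality of spaces by an equivalence [phi], which is the identity up to that
    equality, so that no cast appears later. *)
Lemma reduced_equiv : reduced S -> exists phi : mcone R (att S 0) -> spc S 1,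
  he phi /\ phi \o mcl (att S 0) = inc S 0.
Proof.
(* A predicate on the whole dependent pair, in which [red] can be rewritten. *)
pose Q (u : {Z : ptopologicalType & B -> Z}) :=
  exists phi : mcone R (att S 0) -> projT1 u, he phi /\ phi \o mcl (att S 0) = projT2 u.
move=> red; suff : Q (existT (fun Z : ptopologicalType => B -> Z) (spc S 1) (inc S 0)) by [].
by rewrite red; exists idfun; split; [exact: he_id|].
Qed.

Lemma reduced_quasi_equiv (w : quasi_data S) : reduced_quasi w ->
  exists phi : mcone R (att S 0) -> spc S 1,
  [/\ he phi, phi \o mcl (att S 0) = inc S 0
    & w 0%N \o mcone_map (mcl (att S 0)) (inc S 0) phi idfun = qprime (att S 0)].
Proof.
pose P (Z : ptopologicalType) := {j : B -> Z & mcone R j -> Susp R 1 (Y 0)}.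
pose Q (u : {Z : ptopologicalType & P Z}) :=
  exists phi : mcone R (att S 0) -> projT1 u,
  [/\ he phi, phi \o mcl (att S 0) = projT1 (projT2 u)
    & projT2 (projT2 u) \o mcone_map (mcl (att S 0)) (projT1 (projT2 u)) phi idfun =
      qprime (att S 0)].
move=> red; suff : Q (existT P (spc S 1) (existT _ (inc S 0) (w 0%N))) by [].
rewrite /P red; exists idfun; split=> //; first exact: he_id.
by rewrite mcone_map_id.
Qed.

Lemma reduced_str_equiv (a : str_data S) : reduced_str a ->
  exists phi : mcone R (att S 0) -> spc S 1,
  [/\ he phi, phi \o mcl (att S 0) = inc S 0 & a 0%N \o phi = idfun].
Proof.
pose P (Z : ptopologicalType) := ((B -> Z) * (Z -> mcone R (att S 0)))%type.
pose Q (u : {Z : ptopologicalType & P Z}) :=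
  exists phi : mcone R (att S 0) -> projT1 u,
  [/\ he phi, phi \o mcl (att S 0) = (projT2 u).1 & (projT2 u).2 \o phi = idfun].
move=> red; suff : Q (existT P (spc S 1) (inc S 0, a 0%N)) by [].
by rewrite /P red; exists idfun; split=> //; exact: he_id.
Qed.

Hypothesis wY : well_pointed R (Y 0).

Lemma pre_imc_cone_system : pre_imc 1 (cone_system g).
Proof.
have [wS _] := qS; have pg := hpmapl gg.
split=> [[|[|]//] _|[|]// _]; first exact: (wS 0%N).
  by apply: well_pointed_mcone => //; exact: (wS 0%N).
by split=> //; [exact: pmap_mcl|exact: cof_mcl].
Qed.

Section Phi.
Variable phi : mcone R (att S 0) -> spc S 1.
Hypotheses (hphi : he phi) (phiE : phi \o mcl (att S 0) = inc S 0).

(** [mu] is the map of mapping cones induced by the homotopy from [g] to [att S 0], with identities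
    on both sides; [phi] leads on to the old second space. *)
Lemma cone_system_morph : exists mu : mcone R g -> mcone R (att S 0),
  [/\ morph (S' := cone_system g) (S := S) 1 (cone_system_map (phi \o mu)),
      he mu, mu \o mcl g = mcl (att S 0)
    & qprime g =h qprime (att S 0) \o
        mcone_map (mcl g : B -> mcone R g) (mcl (att S 0)) mu idfun].
Proof.
have [K [cK K0 K1 Kp]] := gg; have pg := hpmapl gg; have pg' := hpmapr gg.
have sq : hsq_data g (att S 0) idfun K idfun.
  by split=> //; exact: pmap_id.
pose mu := hsq g (att S 0) idfun K idfun.
have hmu : he mu := he_hsq pg pg' sq (@he_id R _) (@he_id R _).
have muE x : mu (mcl g x) = mcl (att S 0) x by rewrite /mu (hsq_l pg'.2 sq).
exists mu; split=> //; last 1 first.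
- have := qprime_hsq pg.2 pg'.2 sq.
  by rewrite (susp_map_id R 1) => /hsym.
- split=> // [[|[|]//] _|[|]// _ x|[|]// _]; first exact: he_id.
  + exact: he_comp.
  + by rewrite /= muE -phiE.
- by apply/funext => x; rewrite /= muE.
Qed.

Lemma cone_system_cone_morph (mu : mcone R g -> mcone R (att S 0)) :
  he mu -> mu \o mcl g = mcl (att S 0) ->
  cone_morph (S' := cone_system g) (S := S) (cone_system_map (phi \o mu)) 0 =
  mcone_map (mcl (att S 0)) (inc S 0) phi idfun \o
    mcone_map (mcl g : B -> mcone R g) (mcl (att S 0)) mu idfun.
Proof.
move=> hmu muE; have pmu := he_pmap hmu; have pphi := he_pmap hphi.
have [_ /(_ 0%N isT)[_ pj _ _ _]] := qS; have qj := pj.2.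
have pid := pmap_id B.
have mE x : mu (mcl g x) = mcl (att S 0) x by rewrite -muE.
have pE x : phi (mcl (att S 0) x) = inc S 0 x by rewrite -phiE.
apply/funext => x; rewrite /cone_morph /=.
have pmm := pmap_comp pphi pmu.
have mmE a : (phi \o mu) (mcl g a) = inc S 0 a by rewrite /= mE.
have [[y ->]|[z [t ->]]] := mconeP x.
  by rewrite !mcone_map_l.
by rewrite !mcone_map_r.
Qed.

End Phi.
End Base.

Section BaseStage.
Variables (R : realType) (X : nat -> ptopologicalType) (m : nat -> nat).
Local Notation "f =h g" := (homotopic R f g) (at level 70).
Local Notation he := (homotopy_equivalence R).

Definition compat (str : Prop) (x : stage R X m 2) (S' : sys R X m 2)
    (e : forall s, spc S' s -> spc (stage_sys x) s)
    (w' : quasi_data S') (a' : str_data S') : Prop :=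
  (forall s, (s < 1)%N -> w' s =h stage_quasi x s \o cone_morph e s) /\
  (str -> structure 1 a' /\ w' = quasi_of_str a').

Lemma compat_exists (str ext : Prop) f (x : stage R X m 2) S'
    (e : forall s, spc S' s -> spc (stage_sys x) s) :
  stage_of str ext f x -> morph 1 e -> pre_imc 1 S' ->
  exists w' a', compat str e w' a'.
Proof.
move=> gx me pS'; have [qS gstr _ _] := gx.
have [hs|hs] := pselect str; last first.
  exists (fun s => stage_quasi x s \o cone_morph e s), (fun s _ => point).
  split=> [s sr|/hs//]; apply: hrefl; apply: pmap_comp; first exact: (stage_of_pmap gx sr).
  exact: (he_pmap (he_cone_morph me pS' qS sr)).
have [ha wE _] := gstr hs.
have [a' [ha' h]] := structure_transfer_lift me pS' qS ha.
by exists (quasi_of_str a'), a'; split=> // s sr; rewrite wE; exact: h.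
Qed.

Lemma stage_over_base (str ext red redq reds : Prop)
    (g : Susp R (m 1) (X 1) -> X 2) (f f' : Susp R (m 2) (X 2) -> X 3)
    (x : stage R X m 2) :
  well_pointed R (Susp R (m 1) (X 1)) -> stage_of str ext f x -> f =h f' ->
  g =h att (stage_sys x) 0 ->
  (red -> reduced (stage_sys x)) ->
  (redq -> [/\ ~ str, red & reduced_quasi (stage_quasi x)]) ->
  (reds -> [/\ str, red & reduced_str (stage_str x)]) ->
  exists x' : stage R X m 2,
  [/\ stage_over str ext f' x x', att (stage_sys x') 0 = g,
      red -> reduced (stage_sys x'),
      redq -> reduced_quasi (stage_quasi x')
    & reds -> reduced_str (stage_str x')].
Proof.
move=> wX gx ff' gg hred hredq hreds.
have [qS gstr _ _] := gx.
suff [S' [e [w' [a' [me pS' [ww' sa'] [attE r1 r2 r3]]]]]] :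
    exists S' (e : forall s, spc S' s -> spc (stage_sys x) s)
      (w' : quasi_data S') (a' : str_data S'),
    [/\ morph 1 e, pre_imc 1 S', compat str e w' a'
      & [/\ att S' 0 = g, red -> reduced S', redq -> reduced_quasi w'
          & reds -> reduced_str a']].
  have [|fb' ov] := stage_over_extend gx ff' me pS' ww' (a' := a').
    by move=> /sa'[h1 h2]; split.
  by exists (Stage w' a' fb').
have [rd|nrd] := pselect red; last first.
  have me := change_att_morph gg; have pS' := pre_imc_change_att qS gg.
  have [w' [a' c]] := compat_exists gx me pS'.
  exists (change_att (stage_sys x) g), (fun=> idfun), w', a'; split=> //; split=> //.
  - by move=> /hredq[_ /nrd].
  - by move=> /hreds[_ /nrd].
have pS' : pre_imc 1 (cone_system _ g) := pre_imc_cone_system qS gg wX.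
(* A reduced quasi-structure leaves no choice but [qprime g]. It is compatible because the old first
   member corresponds to [qprime] under [phi]. *)
have [rq|nrq] := pselect redq.
  have [ns _ /reduced_quasi_equiv[phi [hphi phiE wphi]]] := hredq rq.
  have [mu [me hmu muE qh]] := cone_system_morph gg hphi phiE.
  exists (cone_system _ g), (cone_system_map (phi \o mu)),
    (fun s => match s return mcone R (inc (cone_system _ g) s) -> Susp R s.+1 (msusp R X m 2 s.+1)
       with 0 => qprime g | _.+1 => fun=> point end), (fun s _ => point).
  split=> //; last by split=> // /hreds[/ns].
  split=> [[|//] _|/ns//].
  by rewrite (cone_system_cone_morph qS hphi phiE hmu muE) compA wphi.
have [rs|nrs] := pselect reds.
  have [hs _ /reduced_str_equiv[phi [hphi phiE aphi]]] := hreds rs.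
  have [mu [me hmu muE qh]] := cone_system_morph gg hphi phiE.
  have [ha wE _] := gstr hs.
  have [|a' [a'0 ha' h]] := structure_transfer (S' := cone_system _ g)
    (a0 := idfun) me pS' qS ha.
    move=> _; split; first by split; [exact: he_id|].
    have [_ qg] := hpmapl gg.
    rewrite mcone_map_id //.
    have pa := he_pmap (ha 0%N isT).1; have pphi := he_pmap hphi.
    have [_ /(_ 0%N isT)[pgS pj _ _ _]] := qS; have [qgS qj] := (pgS.2, pj.2).
    have pid := pmap_id (X 2).
    (* The old first member is a strict left inverse of [phi], so the induced maps of cones cancel
       and the comparison along [mu] is left, which is [qh]. *)
    have cancel : mcone_map (R := R) (inc (stage_sys x) 0) (mcl (att (stage_sys x) 0))
        (stage_str x 0%N) idfun \o
        mcone_map (R := R) (mcl (att (stage_sys x) 0)) (inc (stage_sys x) 0) phi idfun =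
        idfun.
      have aE y : stage_str x 0%N (phi y) = y by rewrite -[LHS]/((_ \o phi) y) aphi.
      have pE y : phi (mcl (att (stage_sys x) 0) y) = inc (stage_sys x) 0 y by rewrite -phiE.
      have iE y : stage_str x 0%N (inc (stage_sys x) 0 y) = mcl (att (stage_sys x) 0) y.
        by rewrite -pE aE.
      apply: funext => y /=; have [[z ->]|[z [t ->]]] := mconeP y.
        by rewrite !mcone_map_l //= aE.
      by rewrite !mcone_map_r.
    rewrite (cone_system_cone_morph qS hphi phiE hmu muE) /quasi_of_str.
    rewrite (_ : _ \o (_ \o _) = qprime (att (stage_sys x) 0) \o
      mcone_map (mcl g : X 2 -> mcone R g) (mcl (att (stage_sys x) 0)) mu idfun); first exact: qh.
    apply: funext => y; congr qprime.
    exact: (congr1 (fun h => h (mcone_map _ _ mu idfun y)) cancel).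
  exists (cone_system _ g), (cone_system_map (phi \o mu)), (quasi_of_str a'), a'.
  split=> //; last by split=> // _; rewrite /reduced_str a'0.
  by split=> // s sr; rewrite wE; exact: h.
have [phi [hphi phiE]] := reduced_equiv (hred rd).
have [mu [me hmu muE qh]] := cone_system_morph gg hphi phiE.
have [w' [a' c]] := compat_exists gx me pS'.
by exists (cone_system _ g), (cone_system_map (phi \o mu)), w', a'.
Qed.

End BaseStage.

(** Dependent choice along a family of types, keeping the relation between consecutive terms. [d]
    supplies the values at 0 and 1. *)
Lemma dependent_chain (S : nat -> Type) (d : forall r, S r)
    (Q : forall r, S r -> Prop) (L : forall r, S r -> S r.+1 -> Prop) n (x2 : S 2) :
  Q 2 x2 ->
  (forall r x, (2 <= r < n)%N -> Q r x -> exists y, Q r.+1 y /\ L r x y) ->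
  exists F : forall r, S r, [/\ F 2 = x2, forall r, (2 <= r <= n)%N -> Q r (F r)
    & forall r, (2 <= r < n)%N -> L r (F r) (F r.+1)].
Proof.
move=> Q2 step.
(* Made total by falling back on [d] when no successor exists, so that the recursion [G] carries no
   proofs. *)
have next r (x : S r) : exists y, (exists z, Q r.+1 z /\ L r x z) -> Q r.+1 y /\ L r x y.
  have [[y hy]|h] := pselect (exists z, Q r.+1 z /\ L r x z); first by exists y.
  by exists (d r.+1).
pose fix G j : S j.+2 := if j is j'.+1 then projT1 (cid (next _ (G j'))) else x2.
have GP j : (j.+2 < n)%N -> Q j.+2 (G j) ->
    Q j.+3 (G j.+1) /\ L j.+2 (G j) (G j.+1).
  move=> jn qj; have h := projT2 (cid (next _ (G j))); apply: h.
  exact: step.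
have QG j : (j.+2 <= n)%N -> Q j.+2 (G j).
  by elim: j => // j IH jn; have [] := GP j jn (IH (ltnW jn)).
exists (fun r => match r with 0 => d 0%N | 1 => d 1%N | j.+2 => G j end).
by split=> // -[|[|j]] // jn; [exact: QG|have [] := GP j jn (QG j (ltnW jn))].
Qed.
Arguments dependent_chain {S} d {Q L n x2} _ _.

Arguments csys {R X m n} c r.
Arguments cext {R X m n} c r _ : rename.
Arguments clast {R X m n} c _ : rename.
Arguments admissible {R X m n} f P.

Section Transfer.
Variables (R : realType) (n : nat) (X : nat -> ptopologicalType) (m : nat -> nat).
Local Notation I := (I01 R).
Local Notation "f =h g" := (homotopic R f g) (at level 70).
Local Notation he := (homotopy_equivalence R).
Local Notation collection := (collection R X m n).
Local Notation maps := (forall i, Susp R (m i) (X i) -> X i.+1).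

(* A common generalization of the twelve notions of presentation (up to the
   conditions on [csys P 2]): under [str r] the [r]-th quasi-structure is the one
   of the structure [a r], and under [aq] the quasi-structures are iterated. *)
Definition presented (aq : Prop) (str : nat -> Prop) (f : maps) (P : collection)
    (w : forall r, quasi_data (csys P r)) (a : forall r, str_data (csys P r)) : Prop :=
  [/\ admissible f P,
      forall r, (2 <= r <= n)%N -> ~ str r -> quasi_structure r.-1 (w r),
      forall r, (2 <= r <= n)%N -> str r ->
        [/\ structure r.-1 (a r), w r = quasi_of_str (a r)
          & (3 <= r)%N -> reduced_str (a r)]
    & forall r, (2 <= r < n)%N -> exists v,
        [/\ inverses (w r) v, csys P r.+1 = T (cext P r) (f r) v
          & aq -> existT (@quasi_data R _ _) (csys P r.+1) (w r.+1) =
              existT (@quasi_data R _ _) (T (cext P r) (f r) v)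
                (T_quasi (cext P r) (w r) (f r) v)]].
Arguments presented aq str f {P} w a.

Variables f f' : maps.
Arguments f i _ : clear implicits.
Arguments f' i _ : clear implicits.
Hypotheses (n3 : (3 <= n)%N)
  (wX : forall i, (1 <= i <= n.+1)%N -> well_pointed R (X i))
  (ff' : forall i, (1 <= i <= n)%N -> f i =h f' i).

Lemma presentation_transfer (aq red redq reds : Prop) (str : nat -> Prop)
    (P : collection) (w : forall r, quasi_data (csys P r))
    (a : forall r, str_data (csys P r)) :
  presented aq str f w a -> (aq -> forall r, ~ str r) ->
  (red -> reduced (csys P 2)) ->
  (redq -> [/\ ~ str 2, red & reduced_quasi (w 2)]) ->
  (reds -> [/\ str 2, red & reduced_str (a 2)]) ->
  exists (P' : collection) (w' : forall r, quasi_data (csys P' r))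
      (a' : forall r, str_data (csys P' r)),
    [/\ presented aq str f' w' a', imc 1 (csys P 2) -> imc 1 (csys P' 2),
        [/\ red -> reduced (csys P' 2), redq -> reduced_quasi (w' 2)
          & reds -> reduced_str (a' 2)]
      & pres_map P =h pres_map P'].
Proof.
move=> [adm hw ha hlink] naq hred hredq hreds.
have [hatt q2 hi hext hlast] := adm.
pose O r : stage R X m r := Stage (w r) (a r) (cext P r).
have qP r : (2 <= r <= n)%N -> quasi_imc r.-1 (csys P r).
  move=> /andP[]; rewrite leq_eqVlt => /orP[/eqP <- //|r3 rn].
  by have /hi[] : (3 <= r <= n)%N by rewrite r3.
(* Extensions over the full space [spc S r.-1] exist only for [r < n]; the last one, [clast], lives
   one space earlier and is transferred separately. *)
have gO r : (2 <= r <= n)%N -> stage_of (str r) (r < n)%N (f r) (O r).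
  move=> rn; split; [exact: qP|exact: ha| |].
  - by move=> ns s sr; exact: (he_pmap (hw r rn ns s sr)).
  - by move=> rn'; apply: hext; case/andP: rn => ->.
have [|||||||F2 [ov2 att2 red2 redq2 reds2]] := @stage_over_base R X m
    (str 2) (2 < n)%N red redq reds (f' 1%N) (f 2) (f' 2) (O 2).
- by apply: well_pointed_susp; exact: wX.
- by apply: gO; exact: (ltnW n3).
- by apply: ff'; exact: (ltnW n3).
- by rewrite (hatt 1%N (ltnW n3)); apply: hsym; apply: ff'; exact: (ltnW (ltnW n3)).
- exact: hred.
- exact: hredq.
- exact: hreds.
pose Q r (x' : stage R X m r) := stage_over (str r) (r < n)%N (f' r) (O r) x'.
pose L r (x' : stage R X m r) (x1' : stage R X m r.+1) :=
  exists v' : inv_data (stage_sys x'),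
    [/\ inverses (stage_quasi x') v', stage_sys x1' = T (stage_ext x') (f' r) v'
      & aq -> existT (@quasi_data R _ _) (stage_sys x1') (stage_quasi x1') =
        existT (@quasi_data R _ _) (T (stage_ext x') (f' r) v')
          (T_quasi (stage_ext x') (stage_quasi x') (f' r) v')].
have [|F [FE QF LF]] := @dependent_chain (stage R X m) O Q L n F2 ov2.
  move=> r x' rn ov; have /andP[r2 rn1] := rn; have [v [hv sE aE]] := hlink r rn.
  have r1 := ltnW r2; have rn' := ltnW rn1.
  apply: (stage_over_step (f := f r) (f1 := f r.+1) (x := O r) (x1 := O r.+1)
    (ext := is_true (r < n)%N) (v := v) r2 rn1 _ _ _ _ _ _ ov hv sE aE).
  - by apply: wX; rewrite ltnS ltnW.
  - by apply: ff'; rewrite r1.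
  - by apply: ff'; rewrite rn1.
  - by apply: gO; rewrite r2.
  - by apply: gO; rewrite rn1 andbT ltnS.
  - by move=> haq; exact: naq.
have nn : (2 <= n <= n)%N by rewrite ltnW /=.
have [e [me pS' ww' _ _]] := QF n nn.
have [plast lastE] := hlast.
have lt_n : (n.-2 < n.-1)%N by case: (n) n3 => // -[].
have fn : f n =h f' n by apply: ff'; rewrite leqnn (ltnW (ltnW n3)).
(* The level is [n.-2], one below the top, as this is the source of [clast]. *)
have [l' [K [pl' l'E [cK Kp] K0 K1]]] :=
  extension_transfer me pS' (quasi_imc_pre (qP n nn)) (ltnW lt_n) plast lastE fn.
have n22 : (2 <= 2 <= n)%N := ltnW n3.
exists (Collection (fun r => stage_ext (F r)) l'),
  (fun r => stage_quasi (F r)), (fun r => stage_str (F r)).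
split.
- split; first split.
  + move=> [//|[_|r /andP[_ rn]]] /=; first by rewrite FE.
    by have [v' [_ sE _]] := LF r.+2 rn; rewrite sE.
  + have [e2 [me2 pS2 _ _ _]] := QF 2 n22.
    exact: (morph_quasi_imc me2 pS2 q2).
  + move=> r /andP[r3 rn]; have r2 : (2 <= r <= n)%N by rewrite (ltnW r3).
    have [er [mer pSr _ _ _]] := QF r r2.
    apply: (morph_imc mer pSr (qP r r2)); apply: hi; by rewrite r3.
  + move=> r /andP[r2 rn]; have r2n : (2 <= r <= n)%N by rewrite r2 ltnW.
    by have [er [_ _ _ _ /(_ rn)[Kr [[? ?] _ _ _ _]]]] := QF r r2n.
  + by split.
  + move=> r rn ns s sr; have [er [mer pSr wwr _ _]] := QF r rn.
    apply: he_homotopic (hsym (wwr s sr)) _.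
    by apply: he_comp; [exact: hw|exact: (he_cone_morph mer pSr (qP r rn) sr)].
  + by move=> r rn hs; have [er [_ _ _ /(_ hs) h _]] := QF r rn.
  + exact: LF.
- have [e2 [me2 pS2 _ _ _]] := QF 2 n22.
  exact: (morph_imc me2 pS2 q2).
- by rewrite /= FE.
have [_ he_e _ eatt] := me.
have pe := he_pmap (he_e n.-2 (ltnW lt_n)).
have [_ /(_ n.-2 lt_n)[patt _ _]] := pS'.
have psw := @pmap_susp_swap R (m n) n.-2 (msusp R X m n n.-2.+1).
apply: hsym; rewrite /pres_map /=; apply: hcompr; first exact: psw.
(* First [K] replaces the new last extension by the old one after [e], then the morphism moves [e]
   past the attaching map. *)
apply: (@htrans _ _ _ (clast P \o susp_map (m n) (e n.-2) \o
  susp_map (m n) (att (stage_sys (F n)) n.-2))).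
  apply: hcompr; first exact: pmap_susp.
  by exists K; split.
rewrite -(compA (clast P)) -(susp_map_comp R (m n) patt.2 pe.2).
by apply: hcompl => //; apply: susp_homotopic; exact: eatt.
Qed.

End Transfer.

Arguments presented {R n X m} aq str f {P} w a.
Arguments q_pres {R X m n} f {P} w.
Arguments aq_pres {R X m n} f {P} w.
Arguments q2_pres {R X m n} f {P} w a.
Arguments st_pres {R X m n} f {P} a.
Arguments presentation {R X m n} f star P.
Arguments presentation_transfer {R n X m f f'} n3 wX ff' {aq red redq reds str P w a}.

(** * Reduction of the twelve symbols to one notion of presentation *)

Definition star_iterated (star : symbol) : bool :=
  match star with
  | star_aq | star_aqs2 | star_aqds2 | star_aqdds2 => true
  | _ => false
  end.

Definition star_structured (star : symbol) (r : nat) : bool :=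
  match star with
  | star_q2 => (2 < r)%N
  | star_st | star_dst | star_ddst => true
  | _ => false
  end.

Definition star_imc (star : symbol) : bool :=
  match star with star_q | star_aq | star_q2 => false | _ => true end.

Definition star_reduced (star : symbol) : bool :=
  match star with
  | star_qds2 | star_qdds2 | star_aqds2 | star_aqdds2 | star_dst | star_ddst => true
  | _ => false
  end.

Definition star_reduced_quasi (star : symbol) : bool :=
  match star with star_qdds2 | star_aqdds2 => true | _ => false end.

Definition star_reduced_str (star : symbol) : bool :=
  match star with star_ddst => true | _ => false end.

Section Symbols.
Variables (R : realType) (n : nat) (X : nat -> ptopologicalType) (m : nat -> nat).
Local Notation "f =h g" := (homotopic R f g) (at level 70).
Local Notation collection := (collection R X m n).
Local Notation maps := (forall i, Susp R (m i) (X i) -> X i.+1).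
Local Notation quasi P := (forall r, quasi_data (csys P r)).
Local Notation str P := (forall r, str_data (csys P r)).
Implicit Types (P : collection) (f : maps).

Lemma q_presE f P (w : quasi P) (a : str P) :
  presented false (fun=> false) f w a <-> q_pres f w.
Proof.
split=> [[adm hw _ link]|[adm hw link]]; split=> //.
- by move=> r rn; exact: hw.
- by move=> r /link[v [hv sE _]]; exists v.
- by move=> r rn _; exact: hw.
- by move=> r /link[v [hv sE]]; exists v.
Qed.

Lemma aq_presE f P (w : quasi P) (a : str P) :
  presented true (fun=> false) f w a <-> aq_pres f w.
Proof.
split=> [[adm hw _ link]|[[adm hw _] link]]; split=> //.
- split=> //; first by move=> r rn; exact: hw.
  by move=> r /link[v [hv sE _]]; exists v.
- by move=> r /link[v [hv sE /(_ isT)]]; exists v.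
- by move=> r rn _; exact: hw.
- move=> r /link[v [hv wE]]; exists v; split=> //.
  exact: (existT_inj1 wE).
Qed.

(** A [q_2]-presentation has an independent quasi-structure only at stage 2; at the later stages it
    is induced by the structures. *)
Definition quasi_from3 P (w : quasi_data (csys P 2)) (a : str P) : quasi P :=
  fun r => match r return quasi_data (csys P r) with
    | 2 => w | r' => quasi_of_str (a r') end.

Lemma q2_pres_presented f P (w : quasi_data (csys P 2)) (a : str P) :
  q2_pres f w a -> presented false (fun r => (3 <= r)%N) f (quasi_from3 w a) a.
Proof.
move=> [adm [hw ha] [link2 link] red]; split=> //.
- by move=> [|[|[|r]]] // _ nr; case: nr.
- move=> [|[|[|r]]] // rn _; split=> //; [exact: ha|by move=> _; exact: red].
- move=> [|[|[|r]]] // rn.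
    by have [v [hv sE]] := link2; exists v.
  by have [v [hv sE]] := link r.+3 rn; exists v.
Qed.

Lemma presented_q2_pres f P (w : quasi P) (a : str P) : (2 < n)%N ->
  presented false (fun r => (3 <= r)%N) f w a -> q2_pres f (w 2) a.
Proof.
move=> n3 [adm hw ha link]; split=> //.
- split; first by apply: (hw 2) => //; exact: (ltnW n3).
  by move=> r /andP[r3 rn]; have [] := ha r; rewrite // (ltnW r3).
- split; first by have [v [hv sE _]] := link 2 n3; exists v.
  move=> r /andP[r3 rn]; have r2 : (2 <= r < n)%N by rewrite (ltnW r3).
  have r2n : (2 <= r <= n)%N by rewrite (ltnW r3) ltnW.
  by have [_ <- _] := ha r r2n r3; have [v [hv sE _]] := link r r2; exists v.
- by move=> r /andP[r3 rn]; have [||_ _] := ha r; rewrite ?(ltnW r3) // => /(_ r3).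
Qed.

Lemma st_presE f P (w : quasi P) (a : str P) :
  (presented false (fun=> true) f w a /\ imc 1 (csys P 2) -> st_pres f a) /\
  (st_pres f a -> presented false (fun=> true) f (fun r => quasi_of_str (a r)) a).
Proof.
split=> [[[adm _ ha link] i2]|[[adm i2] ha link red]]; split=> //.
- by move=> r /ha/(_ isT)[].
- move=> r /andP[r2 rn]; have r2n : (2 <= r <= n)%N by rewrite r2 ltnW.
  have [_ wE _] := ha r r2n isT; rewrite -wE.
  by have [|v [hv sE _]] := link r; [rewrite r2|exists v].
- by move=> r /andP[r3 rn]; have [||_ _] := ha r; rewrite ?(ltnW r3) // => /(_ r3).
- by move=> r rn _; split=> // [|r3]; [exact: ha|apply: red; case/andP: rn => _ ->; rewrite r3].
- by move=> r /link[v [hv sE]]; exists v.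
Qed.

(** Symbols without structures take constant maps as default structure data; for [st] and its dotted
    forms the quasi-structures are those induced by the structures. *)
Lemma presentationE f star P : (2 < n)%N -> presentation f star P <->
  exists (w : quasi P) (a : str P),
  [/\ presented (star_iterated star) (star_structured star) f w a,
      star_imc star -> imc 1 (csys P 2)
    & [/\ star_reduced star -> reduced (csys P 2),
        star_reduced_quasi star -> reduced_quasi (w 2)
      & star_reduced_str star -> reduced_str (a 2)]].
Proof.
move=> n3; pose a0 : str P := fun _ _ _ => point.
case: star => /=; split.
- by move=> [w /(q_presE f w a0) h]; exists w, a0.
- by move=> [w [a [/q_presE h _ _]]]; exists w.
- by move=> [w /(aq_presE f w a0) h]; exists w, a0.
- by move=> [w [a [/aq_presE h _ _]]]; exists w.
- by move=> [w [a /q2_pres_presented h]]; exists (quasi_from3 w a), a.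
- by move=> [w [a [/(presented_q2_pres n3) h _ _]]]; exists (w 2), a.
- by move=> [w [/(q_presE f w a0) h i]]; exists w, a0.
- by move=> [w [a [/q_presE h /(_ isT) i _]]]; exists w.
- by move=> [w [/(q_presE f w a0) h i r]]; exists w, a0.
- by move=> [w [a [/q_presE h /(_ isT) i [/(_ isT) r _ _]]]]; exists w.
- by move=> [w [/(q_presE f w a0) h i r rq]]; exists w, a0.
- by move=> [w [a [/q_presE h /(_ isT) i [/(_ isT) r /(_ isT) rq _]]]]; exists w.
- by move=> [w [/(aq_presE f w a0) h i]]; exists w, a0.
- by move=> [w [a [/aq_presE h /(_ isT) i _]]]; exists w.
- by move=> [w [/(aq_presE f w a0) h i r]]; exists w, a0.
- by move=> [w [a [/aq_presE h /(_ isT) i [/(_ isT) r _ _]]]]; exists w.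
- by move=> [w [/(aq_presE f w a0) h i r rq]]; exists w, a0.
- by move=> [w [a [/aq_presE h /(_ isT) i [/(_ isT) r /(_ isT) rq _]]]]; exists w.
- by move=> [a h]; have [_ /(_ h) p] := st_presE f (fun r => quasi_of_str (a r)) a;
  have [[_ i] _ _ _] := h; exists (fun r => quasi_of_str (a r)), a.
- by move=> [w [a [h /(_ isT) i _]]]; exists a; apply: (st_presE f w a).1.
- by move=> [a [h red]]; have [_ /(_ h) p] := st_presE f (fun r => quasi_of_str (a r)) a;
  have [[_ i] _ _ _] := h; exists (fun r => quasi_of_str (a r)), a.
- by move=> [w [a [h /(_ isT) i [/(_ isT) red _ _]]]]; exists a; split=> //;
  apply: (st_presE f w a).1.
- by move=> [a [h red reds]]; have [_ /(_ h) p] := st_presE f (fun r => quasi_of_str (a r)) a;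
  have [[_ i] _ _ _] := h; exists (fun r => quasi_of_str (a r)), a.
- by move=> [w [a [h /(_ isT) i [/(_ isT) red _ /(_ isT) reds]]]]; exists a; split=> //;
  apply: (st_presE f w a).1.
Qed.

Lemma presentation_homotopic (f f' : maps) star P : (2 < n)%N ->
  (forall i, (1 <= i <= n.+1)%N -> well_pointed R (X i)) ->
  (forall i, (1 <= i <= n)%N -> @f i =h @f' i) ->
  presentation f star P ->
  exists P', presentation f' star P' /\ pres_map P =h pres_map P'.
Proof.
move=> n3 wX ff' /(presentationE _ _ _ n3)[w [a [h i [r rq rs]]]].
have [||||P' [w' [a' [h' i' [r' rq' rs'] hom]]]] :=
    presentation_transfer n3 wX ff' h (red := star_reduced star)
      (redq := star_reduced_quasi star) (reds := star_reduced_str star).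
- by case: (star).
- exact: r.
- by move=> hq; split; last exact: (rq hq); case: (star) hq.
- by move=> hs; split; last exact: (rs hs); case: (star) hs.
exists P'; split=> //; apply/(presentationE _ _ _ n3).
by exists w', a'; split=> // /i.
Qed.

End Symbols.

Theorem theorem6p1 (R : realType) (n : nat) (hn : (3 <= n)%N)
    (X : nat -> ptopologicalType)
    (hX : forall i : nat, (1 <= i <= n.+1)%N -> well_pointed R (X i))
    (m : nat -> nat)
    (f f' : forall i : nat, Susp R (m i) (X i) -> X i.+1)
    (hf : forall i : nat, (1 <= i <= n)%N -> pointed_map (f i))
    (hf' : forall i : nat, (1 <= i <= n)%N -> pointed_map (f' i))
    (hff' : forall i : nat, (1 <= i <= n)%N -> homotopic R (f i) (f' i))
    (star : symbol) :
  bracket n f star = bracket n f' star.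
Proof.
(* One inclusion, stated for an arbitrary pair of sequences; symmetry of homotopy then gives the
   other. *)
have sub (g g' : forall i : nat, Susp R (m i) (X i) -> X i.+1) :
    (forall i : nat, (1 <= i <= n)%N -> homotopic R (g i) (g' i)) ->
    bracket n g star `<=` bracket n g' star.
  move=> gg' K [P [hP ->]].
  have [P' [hP' hom]] := presentation_homotopic hn hX gg' hP.
  by exists P'; split=> //; exact: hclass_eq.
by rewrite eqEsubset; split; apply: sub => // i /hff' /hsym.
Qed.
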